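(* In the finite-stratum model described in the context, the target $\Psi$ (value of an optimal individualized treatment rule) is directionally pathwise differentiable with derivative $\gamma(h)=\mathbb E\{(q(X)-\Psi(P))h\}+\sum_xp_x\max_{a\in\mathcal A^*(x)}\dot\mu_{a,h}(x)$, and its unique maximal linearity subspace is $$\mathcal H_\kappa=\{h\in\mathcal T:\dot\mu_{a,h}(x)=\dot\mu_{b,h}(x)\text{ for every }x\text{ and }a,b\in\mathcal A^*(x)\}.$$ The efficient influence function relative to $\mathcal H_\kappa$ and its variance bound are $$\tilde\psi_\kappa(O)=q(X)-\Psi(P)+\sum_aw_a^*(X)R_a(O),\qquad V_\kappa=\operatorname{Var}\{q(X)\}+\sum_xp_x\Big\{\sum_{a\in\mathcal A^*(x)}\frac{\pi_a(x)}{\sigma_a^2(x)}\Big\}^{-1}.$$ Every estimator regular along $\mathcal H_\kappa$ has a limit law $N(0,V_\kappa)*M$ for some probability law $M$. For any optimal rule $d$, the cone $C_d$ spans $\mathcal T$, and every estimator regular along $C_d$ has a limit law $N(0,V_d)*M_d$ for some probability law $M_d$, where $$V_d=\operatorname{Var}\{q(X)\}+\sum_xp_xc_{d(x)}(x),\qquad V_d-V_\kappa=\sum_xp_x\Big[c_{d(x)}(x)-\Big\{\sum_{a\in\mathcal A^*(x)}c_a(x)^{-1}\Big\}^{-1}\Big].$$ The variance increase $V_d-V_\kappa$ is strictly positive if at least one stratum has more than one best treatment, and is zero otherwise.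
   Context: Model. $O=(X,A,Y)$ with $X\in\{1,\dots,J\}$, $A\in\{1,\dots,K\}$, $Y\in\mathbb R$. For fixed $B_0<\infty$, $\epsilon>0$, $\mathcal P$ is the set of all laws $Q$ of $O$ with $|Y|\le B_0$ and $\pi_{a,Q}(X):=Q(A=a\mid X)\ge\epsilon$ for all $a$. $P\in\mathcal P$ is fixed with $\pi_a(X):=P(A=a\mid X)\ge\epsilon+\eta$ for some $\eta>0$, $p_x:=P(X=x)>0$ for every $x$, and $\sigma_a^2(x):=\operatorname{Var}(Y\mid X=x,A=a)>0$. Data are i.i.d.; $\mathcal T=L_2^0(P)$ (mean-zero square-integrable functions of $O$, inner product $\langle f,g\rangle=\mathbb E fg$). $\mu_a(x)=\mathbb E[Y\mid X=x,A=a]$, $q(x)=\max_{a\le K}\mu_a(x)$, $\Psi(P)=\mathbb E\,q(X)$ (and similarly under $Q$), $\mathcal A^*(x)=\arg\max_a\mu_a(x)$, $R_a(O)=\frac{\mathbf 1\{A=a\}}{\pi_a(X)}\{Y-\mu_a(X)\}$, $c_a(x)=\sigma_a^2(x)/\pi_a(x)$, $\dot\mu_{a,h}(x)=\mathbb E\{R_ah\mid X=x\}$. Weights: $w_a^*(x)=c_a(x)^{-1}/\sum_{b\in\mathcal A^*(x)}c_b(x)^{-1}$ for $a\in\mathcal A^*(x)$, and $w_a^*(x)=0$ otherwise. An optimal rule is $d:\{1,\dots,J\}\to\{1,\dots,K\}$ with $d(x)\in\mathcal A^*(x)$ for every $x$; $C_d=\{h\in\mathcal T:\dot\mu_{d(x),h}(x)\ge\dot\mu_{a,h}(x)\text{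 for every }x\text{ and }a\in\mathcal A^*(x)\}$. A DQM path with score $h$ is a map $t\mapsto P_{t,h}\in\mathcal P$, $t\in[0,\varepsilon)$, $P_{0,h}=P$, with $\int[(dP_{t,h}^{1/2}-dP^{1/2})/t-\tfrac12h\,dP^{1/2}]^2\to0$; $P_{n,h}:=P_{n^{-1/2},h}$, $P^n_{n,h}$ its $n$-fold product. $\Psi$ has directional derivative $\gamma$ if $t^{-1}\{\Psi(P_{t,h})-\Psi(P)\}\to\gamma(h)$ for every $h\in\mathcal T$ and every DQM path with score $h$. A linearity subspace is a linear subspace of $\mathcal T$ on which $\gamma$ is linear; the efficient influence function relative to $\mathcal H_\kappa$ is the Riesz representer $\tilde\psi_\kappa\in\mathcal H_\kappa$ of $\gamma|_{\mathcal H_\kappa}$, $V_\kappa=\|\tilde\psi_\kappa\|^2$. An estimator sequence $T_n$ is regular along a convex cone $C$ with limit law $L$ if $\sqrt n\{T_n-\Psi(P_{n,h})\}\rightsquigarrow L$ under $P^n_{n,h}$ for all $h\in C$ and all DQM paths with score $h$. *)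

(* Defs.v *)
From HB Require Import structures.
From mathcomp Require Import all_boot all_order all_algebra.
From mathcomp Require Import all_classical all_reals all_analysis.

Set Implicit Arguments.
Unset Strict Implicit.
Unset Printing Implicit Defensive.

Import Order.TTheory GRing.Theory Num.Theory.
Import numFieldNormedType.Exports.

Local Open Scope classical_set_scope.
Local Open Scope ring_scope.

HB.instance Definition _ (n : nat) := isPointed.Build 'I_n.+1 ord0.

HB.instance Definition _ (n : nat) := @isMeasurable.Build
  default_measure_display 'I_n.+1 discrete_measurable discrete_measurable0
  discrete_measurableC discrete_measurableU.

Section iid_sampling.
Context d (T : measurableType d) (R : realType).

Definition cons_tuple n (z : T * n.-tuple T) : n.+1.-tuple T :=
  [tuple of z.1 :: z.2].

Lemma measurable_cons_tuple n : measurable_fun setT (@cons_tuple n).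
Proof. exact: (measurable_cons measurable_fst measurable_snd). Qed.

HB.instance Definition _ n :=
  isMeasurableFun.Build _ _ _ _ (@cons_tuple n) (@measurable_cons_tuple n).

(* The n-fold product law of Q. *)
Fixpoint iid (Q : probability T R) (n : nat) : probability (n.-tuple T) R :=
  match n with
  | 0 => \d_ [tuple]
  | m.+1 => distribution (Q \x iid Q m)%E (@cons_tuple m)
  end.

End iid_sampling.

Section laws.
Context (R : realType).

(* Weak convergence to L of the law of [Z n] under [Q n]. *)
Definition cvg_in_law (d : nat -> measure_display)
    (Om : forall n, measurableType (d n)) (Q : forall n, probability (Om n) R)
    (Z : forall n, Om n -> R) (L : probability (measurableTypeR R) R) : Prop :=
  forall f : R -> R, continuous f -> (exists M : R, forall y, `|f y| <= M) ->
    (fun n => 'E_(Q n)[f \o Z n])%E @ \oo --> ('E_L[f])%E.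

Definition convolution (L M : probability (measurableTypeR R) R) :
    set (measurableTypeR R) -> \bar R :=
  pushforward (L \x M)%E (fun z => z.1 + z.2 : measurableTypeR R).

(* The centered normal law with variance V; [normal_prob] takes the standard
   deviation. *)
Definition centered_normal (V : R) : probability (measurableTypeR R) R :=
  normal_prob 0 (Num.sqrt V).

Definition is_normal_convolution (V : R) (L : probability (measurableTypeR R) R) : Prop :=
  exists M : probability (measurableTypeR R) R,
    forall B, measurable B -> L B = convolution (centered_normal V) M B.

End laws.

Section function_spaces.
Context d (T : measurableType d) (R : realType).
Implicit Types (P : probability T R) (S C : set (T -> R)) (g : (T -> R) -> R).

(* L_2^0(P), as a space of functions rather than of P-almost-sure classes. *)
Definition tangent P : set (T -> R) :=
  [set h | h \in Lfun P 2%:E /\ ('E_P[h] = 0)%E].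

Definition linear_subspace S : Prop :=
  S 0 /\ forall (a : R) (f h : T -> R), S f -> S h -> S (a *: f + h).

Definition linear_on S g : Prop :=
  forall (a : R) (f h : T -> R), S f -> S h -> g (a *: f + h) = a * g f + g h.

Definition convex_cone C : Prop :=
  [/\ C !=set0,
      forall (a : R) (h : T -> R), 0 < a -> C h -> C (a *: h) &
      forall f h : T -> R, C f -> C h -> C (f + h)].

Definition linear_span C : set (T -> R) :=
  [set h | exists (n : nat) (a : 'I_n -> R) (f : 'I_n -> T -> R),
    (forall i, C (f i)) /\ h = \sum_(i < n) a i *: f i].

Definition linearity_subspace P g S : Prop :=
  [/\ S `<=` tangent P, linear_subspace S & linear_on S g].

Definition maximal_linearity_subspace P g S : Prop :=
  linearity_subspace P g S /\
  forall S', linearity_subspace P g S' -> S `<=` S' -> S' = S.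

Definition unique_maximal_linearity_subspace P g S : Prop :=
  maximal_linearity_subspace P g S /\
  forall S', maximal_linearity_subspace P g S' -> S' = S.

(* The representer is determined up to P-almost-sure equality. *)
Definition riesz_representer P g S (psi : T -> R) : Prop :=
  S psi /\ forall h, S h -> ('E_P[psi \* h] = (g h)%:E)%E.

End function_spaces.

(* An observation o = (X, A, Y) has X = o.1.1, A = o.1.2 and Y = o.2.  There
   are J.+1 >= 1 strata and K.+1 >= 1 treatments. *)
Section functionals.
Context (R : realType) (J K : nat).
Notation O := ('I_J.+1 * 'I_K.+1 * R)%type.
Implicit Types (Q P : probability O R) (x : 'I_J.+1) (a b : 'I_K.+1)
  (h : O -> R).

(* E_Q[f | E]; this is 0 when Q E = 0. *)
Definition cond_exp Q (f : O -> R) (E : set O) : R :=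
  fine ('E_Q[f \* \1_E])%E / fine (Q E).

Definition stratum x : set O := [set o | o.1.1 = x].
Definition cell x a : set O := [set o | o.1.1 = x /\ o.1.2 = a].

Definition pX Q x : R := fine (Q (stratum x)).
Definition propensity Q a x : R := fine (Q (cell x a)) / pX Q x.
Definition mu Q a x : R := cond_exp Q (fun o => o.2) (cell x a).
Definition sigma2 Q a x : R :=
  cond_exp Q (fun o => (o.2 - mu Q a x) ^+ 2) (cell x a).
Definition qmax Q x : R := sup (range (fun a => mu Q a x)).
Definition Psi Q : R := fine ('E_Q[fun o : O => qmax Q o.1.1])%E.
Definition best Q x : {set 'I_K.+1} :=
  [set a | [forall b, mu Q b x <= mu Q a x]]%SET.

Definition resid P a (o : O) : R :=
  (o.1.2 == a)%:R / propensity P a o.1.1 * (o.2 - mu P a o.1.1).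
Definition cvar P a x : R := sigma2 P a x / propensity P a x.
Definition mudot P a h x : R := cond_exp P (resid P a \* h) (stratum x).
Definition weight P a x : R :=
  if a \in best P x
  then (cvar P a x)^-1 / \sum_(b in best P x) (cvar P b x)^-1 else 0.

(* The suprema here and in [qmax] are maxima over nonempty finite sets. *)
Definition gamma P h : R :=
  fine ('E_P[fun o : O => ((qmax P o.1.1 - Psi P) * h o)%R])%E
  + \sum_x pX P x * sup [set mudot P a h x | a in [set` best P x]].

Definition Hkappa P : set (O -> R) :=
  [set h | tangent P h /\ forall x a b, a \in best P x -> b \in best P x ->
     mudot P a h x = mudot P b h x].

Definition psi_kappa P (o : O) : R :=
  qmax P o.1.1 - Psi P + \sum_a weight P a o.1.1 * resid P a o.

Definition var_q P : R := fine ('V_P[fun o : O => qmax P o.1.1])%E.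

Definition Vkappa P : R :=
  var_q P + \sum_x pX P x *
    (\sum_(a in best P x) propensity P a x / sigma2 P a x)^-1.

Definition optimal_rule P (d : 'I_J.+1 -> 'I_K.+1) : Prop :=
  forall x, d x \in best P x.

Definition Ccone P (d : 'I_J.+1 -> 'I_K.+1) : set (O -> R) :=
  [set h | tangent P h /\ forall x a, a \in best P x ->
     mudot P a h x <= mudot P (d x) h x].

Definition Vrule P (d : 'I_J.+1 -> 'I_K.+1) : R :=
  var_q P + \sum_x pX P x * cvar P (d x) x.

End functionals.

Section model.
Context (R : realType) (J K : nat) (B0 eps : R).
Notation O := ('I_J.+1 * 'I_K.+1 * R)%type.
Implicit Types (Q P : probability O R) (h : O -> R).

(* Propensities are only constrained on strata of positive probability. *)
Definition in_model Q : Prop :=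
  Q [set o : O | `|o.2| <= B0] = 1%E /\
  forall x a, 0 < pX Q x -> eps <= propensity Q a x.

Definition is_density (nu : {sigma_finite_measure set O -> \bar R}) Q
    (f : O -> R) : Prop :=
  [/\ measurable_fun setT f, forall o, 0 <= f o &
      forall B, measurable B -> Q B = (\int[nu]_(o in B) (f o)%:E)%E].

(* [nu t] is an arbitrary measure dominating both [Pt t] and P; the integral
   does not depend on its choice.  Values of [Pt] outside [0, e) are
   irrelevant. *)
Definition dqm_path P h (Pt : R -> probability O R) : Prop :=
  exists (e : R) (nu : R -> {sigma_finite_measure set O -> \bar R})
         (f g : R -> O -> R),
  [/\ 0 < e,
      forall t : R, 0 <= t < e ->
        [/\ in_model (Pt t), is_density (nu t) (Pt t) (f t) &
            is_density (nu t) P (g t)],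
      forall B, measurable B -> Pt 0 B = P B &
      (fun t => \int[nu t]_o
         (((Num.sqrt (f t o) - Num.sqrt (g t o)) / t
           - 2^-1 * h o * Num.sqrt (g t o)) ^+ 2)%R%:E)%E @ 0^'+ --> 0%E].

Definition directional_derivative P (g : (O -> R) -> R) : Prop :=
  forall h Pt, tangent P h -> dqm_path P h Pt ->
    t^-1 * (Psi (Pt t) - Psi P) @[t --> 0^'+] --> g h.

Definition local_law (Pt : R -> probability O R) (n : nat) : probability O R :=
  Pt (Num.sqrt n%:R)^-1.

(* [Tn n] is a statistic of a sample of size n. *)
Definition regular_along P (C : set (O -> R)) (Tn : forall n, n.-tuple O -> R)
    (L : probability (measurableTypeR R) R) : Prop :=
  forall h Pt, C h -> dqm_path P h Pt ->
    cvg_in_law (fun n => iid (local_law Pt n) n)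
      (fun n (s : n.-tuple O) =>
         Num.sqrt n%:R * (Tn n s - Psi (local_law Pt n))) L.

End model.

(* Main.v *)
(* On bounded outcomes, the Hellinger differentiability of a path passes to the
   expectations of bounded functions, hence to each mu_a(x), and Danskin's
   theorem for the maximum over a gives the directional derivative.

   The convolution theorems need only the paths of score s psi with s >= 0, where
   psi is the efficient score (relative to H_kappa, or along a fixed optimal
   rule d): psi is bounded up to a null set, so these paths can be taken to be
   exponential tilts.  Along them the localized experiment is asymptotically a
   Gaussian shift of which only the half-line s >= 0 is available.  Averaging the
   regularity hypothesis over s in [0, tau] with flat weight, completing the
   square in s, and letting n and then tau tend to infinity shows that L is a
   limit of averages of translates of N(0, V); a limit of the averaging measures
   along an ultrafilter is the law M.  It has no mass at infinity because L has
   none. *)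
Require Import Defs.
From HB Require Import structures.
From mathcomp Require Import all_boot all_order all_algebra.
From mathcomp Require Import all_classical all_reals all_analysis.
From mathcomp Require Import measurable_realfun ring lra.

Set Implicit Arguments.
Unset Strict Implicit.
Unset Printing Implicit Defensive.

Import Order.TTheory GRing.Theory Num.Theory.
Import numFieldNormedType.Exports.

Local Open Scope classical_set_scope.
Local Open Scope ring_scope.

(** The flat weight on $[0,\tau]$ works because, for a sample whose maximizer $s=D/V$ is well inside
    the window, the integral over $s$ is almost a full Gaussian integral, and for one well outside
    it almost vanishes. The two edges cost a fixed multiple of [gauss_mass V] in mean, hence
    $O(1/\tau)$ after normalization. The likelihood ratio is written with the quadratic term
    $s^2V/2$ in place of the log moment generating function. The Gaussian identity is then exact for
    every sample, only the mean of the ratio has to converge, and no joint limit law of statistic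
    and score is extracted. Functions are bounded everywhere and not only almost surely, so that
    exponentials of scores are integrable without side conditions. The outcome is therefore
    truncated at $B_0$, and the literal influence function is compared with its truncated version up
    to a null set. Test functions are Lipschitz, so that centring errors of order $o(1)$ are
    harmless. *)

(** * Integration of bounded measurable functions *)

Definition bounded_measurable d (T : measurableType d) (R : realType)
    (f : T -> R) : Prop :=
  measurable_fun setT f /\ exists M : R, forall x, `|f x| <= M.

Section bounded_measurable.
Context d (T : measurableType d) (R : realType).
Implicit Types f g : T -> R.

Lemma bm_bound_gt0 f : bounded_measurable f ->
  exists2 M : R, 0 < M & forall x, `|f x| <= M.
Proof.
move=> [_ [M fM]]; exists (`|M| + 1); first by rewrite ltr_wpDl.
by move=> x; apply: (le_trans (fM x)); rewrite ler_wpDr// ler_norm.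
Qed.

Lemma bm_cst (c : R) : bounded_measurable (fun _ : T => c).
Proof. by split; [exact: measurable_cst|exists `|c|]. Qed.

Lemma bmD f g : bounded_measurable f -> bounded_measurable g ->
  bounded_measurable (fun x => f x + g x).
Proof.
move=> [mf [M fM]] [mg [N gN]]; split; first exact: measurable_funD.
by exists (M + N) => x; apply: (le_trans (ler_normD _ _)); exact: lerD.
Qed.

Lemma bmN f : bounded_measurable f -> bounded_measurable (fun x => - f x).
Proof.
move=> [mf [M fM]]; split; first exact: measurableT_comp.
by exists M => x; rewrite normrN.
Qed.

Lemma bmB f g : bounded_measurable f -> bounded_measurable g ->
  bounded_measurable (fun x => f x - g x).
Proof. by move=> bf bg; apply: bmD => //; exact: bmN. Qed.

Lemma bmM f g : bounded_measurable f -> bounded_measurable g ->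
  bounded_measurable (fun x => f x * g x).
Proof.
move=> [mf [M fM]] [mg [N gN]]; split; first exact: measurable_funM.
by exists (M * N) => x; rewrite normrM; exact: ler_pM.
Qed.

Lemma bm_indic (A : set T) : measurable A -> bounded_measurable (\1_A : T -> R).
Proof.
move=> mA; split; first exact: measurable_indic.
by exists 1 => x; rewrite indicE; case: (_ \in _); rewrite ?normr1 ?normr0.
Qed.

Lemma bm_sum (I : Type) (r : seq I) (p : pred I) (F : I -> T -> R) :
  (forall i, p i -> bounded_measurable (F i)) ->
  bounded_measurable (fun x => \sum_(i <- r | p i) F i x).
Proof.
move=> bF; elim: r => [|i r IH].
  have -> : (fun x => \sum_(i <- [::] | p i) F i x) = fun=> 0.
    by apply/funext => x; rewrite big_nil.
  exact: bm_cst.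
have -> : (fun x => \sum_(j <- i :: r | p j) F j x) = fun x =>
    if p i then F i x + \sum_(j <- r | p j) F j x else \sum_(j <- r | p j) F j x.
  by apply/funext => x; rewrite big_cons.
by case: (p i) (bF i) => [/(_ isT) bi|_//]; exact: bmD.
Qed.

Lemma bm_expR f : bounded_measurable f -> bounded_measurable (fun x => expR (f x)).
Proof.
move=> [mf [M fM]]; split; first exact: measurableT_comp.
exists (expR M) => x; rewrite ger0_norm ?expR_ge0// ler_expR.
exact: le_trans (ler_norm _) (fM x).
Qed.

Lemma bm_norm f : bounded_measurable f -> bounded_measurable (fun x => `|f x|).
Proof.
move=> [mf [M fM]]; split; first exact: measurableT_comp.
by exists M => x; rewrite normr_id.
Qed.

Lemma bm_comp d' (T' : measurableType d') (h : T' -> T) f :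
  measurable_fun setT h -> bounded_measurable f ->
  bounded_measurable (fun x => f (h x)).
Proof.
move=> mh [mf [M fM]]; split; first exact: measurableT_comp mf mh.
by exists M => x.
Qed.

Variable mu : {finite_measure set T -> \bar R}.

Lemma bm_integrable f : bounded_measurable f ->
  mu.-integrable setT (EFin \o f).
Proof.
move=> [mf [M fM]]; apply: measurable_bounded_integrable => //.
  exact: fin_num_fun_lty.
exists `|M|; split => // y My x _ /=; apply: (le_trans (fM x)).
exact: le_trans (ler_norm _) (ltW My).
Qed.

Lemma bm_int_fin f : bounded_measurable f ->
  (\int[mu]_x (f x)%:E = (\int[mu]_x f x)%:E)%E.
Proof.
move=> bf; rewrite /Rintegral fineK//.
by apply: integrable_fin_num => //; exact: bm_integrable.
Qed.

Lemma RintD f g : bounded_measurable f -> bounded_measurable g ->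
  \int[mu]_x (f x + g x) = \int[mu]_x f x + \int[mu]_x g x.
Proof. by move=> bf bg; apply: RintegralD => //; exact: bm_integrable. Qed.

Lemma RintB f g : bounded_measurable f -> bounded_measurable g ->
  \int[mu]_x (f x - g x) = \int[mu]_x f x - \int[mu]_x g x.
Proof. by move=> bf bg; apply: RintegralB => //; exact: bm_integrable. Qed.

Lemma RintZl f (c : R) : bounded_measurable f ->
  \int[mu]_x (c * f x) = c * \int[mu]_x f x.
Proof. by move=> bf; apply: RintegralZl => //; exact: bm_integrable. Qed.

Lemma RintZr f (c : R) : bounded_measurable f ->
  \int[mu]_x (f x * c) = \int[mu]_x f x * c.
Proof. by move=> bf; apply: RintegralZr => //; exact: bm_integrable. Qed.

Lemma Rint_sum (I : Type) (r : seq I) (p : pred I) (F : I -> T -> R) :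
  (forall i, p i -> bounded_measurable (F i)) ->
  \int[mu]_x (\sum_(i <- r | p i) F i x) = \sum_(i <- r | p i) \int[mu]_x F i x.
Proof.
move=> bF; elim: r => [|i r IH].
  under eq_Rintegral do rewrite big_nil.
  by rewrite big_nil Rintegral_cst// mul0r.
under eq_Rintegral do rewrite big_cons.
rewrite big_cons; case: ifPn => // pi; rewrite RintD ?IH//; first exact: bF.
exact: bm_sum.
Qed.

Lemma Rint_le f g : bounded_measurable f -> bounded_measurable g ->
  (forall x, f x <= g x) -> \int[mu]_x f x <= \int[mu]_x g x.
Proof. by move=> bf bg fg; apply: le_Rintegral => //; exact: bm_integrable. Qed.

Lemma Rint_norm f : bounded_measurable f ->
  `|\int[mu]_x f x| <= \int[mu]_x `|f x|.
Proof. by move=> bf; apply: le_normr_Rintegral => //; exact: bm_integrable. Qed.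

Lemma Rint_indic (A : set T) : measurable A ->
  \int[mu]_x (\1_A x : R) = fine (mu A).
Proof. by move=> mA; rewrite /Rintegral integral_indic// setIT. Qed.

Lemma Rint_ae f g : measurable_fun setT f -> measurable_fun setT g ->
  {ae mu, forall x, f x = g x} -> \int[mu]_x f x = \int[mu]_x g x.
Proof.
move=> mf mg fg; congr fine; apply: ae_eq_integral => //;
  [exact/measurable_EFinP|exact/measurable_EFinP|].
by apply: filterS fg => x fgx _; rewrite /= fgx.
Qed.

End bounded_measurable.

Section expectation_Rintegral.
Context d (T : measurableType d) (R : realType) (P : probability T R).

Lemma Rint_cst (c : R) : \int[P]_x c = c.
Proof. by rewrite /Rintegral integral_cst//= probability_setT mule1. Qed.

Lemma bm_expectation (f : T -> R) : bounded_measurable f ->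
  ('E_P[f] = (\int[P]_x f x)%:E)%E.
Proof. by move=> bf; rewrite unlock bm_int_fin. Qed.

Lemma Rint_le_cst (f : T -> R) (c : R) : bounded_measurable f ->
  (forall x, f x <= c) -> \int[P]_x f x <= c.
Proof.
by move=> bf fc; rewrite -[leRHS]Rint_cst; apply: Rint_le => //; exact: bm_cst.
Qed.

Lemma Rint_norm_le_cst (f : T -> R) (c : R) : bounded_measurable f ->
  (forall x, `|f x| <= c) -> `|\int[P]_x f x| <= c.
Proof.
move=> bf fc; apply: (le_trans (Rint_norm P bf)).
by apply: Rint_le_cst => //; exact: bm_norm.
Qed.

End expectation_Rintegral.

Section product.
Context d d' (T : measurableType d) (T' : measurableType d') (R : realType)
  (P : probability T R) (Q : probability T' R).

Lemma Rint_prod (f : T * T' -> R) : bounded_measurable f ->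
  bounded_measurable (fun x => \int[Q]_y f (x, y)) /\
  \int[(P \x Q)%E]_z f z = \int[P]_x \int[Q]_y f (x, y).
Proof.
move=> bf.
have bfx x : bounded_measurable (fun y => f (x, y)).
  by apply: bm_comp => //; exact: measurable_fun_pair.
have intf : (P \x Q)%E.-integrable setT (EFin \o f).
  exact: (@bm_integrable _ _ _ ((P \x Q)%E : probability (T * T')%type R)).
have FE x : fubini_F Q (EFin \o f) x = (\int[Q]_y f (x, y))%:E.
  by rewrite /fubini_F /= bm_int_fin.
split.
  split.
    apply/measurable_EFinP.
    rewrite (_ : _ \o _ = fubini_F Q (EFin \o f)); last first.
      by apply/funext => x; rewrite FE.
    exact: measurable_fubini_F intf.
  have [M M0 fM] := bm_bound_gt0 bf; exists M => x.
  exact: Rint_norm_le_cst.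
rewrite /Rintegral -(integral12_prod_meas1 intf).
by congr fine; apply: eq_integral => x _; rewrite FE.
Qed.

Lemma Rint_prodr (f : T * T' -> R) : bounded_measurable f ->
  \int[(P \x Q)%E]_z f z = \int[Q]_y \int[P]_x f (x, y).
Proof.
move=> bf.
have bfy y : bounded_measurable (fun x => f (x, y)).
  by apply: bm_comp => //; exact: measurable_fun_pair.
have intf : (P \x Q)%E.-integrable setT (EFin \o f).
  exact: (@bm_integrable _ _ _ ((P \x Q)%E : probability (T * T')%type R)).
rewrite /Rintegral -(integral21_prod_meas1 intf).
congr fine; apply: eq_integral => y _.
by rewrite /fubini_G /= bm_int_fin.
Qed.

End product.

Lemma Rint_distribution d d' (T : measurableType d) (T' : measurableType d')
    (R : realType) (P : probability T' R)
    (X : {mfun T' >-> T}) (f : T -> R) : bounded_measurable f ->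
  \int[distribution P X]_y f y = \int[P]_x f (X x).
Proof.
move=> bf; congr fine; rewrite integral_distribution//.
  by apply/measurable_EFinP; case: bf.
by apply: (bm_integrable P); apply: bm_comp.
Qed.

Section iid.
Context d (T : measurableType d) (R : realType) (Q : probability T R).

Lemma Rint_iidS n (f : n.+1.-tuple T -> R) : bounded_measurable f ->
  bounded_measurable (fun x => \int[iid Q n]_s f (Defs.cons_tuple (x, s))) /\
  \int[iid Q n.+1]_s f s = \int[Q]_x \int[iid Q n]_s f (Defs.cons_tuple (x, s)).
Proof.
move=> bf.
have bf' : bounded_measurable (fun z : T * n.-tuple T => f (Defs.cons_tuple z)).
  by apply: bm_comp => //; exact: measurable_cons_tuple.
have [b1 e1] := Rint_prod Q (iid Q n) bf'; split => //.
rewrite -e1; exact: (Rint_distribution (Q \x iid Q n)%E _ bf).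
Qed.

End iid.

(** * Laws given by densities *)

Section density.
Context d (T : measurableType d) (R : realType).
Variables (nu : {sigma_finite_measure set T -> \bar R}) (Q : probability T R)
  (f : T -> R).
Hypotheses (mf : measurable_fun setT f) (f0 : forall x, 0 <= f x)
  (Qf : forall B, measurable B -> Q B = (\int[nu]_(x in B) (f x)%:E)%E).

Lemma density_integral (phi : T -> R) : Q.-integrable setT (EFin \o phi) ->
  nu.-integrable setT (EFin \o (fun x => phi x * f x)) /\
  \int[Q]_x phi x = \int[nu]_x (phi x * f x).
Proof.
move=> iphi; have mphi : measurable_fun setT phi.
  by apply/measurable_EFinP; exact: (measurable_int Q).
have mpf : measurable_fun setT (fun x => phi x * f x) by exact: measurable_funM.
have Qnu : Q `<< nu.
  apply/null_content_dominatesP => A mA A0; rewrite Qf//.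
  by apply: null_set_integral => //; exact/measurable_funTS/measurable_EFinP.
have RNf : ae_eq nu setT (Radon_Nikodym (charge_of_finite_measure Q) nu) (EFin \o f).
  apply: integral_ae_eq => //.
  - exact: Radon_Nikodym_integrable.
  - exact/measurable_EFinP.
  - by move=> E _ mE; rewrite -Radon_Nikodym_integral//= /charge_of_finite_measure Qf.
have change (u : T -> R) : Q.-integrable setT (EFin \o u) ->
    (\int[Q]_x (u x)%:E = \int[nu]_x (u x * f x)%:E)%E.
  move=> iu; have mu : measurable_fun setT u.
    by apply/measurable_EFinP; exact: (measurable_int Q).
  rewrite -(@Radon_Nikodym_change_of_variables _ _ _ Q nu Qnu (EFin \o u))//.
  apply: ae_eq_integral => //.
  - apply: emeasurable_funM; first exact/measurable_EFinP.
    by apply: (measurable_int nu); exact: Radon_Nikodym_integrable.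
  - by apply/measurable_EFinP; exact: measurable_funM.
  - by apply: filterS RNf => x /= + _ => ->.
split; last by rewrite /Rintegral change.
apply/integrableP; split; first exact/measurable_EFinP.
have iabs : Q.-integrable setT (EFin \o (fun x => `|phi x|)).
  exact: integrable_norm.
under eq_integral do rewrite /= normrM (ger0_norm (f0 _)).
by rewrite -change//; apply: integrable_lty.
Qed.

Lemma Rint_density (phi : T -> R) : bounded_measurable phi ->
  nu.-integrable setT (EFin \o (fun x => phi x * f x)) /\
  \int[Q]_x phi x = \int[nu]_x (phi x * f x).
Proof. by move=> bphi; apply: density_integral; exact: bm_integrable. Qed.

End density.

Section density_probability.
Context d (T : measurableType d) (R : realType).
Variables (P : probability T R) (f : T -> R).
Hypotheses (mf : measurable_fun setT f) (f0 : forall x, 0 <= f x)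
  (f1 : (\int[P]_x (f x)%:E = 1)%E).

(** Carrying the three proofs as arguments lets unification recover the probability structure
    declared below from the term itself. *)
Definition density_prob (mf' : measurable_fun setT f) (f0' : forall x, 0 <= f x)
    (f1' : (\int[P]_x (f x)%:E = 1)%E) (A : set T) : \bar R :=
  (\int[P]_(x in A) (f x)%:E)%E.

Local Notation dP := (density_prob mf f0 f1).

Let dP0 : dP set0 = 0%E.
Proof. by rewrite /density_prob integral_set0. Qed.

Let dP_ge0 A : (0 <= dP A)%E.
Proof. by apply: integral_ge0 => x _; rewrite lee_fin. Qed.

Let dP_sigma_additive : semi_sigma_additive dP.
Proof.
move=> F mF tF mUF; rewrite /density_prob.
rewrite ge0_integral_bigcup//.
- apply: is_cvg_ereal_nneg_natsum_cond => n _ _.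
  by apply: integral_ge0 => x _; rewrite lee_fin.
- exact/measurable_funTS/measurable_EFinP.
- by move=> x _; rewrite lee_fin.
Qed.

HB.instance Definition _ := isMeasure.Build _ _ _ dP dP0 dP_ge0 dP_sigma_additive.

Let dP_setT : dP setT = 1%E. Proof. exact: f1. Qed.

HB.instance Definition _ := @Measure_isProbability.Build _ _ R dP dP_setT.

End density_probability.

(** * Exponential tilts and their product laws *)

Section tilt.
Context d (T : measurableType d) (R : realType) (P : probability T R).
Variables (psi : T -> R) (bpsi : bounded_measurable psi).

Definition mgf (t : R) : R := \int[P]_x expR (t * psi x).

Lemma bm_exp_psi (t : R) : bounded_measurable (fun x => expR (t * psi x)).
Proof. by apply: bm_expR; apply: bmM => //; exact: bm_cst. Qed.

Lemma mgf_gt0 (t : R) : 0 < mgf t.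
Proof.
have [M M0 psiM] := bm_bound_gt0 bpsi.
apply: (@lt_le_trans _ _ (expR (- (`|t| * M)))); first exact: expR_gt0.
rewrite -[leLHS](Rint_cst P); apply: Rint_le.
- exact: bm_cst.
- exact: bm_exp_psi.
- move=> x; rewrite ler_expR lerNl; apply: (le_trans (ler_norm _)).
  by rewrite normrN normrM ler_wpM2l.
Qed.

Definition tilt_density (t : R) (x : T) : R := expR (t * psi x) / mgf t.

Lemma bm_tilt_density t : bounded_measurable (tilt_density t).
Proof. by apply: bmM; [exact: bm_exp_psi|exact: bm_cst]. Qed.

Lemma tilt_density_ge0 t x : 0 <= tilt_density t x.
Proof. by rewrite divr_ge0 ?expR_ge0// ltW// mgf_gt0. Qed.

Lemma tilt_density1 t : (\int[P]_x (tilt_density t x)%:E = 1)%E.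
Proof.
rewrite (bm_int_fin _ (bm_tilt_density t)) /tilt_density.
rewrite RintZr; last exact: bm_exp_psi.
by rewrite -/(mgf t) divff// gt_eqF// mgf_gt0.
Qed.

Definition tilt (t : R) : probability T R :=
  density_prob (bm_tilt_density t).1 (tilt_density_ge0 t) (tilt_density1 t).

Lemma tiltE t B : tilt t B = (\int[P]_(x in B) (tilt_density t x)%:E)%E.
Proof. by []. Qed.

Lemma Rint_tilt t (F : T -> R) : bounded_measurable F ->
  \int[tilt t]_x F x = (\int[P]_x (F x * expR (t * psi x))) / mgf t.
Proof.
move=> bF.
have [_ ->] := Rint_density (bm_tilt_density t).1 (tilt_density_ge0 t)
  (fun B _ => tiltE t B) bF.
under eq_Rintegral do rewrite /tilt_density mulrA.
by rewrite RintZr//; apply: bmM => //; exact: bm_exp_psi.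
Qed.

Definition sample_sum n (s : n.-tuple T) : R := \sum_(i < n) psi (tnth s i).

Lemma bm_sample_sum n : bounded_measurable (@sample_sum n).
Proof.
apply: bm_sum => i _; apply: bm_comp => //; exact: measurable_tnth.
Qed.

Lemma sample_sumS n x (s : n.-tuple T) :
  sample_sum (Defs.cons_tuple (x, s)) = psi x + sample_sum s.
Proof.
rewrite /sample_sum big_ord_recl; congr (_ + _).
by apply: eq_bigr => i _; rewrite /Defs.cons_tuple tnthS.
Qed.

Lemma bm_exp_sum t n : bounded_measurable (fun s : n.-tuple T => expR (t * sample_sum s)).
Proof.
by apply: bm_expR; apply: bmM; [exact: bm_cst|exact: bm_sample_sum].
Qed.

(** The likelihood ratio of [n] tilted observations depends on the sample only through [sample_sum],
    and the normalizing constants multiply to an [n]-th power. The induction peels off one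
    observation by Fubini. *)
Lemma Rint_iid_tilt t n (F : n.-tuple T -> R) : bounded_measurable F ->
  \int[iid (tilt t) n]_s F s =
  (\int[iid P n]_s (F s * expR (t * sample_sum s))) / mgf t ^+ n.
Proof.
elim: n F => [|n IH] F bF.
  rewrite expr0 divr1; apply: eq_Rintegral => s _.
  by rewrite /sample_sum big_ord0 mulr0 expR0 mulr1.
have bFe : bounded_measurable (fun s : n.+1.-tuple T => F s * expR (t * sample_sum s)).
  by apply: bmM => //; exact: bm_exp_sum.
have [b1 ->] := Rint_iidS (tilt t) bF.
have [b2 ->] := Rint_iidS P bFe.
have bFx x : bounded_measurable (fun s : n.-tuple T => F (Defs.cons_tuple (x, s))).
  apply: bm_comp => //.
  by apply: (measurableT_comp (@Defs.measurable_cons_tuple _ _ _)); exact: measurable_fun_pair.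
rewrite Rint_tilt// exprS invfM mulrA mulrAC; congr (_ / _).
rewrite -RintZr//; apply: eq_Rintegral => x _.
rewrite IH// mulrAC; congr (_ / _).
rewrite -RintZr//; last by apply: bmM => //; exact: bm_exp_sum.
apply: eq_Rintegral => s _.
by rewrite sample_sumS mulrDr expRD; ring.
Qed.

End tilt.

(** * Taylor remainders and the limit of the moment generating function *)

Section expR_taylor.
Context (R : realType).
Implicit Types x : R.

(** The mean value theorem transfers a bound from the derivative to the function at the price of one
    factor [|x|]. Iterated, it gives the Taylor remainders below, without factorials since only the
    order in [x] matters. *)
Lemma derive_bound_expR (k : nat) (f df : R -> R) :
  (forall x, is_derive x 1 f (df x)) -> f 0 = 0 ->
  (forall x, `|df x| <= `|x| ^+ k * expR `|x|) ->
  forall x, `|f x| <= `|x| ^+ k.+1 * expR `|x|.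
Proof.
move=> dfE f0 dfb x.
have cf a b : {within `[a, b], continuous f}.
  apply: continuous_subspaceT => y; apply/differentiable_continuous/derivable1_diffP.
  by have [] := dfE y.
have [c cx fx] : exists2 c, `|c| <= `|x| & f x = df c * x.
  have [x0|x0] := leP 0 x.
    have [c] := MVT_segment x0 (fun y _ => dfE y) (cf _ _).
    rewrite in_itv/= f0 !subr0 => /andP[c0 cx] ->; exists c => //.
    by rewrite !ger0_norm.
  have [c] := MVT_segment (ltW x0) (fun y _ => dfE y) (cf _ _).
  rewrite in_itv/= f0 !sub0r mulrN => /andP[xc c0] /oppr_inj ->; exists c => //.
  by rewrite !ler0_norm// ?lerN2// ltW.
rewrite fx normrM exprSr mulrAC ler_wpM2r//.
apply: (le_trans (dfb c)); apply: ler_pM; rewrite ?expR_ge0 ?ler_expR//.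
by rewrite lerXn2r// nnegrE.
Qed.

Lemma expR_taylor0 x : `|expR x - 1| <= `|x| * expR `|x|.
Proof.
rewrite -[`|x| in leRHS]expr1.
apply: (@derive_bound_expR 0 (fun x => expR x - 1) expR); last 2 first.
- by rewrite expR0 subrr.
- by move=> y; rewrite expr0 mul1r ger0_norm ?expR_ge0// ler_expR ler_norm.
move=> y; rewrite -[X in is_derive _ _ _ X]subr0.
exact: is_deriveB.
Qed.

Lemma expR_taylor1 x : `|expR x - 1 - x| <= `|x| ^+ 2 * expR `|x|.
Proof.
apply: (@derive_bound_expR 1 (fun x => expR x - 1 - x) (fun x => expR x - 1)).
- move=> y; apply: is_deriveB.
  rewrite -[X in is_derive _ _ _ X]subr0; exact: is_deriveB.
- by rewrite expR0 subrr subr0.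
- by move=> y; rewrite expr1; exact: expR_taylor0.
Qed.

Lemma expR_taylor2 x :
  `|expR x - 1 - x - x ^+ 2 / 2| <= `|x| ^+ 3 * expR `|x|.
Proof.
apply: (@derive_bound_expR 2 (fun x => expR x - 1 - x - x ^+ 2 / 2)
  (fun x => expR x - 1 - x)).
- move=> y; apply: is_deriveB.
    apply: is_deriveB.
    rewrite -[X in is_derive _ _ _ X]subr0; exact: is_deriveB.
  rewrite (_ : (fun x => x ^+ 2 / 2) = fun x : R => x * x * cst (2^-1 : R) x); last first.
    by apply/funext => z; rewrite /= expr2.
  apply: is_derive_eq; rewrite /= scaler0 add0r /GRing.scale/= !mulr1.
  by field.
- by rewrite expR0 subrr expr0n/= mul0r !subr0.
- by move=> y; exact: expR_taylor1.
Qed.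

End expR_taylor.

Lemma cvg_invn (R : realType) : (n%:R : R)^-1 @[n --> \oo] --> (0 : R).
Proof.
apply/gtr0_cvgV0; last exact: cvgr_idn.
by near=> n; rewrite ltr0n; near: n; exact: nbhs_infty_gt.
Unshelve. all: by end_near. Qed.

Lemma cvg_inv_sqrtn (R : realType) : (Num.sqrt n%:R)^-1 @[n --> \oo] --> (0 : R).
Proof.
have : Num.sqrt (n%:R : R)^-1 @[n --> \oo] --> (Num.sqrt 0 : R).
  by apply: (cvg_comp _ Num.sqrt (@cvg_invn R)); exact: sqrt_continuous.
by rewrite sqrtr0; apply: cvg_trans; apply: near_eq_cvg; near=> n; rewrite sqrtrV.
Unshelve. all: by end_near. Qed.

(** Both sides of the squeeze come from [1 + y <= expR y]: directly for the upper bound, and applied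
    to the inverse [1 - x / (1 + x)] of [1 + x] for the lower one. *)
Lemma cvg_expn1D (R : realType) (x : R^nat) (a : R) :
  (forall n, 0 < 1 + x n) -> n%:R * x n @[n --> \oo] --> a ->
  (1 + x n) ^+ n @[n --> \oo] --> expR a.
Proof.
move=> x_gt nx.
have x0 : x n @[n --> \oo] --> (0 : R).
  have : (n%:R * x n) * n%:R^-1 @[n --> \oo] --> a * 0.
    by apply: cvgM => //; exact: cvg_invn.
  rewrite mulr0; apply: cvg_trans; apply: near_eq_cvg; near=> n.
  rewrite mulrAC divff ?mul1r// pnatr_eq0 -lt0n; near: n; exact: nbhs_infty_gt.
apply: (@squeeze_cvgr _ _ _ _ (fun n => expR (n%:R * x n / (1 + x n)))
   (fun n => expR (n%:R * x n))).
- near=> n; apply/andP; split; last first.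
    rewrite expRM_natl; apply: lerXn2r; rewrite ?nnegrE ?expR_ge0 ?(ltW (x_gt n))//.
    exact: expR_ge1Dx.
  rewrite -mulrA expRM_natl; apply: lerXn2r; rewrite ?nnegrE ?expR_ge0 ?(ltW (x_gt n))//.
  rewrite -[leRHS]invrK -[X in X <= _]invrK -expRN lef_pV2 ?posrE ?invr_gt0 ?expR_gt0//.
  apply: le_trans (expR_ge1Dx _); rewrite le_eqVlt; apply/orP; left; apply/eqP.
  by field; rewrite gt_eqF.
- apply: (cvg_comp _ expR); last exact: continuous_expR.
  rewrite -[a]divr1; apply: cvgM => //; apply: cvgV; rewrite ?oner_eq0//.
  rewrite -[X in _ --> X]addr0; apply: cvgD => //; exact: cvg_cst.
- by apply: (cvg_comp _ expR nx); exact: continuous_expR.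
Unshelve. all: by end_near. Qed.

Section mgf_limit.
Context d (T : measurableType d) (R : realType) (P : probability T R).
Variables (psi : T -> R) (bpsi : bounded_measurable psi).
Hypothesis psi0 : \int[P]_x psi x = 0.
Let V := \int[P]_x (psi x ^+ 2).

Let bpsi2 : bounded_measurable (fun x => psi x ^+ 2).
Proof. by under eq_fun do rewrite expr2; exact: bmM. Qed.

Let bme t := bm_exp_psi bpsi t.

(** A bound uniform in [n], needed to dominate the integrals over a bounded window of [s]. It
    follows from $e^y=1+y+O(y^2)$, the centring of [psi] and $nt^2=s^2$. *)
Lemma mgf_growth : exists2 C : R, 0 <= C & forall (s : R) n,
  mgf P psi (s / Num.sqrt n%:R) ^+ n <= expR (s ^+ 2 * C * expR (`|s| * C)).
Proof.
have [M M0 psiM] := bm_bound_gt0 bpsi.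
(* One constant serves twice: it dominates [M ^+ 2] in the quadratic factor and [M] in the
   exponent. *)
pose C := M + M ^+ 2.
have C0 : 0 <= C by rewrite addr_ge0 ?sqr_ge0// ltW.
exists C => // s [|n].
  rewrite expr0 -[leLHS]expR0 ler_expR mulr_ge0 ?expR_ge0//.
  by rewrite mulr_ge0// sqr_ge0.
set t := s / _.
have ts : `|t| <= `|s|.
  rewrite /t normrM ler_piMr// ger0_norm ?invr_ge0 ?sqrtr_ge0// invf_le1 ?sqrtr_gt0 ?ltr0n//.
  by rewrite -[leLHS]sqrtr1 ler_sqrt ?ltr0n// ler1n.
have t2 : t ^+ 2 *+ n.+1 = s ^+ 2.
  rewrite /t exprMn exprVn sqr_sqrtr ?ler0n// -mulr_natr mulfVK// pnatr_eq0//.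
have mt : mgf P psi t <= expR (t ^+ 2 * (C * expR (`|s| * C))).
  apply: le_trans (expR_ge1Dx _).
  have -> : mgf P psi t = 1 + \int[P]_x (expR (t * psi x) - 1 - t * psi x).
    rewrite RintB//; [|by apply: bmB => //; exact: bm_cst|by apply: bmM => //; exact: bm_cst].
    rewrite RintB//; last exact: bm_cst.
    by rewrite Rint_cst RintZl// psi0 mulr0 subr0 addrC subrK.
  rewrite lerD2l; apply: (le_trans (ler_norm _)); apply: Rint_norm_le_cst.
    by apply: bmB; [apply: bmB => //; exact: bm_cst|apply: bmM => //; exact: bm_cst].
  move=> x; apply: (le_trans (expR_taylor1 _)).
  have tpsi : `|t * psi x| <= `|s| * M by rewrite normrM ler_pM.
  rewrite mulrA; apply: ler_pM; rewrite ?expR_ge0 ?sqr_ge0//; last first.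
    by rewrite ler_expR (le_trans tpsi)// ler_wpM2l// lerDl sqr_ge0.
  rewrite normrM exprMn real_normK ?num_real// ler_wpM2l ?sqr_ge0//.
  rewrite (@le_trans _ _ (M ^+ 2))// ?lerDr ?(ltW M0)//.
  by rewrite lerXn2r ?nnegrE ?(ltW M0).
have := lerXn2r n.+1 (ltW (mgf_gt0 P bpsi t)) (expR_ge0 _) mt.
move/le_trans; apply.
by rewrite -expRM_natl ler_expR mulrA -[_%:R * _]mulrC mulr_natr t2 mulrA.
Qed.

(** The linear term of the expansion vanishes because [psi] is centred, the quadratic term gives
    $s^2V/2$, and the cubic remainder multiplied by $n$ is of order $n^{-1/2}$. *)
Lemma cvg_mgf (s : R) :
  mgf P psi (s / Num.sqrt n%:R) ^+ n @[n --> \oo] --> expR (s ^+ 2 * V / 2).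
Proof.
have [M M0 psiM] := bm_bound_gt0 bpsi.
pose x n := mgf P psi (s / Num.sqrt n%:R) - 1.
rewrite (_ : (fun n => _) = fun n => (1 + x n) ^+ n); last first.
  by apply/funext => n; rewrite /x addrC subrK.
apply: cvg_expn1D => [n|]; first by rewrite /x addrC subrK mgf_gt0.
pose K := `|s| ^+ 3 * M ^+ 3 * expR (`|s| * M).
have K0 : 0 <= K by rewrite mulr_ge0 ?expR_ge0// mulr_ge0// exprn_ge0// ltW.
have key n : `|n.+1%:R * x n.+1 - s ^+ 2 * V / 2| <= K / Num.sqrt n.+1%:R.
  pose t := s / Num.sqrt n.+1%:R.
  have sn0 : 0 < Num.sqrt (n.+1%:R : R) by rewrite sqrtr_gt0 ltr0n.
  have ts : `|t| <= `|s|.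
    rewrite /t normrM ler_piMr// ger0_norm ?invr_ge0 ?sqrtr_ge0// invf_le1//.
    by rewrite -[leLHS]sqrtr1 ler_sqrt ?ltr0n// ler1n.
  have t2 : n.+1%:R * t ^+ 2 = s ^+ 2.
    by rewrite /t exprMn exprVn sqr_sqrtr ?ler0n// mulrC mulfVK// pnatr_eq0.
  have xE : x n.+1 - t ^+ 2 * V / 2 =
      \int[P]_y (expR (t * psi y) - 1 - t * psi y - (t * psi y) ^+ 2 / 2).
    have b1 : bounded_measurable (fun y => expR (t * psi y) - 1 - t * psi y).
      by apply: bmB; [apply: bmB => //; exact: bm_cst|apply: bmM => //; exact: bm_cst].
    have e y : (t * psi y) ^+ 2 / 2 = (t ^+ 2 / 2) * psi y ^+ 2 by rewrite exprMn mulrAC.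
    under eq_Rintegral do rewrite e.
    rewrite RintB//; last by apply: bmM => //; exact: bm_cst.
    rewrite RintB//; [|by apply: bmB => //; exact: bm_cst|by apply: bmM => //; exact: bm_cst].
    rewrite RintB//; last exact: bm_cst.
    rewrite Rint_cst RintZl// psi0 mulr0 subr0 RintZl// /x -/t -/V.
    by rewrite -/(mgf P psi t) mulrAC.
  have xb : `|x n.+1 - t ^+ 2 * V / 2| <= `|t| ^+ 3 * (M ^+ 3 * expR (`|s| * M)).
    rewrite xE; apply: Rint_norm_le_cst.
      apply: bmB.
        by apply: bmB; [apply: bmB => //; exact: bm_cst|apply: bmM => //; exact: bm_cst].
      under eq_fun do rewrite exprMn.
      by apply: bmM; [apply: bmM => //|]; exact: bm_cst.
    move=> y; apply: (le_trans (expR_taylor2 _)).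
    rewrite mulrA normrM exprMn; apply: ler_pM; rewrite ?expR_ge0//.
    - by rewrite ler_wpM2l ?exprn_ge0// lerXn2r ?nnegrE ?(ltW M0).
    - by rewrite ler_expR; apply: ler_pM.
  have -> : n.+1%:R * x n.+1 - s ^+ 2 * V / 2 = n.+1%:R * (x n.+1 - t ^+ 2 * V / 2).
    by rewrite -t2; ring.
  rewrite normrM [`|_%:R|]ger0_norm ?ler0n//.
  apply: (le_trans (ler_wpM2l (ler0n _ _) xb)).
  rewrite le_eqVlt; apply/orP; left; apply/eqP.
  rewrite /K /t normrM [`|(Num.sqrt _)^-1|]ger0_norm ?invr_ge0 ?sqrtr_ge0// exprMn.
  rewrite -[X in X * _](@sqr_sqrtr _ (n.+1%:R)) ?ler0n//.
  by field; rewrite gt_eqF.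
rewrite -[X in _ --> X]subr0 -(mulr0 K).
apply: (@squeeze_cvgr _ _ _ _ (fun n => s ^+ 2 * V / 2 - K * (Num.sqrt n%:R)^-1)
  (fun n => s ^+ 2 * V / 2 + K * (Num.sqrt n%:R)^-1)).
- near=> n; have n0 : (0 < n)%N by near: n; exact: nbhs_infty_gt.
  rewrite -ler_distl -(prednK n0); exact: key.
- apply: cvgB; first exact: cvg_cst.
  by apply: cvgM; [exact: cvg_cst|exact: cvg_inv_sqrtn].
- rewrite mulr0 subr0 -[X in _ --> X]addr0 -[X in _ + X](mulr0 K).
  apply: cvgD; first exact: cvg_cst.
  by apply: cvgM; [exact: cvg_cst|exact: cvg_inv_sqrtn].
Unshelve. all: by end_near. Qed.

End mgf_limit.

(** * Distribution functions and Lipschitz test functions *)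

Section cumul.
Context (R : realType).
Implicit Types (mu nu : probability (measurableTypeR R) R) (w x y z : R).

(** The identity as a random variable, through which facts about [cdf] become facts about a law on
    the line. *)
Let idTR : measurableTypeR R -> R := idfun.

#[local] HB.instance Definition _ :=
  @isMeasurableFun.Build _ _ _ _ idTR (@measurable_id _ _ setT).

Definition cumul mu (x : R) : R := fine (mu `]-oo, x]%classic).

Lemma cumulE mu : cdf (idTR : {RV mu >-> R}) = fun x => (cumul mu x)%:E.
Proof. apply/funext => x; by rewrite /cumul fineK ?fin_num_measure. Qed.

Lemma cumul_nd mu x y : x <= y -> cumul mu x <= cumul mu y.
Proof.
by have := @cdf_nondecreasing _ _ _ mu (idTR : {RV mu >-> R}) x y; rewrite cumulE.
Qed.

Lemma cumul_cvgNy mu : cumul mu x @[x --> -oo] --> (0 : R).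
Proof.
have := @cvg_cdfNy0 _ _ _ mu (idTR : {RV mu >-> R}).
by rewrite cumulE; move/fine_cvg.
Qed.

Lemma cumul_cvgy mu : cumul mu x @[x --> +oo] --> (1 : R).
Proof.
have := @cvg_cdfy1 _ _ _ mu (idTR : {RV mu >-> R}).
by rewrite cumulE; move/fine_cvg.
Qed.

Lemma cumul_right mu x : cumul mu y @[y --> x^'+] --> cumul mu x.
Proof.
have := @cdf_right_continuous _ _ _ mu (idTR : {RV mu >-> R}) x.
by rewrite cumulE; move/fine_cvg.
Qed.

(** Half-open intervals generate the Borel sets and are stable under intersection, and those from
    [-n] to [n] exhaust the line. *)
Lemma cumul_inj mu nu : (forall x, cumul mu x = cumul nu x) ->
  forall B, measurable B -> mu B = nu B.
Proof.
move=> munu B mB.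
have E (m : probability (measurableTypeR R) R) (a b : R) : a <= b ->
    m `]a, b]%classic = (cumul m b - cumul m a)%:E.
  move=> ab; rewrite EFinB /cumul !fineK ?fin_num_measure//.
  have -> : `]a, b]%classic = `]-oo, b] `\` `]-oo, a].
    by rewrite -[RHS]setCK setCD setCitvl setUC -[LHS]setCK setCitv.
  rewrite measureD ?setIidr//; first exact: subset_itvl.
  by rewrite -ge0_fin_numE// fin_num_measure.
apply: (@measure_unique _ R (measurableTypeR R) R.-ocitv.-measurable
  (fun n => `](- n%:R), n%:R]%classic)) => //.
- exact: ocitvI.
- by move=> n; exact: is_ocitv.
- rewrite -subTset => x _; exists (Num.bound `|x|) => //=; rewrite in_itv/=.
  have := archi_boundP (normr_ge0 x); rewrite ltr_norml => /andP[-> /ltW ->//].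
- move=> _ [[a b] _ <-] /=; have [ab|ba] := leP a b; first by rewrite !E// !munu.
  by rewrite set_itv_ge ?measure0// bnd_simp -leNgt ltW.
- by move=> n; rewrite -ge0_fin_numE// fin_num_measure//; exact: measurable_itv.
Qed.

(* A Lipschitz approximation of the indicator of ]-oo, a]. *)
Definition clamp (a dl y : R) : R := Num.max 0 (Num.min 1 ((a + dl - y) / dl)).

Section clamp.
Variables (a dl : R) (dl0 : 0 < dl).

Lemma clamp_ge0 (y : R) : 0 <= clamp a dl y.
Proof. by rewrite /clamp le_max lexx. Qed.

Lemma clamp_le1 (y : R) : clamp a dl y <= 1.
Proof. by rewrite /clamp ge_max ler01/= ge_min lexx. Qed.

Lemma clamp1 (y : R) : y <= a -> clamp a dl y = 1.
Proof.
move=> ya; rewrite /clamp min_l; first by rewrite max_r.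
by rewrite ler_pdivlMr// mul1r; lra.
Qed.

Lemma clamp0 (y : R) : a + dl <= y -> clamp a dl y = 0.
Proof.
move=> ya; rewrite /clamp min_r; first by rewrite max_l// ler_pdivrMr// mul0r subr_le0.
by rewrite ler_pdivrMr// mul1r; apply: le_trans (ltW dl0); lra.
Qed.

Lemma clamp_ninc (x y : R) : x <= y -> clamp a dl y <= clamp a dl x.
Proof.
move=> xy; rewrite /clamp ge_max le_max lexx/= le_max; apply/orP; right.
rewrite le_min ge_min lexx/= ge_min; apply/orP; right.
by rewrite ler_pM2r ?invr_gt0// lerB.
Qed.

Lemma clamp_lip (x y : R) : `|clamp a dl x - clamp a dl y| <= dl^-1 * `|x - y|.
Proof.
wlog xy : x y / x <= y.
  by move=> H; have [/H//|/ltW/H] := leP x y; rewrite distrC [`|x - y|]distrC.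
rewrite ger0_norm ?subr_ge0 ?clamp_ninc// distrC ger0_norm ?subr_ge0//.
have e : (a + dl - x) / dl = (a + dl - y) / dl + dl^-1 * (y - x).
  by field; rewrite gt_eqF.
have p : 0 <= dl^-1 * (y - x) by rewrite mulr_ge0 ?subr_ge0// invr_ge0 ltW.
rewrite /clamp e; move: ((a + dl - y) / dl) (dl^-1 * (y - x)) p => u v v0.
by case: (leP 1 (u + v)) => ?; case: (leP 1 u) => ?;
  rewrite ?(max_r ler01); case: (leP 0 u) => ?; case: (leP 0 (u + v)) => ?; lra.
Qed.

Lemma continuous_clamp : continuous (clamp a dl).
Proof.
move=> x; apply/cvgrPdist_le => e e0; near=> y.
apply: (le_trans (clamp_lip _ _)); rewrite mulrC ler_pdivrMr//.
near: y; apply: cvgr_dist_le => //; exact: mulr_gt0.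
Unshelve. all: by end_near. Qed.

Lemma bm_clamp : bounded_measurable (clamp a dl : measurableTypeR R -> R).
Proof.
split; first exact: continuous_measurable_fun continuous_clamp.
by exists 1 => x; rewrite ger0_norm ?clamp_ge0 ?clamp_le1.
Qed.

(** [clamp a dl] lies between the indicators of the half-lines ending at [a] and at [a + dl]. The
    shift [w] is included because the test functions get smoothed by [mu]. *)
Lemma cumul_le_clamp mu (w : R) :
  cumul mu (a - w) <= \int[mu]_z clamp a dl (w + z) <= cumul mu (a + dl - w).
Proof.
have mt : measurable_fun setT (fun z : measurableTypeR R => w + z : measurableTypeR R).
  by apply: measurable_funD; [exact: measurable_cst|exact: measurable_id].
have bc : bounded_measurable (fun z : measurableTypeR R => clamp a dl (w + z)).
  by apply: (bm_comp mt bm_clamp).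
apply/andP; split.
  rewrite /cumul -(@Rint_indic _ _ _ mu)//; apply: Rint_le => //.
    exact: bm_indic.
  move=> z; rewrite indicE; case: (boolP (_ \in _)) => [|_]; last exact: clamp_ge0.
  by rewrite inE/= in_itv/= => za; rewrite clamp1//; lra.
rewrite /cumul -(@Rint_indic _ _ _ mu)//; apply: Rint_le => //.
  exact: bm_indic.
move=> z; rewrite indicE; case: (boolP (_ \in _)) => [_|]; first exact: clamp_le1.
by rewrite notin_setE/= in_itv/= => /negP; rewrite -ltNge => za; rewrite clamp0//; lra.
Qed.

End clamp.

(** With [dl = y - x], the two bounds of [cumul_le_clamp] compare one distribution function at [x]
    with the other at [y]; right continuity then lets [y] decrease to [x]. *)
Lemma eq_prob_clamp mu nu :
  (forall a dl : R, 0 < dl -> \int[mu]_y clamp a dl y = \int[nu]_y clamp a dl y) ->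
  forall B, measurable B -> mu B = nu B.
Proof.
move=> H; apply: cumul_inj => x; apply/eqP; rewrite eq_le.
suff S (m1 m2 : probability (measurableTypeR R) R) :
    (forall a dl : R, 0 < dl -> \int[m1]_y clamp a dl y = \int[m2]_y clamp a dl y) ->
    cumul m1 x <= cumul m2 x.
  by rewrite !S// => a dl /H ->.
move=> {}H; apply: (cvgr_to_ge (@cumul_right m2 x)); near=> y.
have xy : 0 < y - x by rewrite subr_gt0; near: y; exact: nbhs_right_gt.
have /andP[+ _] := cumul_le_clamp x xy m1 0.
have /andP[_] := cumul_le_clamp x xy m2 0.
under eq_Rintegral do rewrite add0r.
under [X in _ -> _ <= X -> _]eq_Rintegral do rewrite add0r.
rewrite !subr0 H// => h2 /le_trans; apply; apply: (le_trans h2).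
by rewrite addrC subrK.
Unshelve. all: by end_near. Qed.

End cumul.

(** * Extraction of the mixing law from smoothed averages *)

Lemma fmap_ultra (I T : Type) (U : set_system I) (h : I -> T) :
  UltraFilter U -> UltraFilter (h @ U).
Proof.
move=> UU; split; first exact: fmap_proper_filter.
move=> G PG hUG; rewrite predeqE => A; split; last exact: hUG.
move=> GA; have [//|UnA] := in_ultra_setVsetC (h @^-1` A) UU.
have GnA : G (~` A) by apply: (hUG (~` A)); exact: UnA.
have GAn : G (A `&` ~` A) by exact: filterI.
by have [x []] := @filter_ex _ G PG _ GAn.
Qed.

Lemma ultra_cvg_bounded (I : Type) (R : realType) (U : set_system I)
    (UU : UltraFilter U) (h : I -> R) (m M : R) :
  (\forall i \near U, m <= h i <= M) -> exists l : R, h @ U --> l.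
Proof.
move=> hM.
have := @segment_compact R m M; rewrite compact_ultra => /(_ (h @ U)).
case=> [||l [_ hl]]; [exact: fmap_ultra| |by exists l].
by apply: filterS hM => i /= himM; rewrite in_itv.
Qed.

(** The sum counts the integers of [[1, N]] not exceeding [r]; at the endpoint [r = N.+1] the count
    is [N], so the lower bound is attained. Applied to [N.+1%:R * g w], this is the layer-cake
    approximation of a function with values in [[0, 1]]. *)
Lemma sum_levels (R : realType) (N : nat) (r : R) : 0 <= r <= N.+1%:R ->
  r - 1 <= \sum_(1 <= k < N.+1) ((k%:R <= r)%R)%:R <= r.
Proof.
elim: N => [|N IH] /andP[r0 rN].
  by rewrite big_geq//; apply/andP; split=> //; lra.
rewrite big_nat_recr//=.
have [rN'|rN'] := leP r N.+1%:R.
  have /andP[h1 h2] : r - 1 <= \sum_(1 <= k < N.+1) ((k%:R <= r)%R)%:R <= r.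
    by apply: IH; rewrite r0.
  have [e|_] := leP N.+1%:R r; last by rewrite addr0 h1.
  have {e rN'}-> : r = N.+1%:R by apply/eqP; rewrite eq_le rN' e.
  suff -> : \sum_(1 <= k < N.+1) ((k%:R <= N.+1%:R :> R)%R)%:R = N%:R :> R.
    by rewrite -natr1 -[true%:R]/(1 : R); apply/andP; split; lra.
  rewrite (eq_big_nat _ _ (F2 := fun=> 1)); last first.
    by move=> k /andP[_ kN]; rewrite ler_nat (ltnW kN).
  by rewrite sumr_const_nat subn1.
rewrite (ltW rN') (eq_big_nat _ _ (F2 := fun=> 1)); last first.
  move=> k /andP[_ kN]; rewrite (le_trans _ (ltW rN'))// ler_nat; exact: ltnW.
rewrite sumr_const_nat subn1 -[true%:R]/(1 : R) /=; move: rN rN'.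
by rewrite -!natr1 => rN rN'; apply/andP; split; lra.
Qed.

(** Monotonicity makes the superlevel set a left half-line ending at its supremum, and the Lipschitz
    bound shows that the supremum belongs to it. *)
Lemma level_set (R : realType) (g : R -> R) (K c : R) : 0 < K ->
  (forall x y, x <= y -> g y <= g x) ->
  (forall x y, `|g x - g y| <= K * `|x - y|) ->
  (exists x, c <= g x) -> (exists x, g x < c) ->
  exists z, forall w, (c <= g w) = (w <= z).
Proof.
move=> K0 gnd glip [x0 gx0] [x1 gx1].
pose S := [set w | c <= g w].
have S_ub : ubound S x1.
  move=> w /= cw; rewrite leNgt; apply/negP => /ltW /gnd gw.
  by have := le_lt_trans (le_trans cw gw) gx1; rewrite ltxx.
have supS : has_sup S by split; [exists x0|exists x1].
exists (sup S) => w; apply/idP/idP => [cw|].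
  exact: (sup_upper_bound supS).
move=> wS; rewrite leNgt; apply/negP => gwc.
(* If [g w < c] although [w <= sup S], some [w'] in [S] is within this distance to the left of [w].
   The Lipschitz bound then leaves [g] too little room to fall from [c] to [g w]. *)
have e0 : 0 < (c - g w) / K by rewrite divr_gt0// subr_gt0.
have [w' /= cw' w'S] := sup_adherent e0 supS.
have {}cw' : c <= g w' by [].
have w'w : w' < w.
  by rewrite ltNge; apply/negP => /gnd; rewrite leNgt (lt_le_trans gwc cw').
have := glip w' w; rewrite ger0_norm ?subr_ge0 ?gnd ?(ltW w'w)//.
rewrite distrC ger0_norm ?subr_ge0 ?(ltW w'w)// => h.
have : K * (w - w') < c - g w.
  rewrite mulrC -ltr_pdivlMr//; move: w'S wS; set e := (_ / K); lra.
lra.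
Qed.

Lemma le_cvg_to (I : Type) (R : realType) (F : set_system I)
    (FF : ProperFilter F) (f g : I -> R) (l m : R) :
  f i @[i --> F] --> l -> g i @[i --> F] --> m -> (forall i, f i <= g i) -> l <= m.
Proof.
move=> fl gm fg; rewrite -subr_ge0; apply: (cvgr_to_ge (cvgB gm fl)).
by apply: nearW => i; rewrite /= subr_ge0.
Qed.

Lemma cvg_sumr (I J : Type) (R : realType) (F : set_system I) (FF : Filter F)
    (r : seq J) (p : pred J) (f : J -> I -> R) (l : J -> R) :
  (forall j, p j -> f j i @[i --> F] --> l j) ->
  \sum_(j <- r | p j) f j i @[i --> F] --> \sum_(j <- r | p j) l j.
Proof.
move=> fl; elim: r => [|j r IH].
  rewrite big_nil (_ : (fun i => _) = fun=> 0); first exact: cvg_cst.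
  by apply/funext => i; rewrite big_nil.
rewrite big_cons (_ : (fun i => _) = fun i => if p j
    then f j i + \sum_(k <- r | p k) f k i else \sum_(k <- r | p k) f k i); last first.
  by apply/funext => i; rewrite big_cons.
by case: (p j) (fl j) => [/(_ isT) ?|_//]; exact: cvgD.
Qed.

Lemma cumul_gt (R : realType) (mu : probability (measurableTypeR R) R) (c : R) :
  c < 1 -> exists x, c < cumul mu x.
Proof.
move=> c1; have [M [_ HM]] := cvgr_gt _ (cumul_cvgy mu) _ c1.
by exists (M + 1); apply/HM; rewrite ltrDl.
Qed.

Lemma cumul_lt (R : realType) (mu : probability (measurableTypeR R) R) (c : R) :
  0 < c -> exists x, cumul mu x < c.
Proof.
move=> c0; have [M [_ HM]] := cvgr_lt _ (cumul_cvgNy mu) _ c0.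
by exists (M - 1); apply/HM; rewrite ltrBlDr ltrDl.
Qed.

Section smoothing.
Context (R : realType) (nu : probability (measurableTypeR R) R).

(** The mean of [f] at [w] plus noise of law [nu]; its integral against [M] is the integral of [f]
    against the convolution of [nu] and [M]. *)
Definition smooth (f : R -> R) (w : R) : R := \int[nu]_z f (w + z).

Lemma bm_shift (f : measurableTypeR R -> R) (w : R) : bounded_measurable f ->
  bounded_measurable (fun z : measurableTypeR R => f (w + z)).
Proof.
move=> bf; have mt : measurable_fun setT (fun z : measurableTypeR R => w + z : measurableTypeR R).
  by apply: measurable_funD; [exact: measurable_cst|exact: measurable_id].
exact: (bm_comp mt bf).
Qed.

Variables (a dl : R) (dl0 : 0 < dl).
Let g := smooth (clamp a dl).
Let bmc w := bm_shift w (bm_clamp a dl0).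

Lemma smooth_clamp_ninc (x y : R) : x <= y -> g y <= g x.
Proof. by move=> xy; apply: Rint_le => // z; apply: clamp_ninc => //; rewrite lerD2r. Qed.

Lemma smooth_clamp_bound (x : R) : 0 <= g x <= 1.
Proof.
apply/andP; split; first by apply: Rintegral_ge0 => z _; exact: clamp_ge0.
by apply: Rint_le_cst => // z; exact: clamp_le1.
Qed.

Lemma smooth_clamp_lip (x y : R) : `|g x - g y| <= dl^-1 * `|x - y|.
Proof.
rewrite -RintB//; apply: Rint_norm_le_cst; first exact: bmB.
by move=> z; apply: (le_trans (clamp_lip _ _ _ _)) => //; rewrite opprD addrACA subrr addr0.
Qed.

Lemma bm_smooth_clamp : bounded_measurable (g : measurableTypeR R -> R).
Proof.
split.
  by apply: nonincreasing_measurable => // x y xy; exact: smooth_clamp_ninc.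
by exists 1 => x; have /andP[g0 g1] := smooth_clamp_bound x; rewrite ger0_norm.
Qed.

Lemma smooth_clamp_levels (c : R) : 0 < c < 1 ->
  (exists x, c <= g x) /\ (exists x, g x < c).
Proof.
move=> /andP[c0 c1]; split.
  have [x cx] := cumul_gt nu c1; exists (a - x).
  have /andP[+ _] := cumul_le_clamp a dl0 nu (a - x); apply: le_trans.
  by rewrite opprB addrC subrK ltW.
have [x cx] := cumul_lt nu c0; exists (a + dl - x).
have /andP[_] := cumul_le_clamp a dl0 nu (a + dl - x); move/le_lt_trans; apply.
by rewrite opprB addrC subrK.
Qed.

End smoothing.

Lemma bm_halfline (R : realType) (x : R) :
  bounded_measurable (\1_(`]-oo, x]%classic) : measurableTypeR R -> R).
Proof. by apply: bm_indic; exact: measurable_itv. Qed.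

Section limit_deconvolution.
Context (R : realType) (nu L : probability (measurableTypeR R) R).
Variables (I : Type) (F : set_system I) (FF : ProperFilter F)
  (A : I -> (R -> R) -> R).
Local Notation bm f := (bounded_measurable (f : measurableTypeR R -> R)).
Hypotheses
  (AD : forall i f g, bm f -> bm g -> A i (fun x => f x + g x) = A i f + A i g)
  (AZ : forall i (c : R) f, bm f -> A i (fun x => c * f x) = c * A i f)
  (Ale : forall i f g, bm f -> bm g -> (forall x, f x <= g x) -> A i f <= A i g)
  (A1 : A i (fun=> 1) @[i --> F] --> (1 : R))
  (AL : forall a dl : R, 0 < dl ->
    A i (smooth nu (clamp a dl)) @[i --> F] --> \int[L]_y clamp a dl y).

Let A_sum i (r : seq nat) (f : nat -> R -> R) : (forall k, bm (f k)) ->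
  A i (fun x => \sum_(k <- r) f k x) = \sum_(k <- r) A i (f k).
Proof.
move=> bf; elim: r => [|k r IH].
  rewrite big_nil -[RHS](mul0r (A i (fun=> 1))) -AZ; last exact: bm_cst.
  by congr (A i); apply/funext => x; rewrite big_nil mul0r.
rewrite big_cons -IH -AD//; last by apply: bm_sum => j _; exact: bf.
by congr (A i); apply/funext => x; rewrite big_cons.
Qed.

(** Helly selection on the distribution functions [H i], with the ultrafilter in place of a
    subsequence. Passing to a right-continuous version may change the limit at jumps, so integrals
    are compared through layer-cake sums with slightly shifted levels. *)
Lemma limit_deconvolution_ultra : UltraFilter F ->
  exists M : probability (measurableTypeR R) R, forall a dl : R, 0 < dl ->
    \int[M]_w smooth nu (clamp a dl) w = \int[L]_y clamp a dl y.
Proof.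
move=> UF.
pose H i x := A i (\1_(`]-oo, x]%classic)).
have Hnd i x y : x <= y -> H i x <= H i y.
  move=> xy; apply: Ale; [exact: bm_halfline|exact: bm_halfline|].
  move=> z; rewrite !indicE; case: (boolP (z \in `]-oo, x]%classic)) => [|_]; last exact: ler0n.
  by rewrite inE/= in_itv/= => zx; rewrite mem_set//= in_itv/= (le_trans zx).
have H0 i x : 0 <= H i x.
  rewrite -[leLHS](mul0r (A i (fun=> 1))) -AZ; last exact: bm_cst.
  by apply: Ale; [by apply: bmM; exact: bm_cst|exact: bm_halfline|move=> z; rewrite mul0r].
have HA1 i x : H i x <= A i (fun=> 1).
  apply: Ale; [exact: bm_halfline|exact: bm_cst|].
  by move=> z; rewrite indicE lern1; case: (_ \in _).
have /choice[F0 HF0] : forall x, exists l : R, H i x @[i --> F] --> l.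
  move=> x; apply: (@ultra_cvg_bounded _ _ _ UF _ 0 2); near=> i.
  rewrite H0/= (le_trans (HA1 _ _))//; near: i.
  by apply: (cvgr_le _ A1); lra.
have {}HF0 x : H i x @[i --> F] --> F0 x := HF0 x.
have F0nd x y : x <= y -> F0 x <= F0 y.
  by move=> xy; apply: (le_cvg_to FF (HF0 x) (HF0 y)) => i; exact: Hnd.
have F0_ge0 x : 0 <= F0 x.
  have c0 : (fun=> 0 : R) @ F --> (0 : R) by exact: cvg_cst.
  by apply: (le_cvg_to FF c0 (HF0 x)) => i; exact: H0.
have F0_le1 x : F0 x <= 1.
  exact: (le_cvg_to FF (HF0 x) A1).
(* For [w <= l - 1 - k], noise of at most [k], which has probability at least one half, keeps the
   sum below [l - 1]. Hence the factor 2 between the half-line and the smoothed clamp, whose average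
   has a limit of at most [cumul L l]. *)
have F0_Ny (e : R) : 0 < e -> exists x, F0 x <= e.
  move=> e0.
  have [k k1] : exists k, 2^-1 <= cumul nu k.
    by have [//|x /ltW] := @cumul_gt _ nu 2^-1; [lra|exists x].
  have [l l1] : exists l, cumul L l <= e / 2.
    by have [//|x /ltW] := @cumul_lt _ L (e / 2); [lra|exists x].
  exists (l - 1 - k).
  have Hle i : H i (l - 1 - k) <= 2 * A i (smooth nu (clamp (l - 1) 1)).
    rewrite -AZ; last exact: bm_smooth_clamp.
    apply: Ale; [exact: bm_halfline|by apply: bmM; [exact: bm_cst|exact: bm_smooth_clamp]|].
    move=> w; rewrite indicE; case: (boolP (_ \in _)) => [|_]; last first.
      by rewrite mulr_ge0//; have /andP[] := smooth_clamp_bound nu (l - 1) ltr01 w.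
    rewrite inE/= in_itv/= => wl.
    have /andP[h _] := cumul_le_clamp (l - 1) ltr01 nu w.
    have : cumul nu k <= cumul nu (l - 1 - w) by apply: cumul_nd; lra.
    by rewrite /smooth; lra.
  have HR : 2 * A i (smooth nu (clamp (l - 1) 1)) @[i --> F] -->
      2 * \int[L]_y clamp (l - 1) 1 y.
    by apply: cvgM; [exact: cvg_cst|exact: AL].
  have := le_cvg_to FF (HF0 (l - 1 - k)) HR Hle.
  have /andP[_] := cumul_le_clamp (l - 1) ltr01 L 0.
  under eq_Rintegral do rewrite add0r.
  by rewrite subr0 subrK; lra.
(* The mirror image: for [w > l + 1 - k], noise above [k], again of probability at least one half,
   pushes the sum beyond the support of the clamp, so one minus the smoothed clamp is at least one
   half there. *)
have F0_y (e : R) : 0 < e -> exists x, 1 - e <= F0 x.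
  move=> e0.
  have [k k1] : exists k, cumul nu k <= 2^-1.
    by have [//|x /ltW] := @cumul_lt _ nu 2^-1; exists x.
  have [l l1] : exists l, 1 - e / 2 <= cumul L l.
    by have [//|x /ltW] := @cumul_gt _ L (1 - e / 2); [lra|exists x].
  exists (l + 1 - k).
  have Hle i : A i (fun=> 1) <=
      H i (l + 1 - k) + 2 * (A i (fun=> 1) - A i (smooth nu (clamp l 1))).
    have bs := bm_smooth_clamp nu l (@ltr01 R).
    have bs1 : bm (fun w => -1 * smooth nu (clamp l 1) w) by apply: bmM => //; exact: bm_cst.
    have bs2 : bm (fun w => 1 + -1 * smooth nu (clamp l 1) w) by apply: bmD => //; exact: bm_cst.
    have bs3 : bm (fun w => 2 * (1 + -1 * smooth nu (clamp l 1) w)) by apply: bmM => //; exact: bm_cst.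
    have -> : A i (fun=> 1) - A i (smooth nu (clamp l 1)) =
        A i (fun w => 1 + -1 * smooth nu (clamp l 1) w).
      by rewrite AD ?AZ ?mulN1r//; exact: bm_cst.
    rewrite -(AZ i 2 bs2) /H -(AD i (bm_halfline _) bs3).
    apply: Ale; [exact: bm_cst|by apply: bmD; [exact: bm_halfline|by apply: bmM => //; exact: bm_cst]|].
    move=> w; rewrite indicE; have /andP[_ g1] := smooth_clamp_bound nu l ltr01 w.
    case: (boolP (_ \in _)) => [_|]; first by rewrite -[true%:R]/(1 : R); lra.
    rewrite notin_setE/= in_itv/= => /negP; rewrite -ltNge => wl.
    have /andP[_ h] := cumul_le_clamp l ltr01 nu w.
    have : cumul nu (l + 1 - w) <= cumul nu k by apply: cumul_nd; lra.
    by rewrite -[false%:R]/(0 : R) /smooth in h *; lra.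
  have HR : H i (l + 1 - k) + 2 * (A i (fun=> 1) - A i (smooth nu (clamp l 1))) @[i --> F]
      --> F0 (l + 1 - k) + 2 * (1 - \int[L]_y clamp l 1 y).
    apply: cvgD => //; apply: cvgM; first exact: cvg_cst.
    by apply: cvgB => //; exact: AL.
  have := le_cvg_to FF A1 HR Hle.
  have /andP[+ _] := cumul_le_clamp l ltr01 L 0.
  under eq_Rintegral do rewrite add0r.
  by rewrite subr0; lra.
(* The right-continuous version of [F0]. The comparisons below rest on [F0 x <= Fr x] and on
   [Fr x <= F0 y] for [x < y]. *)
pose Fr x := inf (F0 @` `]x, +oo[%classic).
have Fr_inf x : has_inf (F0 @` `]x, +oo[%classic).
  split; first by exists (F0 (x + 1)), (x + 1) => //=; rewrite in_itv/= andbT ltrDl.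
  by exists 0 => _ [y _ <-].
have F0Fr x : F0 x <= Fr x.
  apply: lb_le_inf; first by case: (Fr_inf x).
  by move=> _ [y /= + <-]; rewrite in_itv/= andbT => /ltW /F0nd.
have FrF0 x y : x < y -> Fr x <= F0 y.
  move=> xy; apply: ge_inf; first by case: (Fr_inf x).
  by exists y => //=; rewrite in_itv/= andbT.
have Frnd : nondecreasing Fr.
  move=> x y; rewrite le_eqVlt => /predU1P[->//|xy].
  exact: le_trans (FrF0 _ _ xy) (F0Fr y).
have Frrc : right_continuous Fr.
  move=> x; apply/cvgrPdist_le => e e0.
  have [_ [y /= + <-] ye] := inf_adherent e0 (Fr_inf x).
  rewrite in_itv/= andbT => xy; near=> z.
  have xz : x < z by near: z; exact: nbhs_right_gt.
  have zy : z < y by near: z; exact: nbhs_right_lt.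
  rewrite distrC ger0_norm ?subr_ge0 ?Frnd ?(ltW xz)//.
  have := FrF0 _ _ zy; rewrite -/(Fr x) in ye; lra.
have FrNy : Fr x @[x --> -oo] --> (0 : R).
  apply/cvgrPdist_le => e e0; have [x0 x0e] := F0_Ny e e0; near=> x.
  have xx0 : x < x0 by near: x; apply: nbhs_ninfty_lt; exact: num_real.
  rewrite sub0r normrN ger0_norm ?(le_trans (F0_ge0 _) (F0Fr _))//.
  exact: le_trans (FrF0 _ _ xx0) x0e.
have Fry : Fr x @[x --> +oo] --> (1 : R).
  apply/cvgrPdist_le => e e0; have [x0 x0e] := F0_y e e0; near=> x.
  have xx0 : x0 < x by near: x; apply: nbhs_pinfty_gt; exact: num_real.
  have : Fr x <= 1 by apply: le_trans (FrF0 x (x + 1) _) (F0_le1 _); rewrite ltrDl.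
  move=> h; rewrite ger0_norm ?subr_ge0//.
  have := le_trans (F0nd _ _ (ltW xx0)) (F0Fr x); lra.
have [M cM] : exists M : probability (measurableTypeR R) R, forall x, cumul M x = Fr x.
  pose FrC := HB.pack_for (cumulativeBounded (0 : R) (1 : R)) Fr
    (isCumulative.Build R _ R Fr Frnd Frrc)
    (isCumulativeBounded.Build R 0 1 Fr FrNy Fry).
  exists (lebesgue_stieltjes_measure FrC) => x.
  by have := cdf_lebesgue_stieltjes_id FrC x; rewrite cumulE => -[].
exists M => a dl dl0; pose g := smooth nu (clamp a dl).
pose K := dl^-1; have K0 : 0 < K by rewrite invr_gt0.
have bg : bm g by exact: bm_smooth_clamp.
have g01 w : 0 <= g w <= 1 by exact: smooth_clamp_bound.
have glip x y : `|g x - g y| <= K * `|x - y| by exact: smooth_clamp_lip.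
set l := \int[L]_y _.
(* [N.+1%:R^-1] is the height of one layer. The shift [eta] turns values of [Fr] back into values of
   [F0], at the Lipschitz cost [K * eta]. *)
have close (N : nat) (eta : R) : 0 < eta ->
    l <= \int[M]_w g w + N.+1%:R^-1 /\ \int[M]_w g w <= l + N.+1%:R^-1 + K * eta.
  move=> eta0; set e := N.+1%:R^-1.
  have e0 : 0 < e by rewrite invr_gt0.
  have /choice[z zP] : forall k : nat, exists z, (0 < k < N.+1)%N ->
      forall w, (k%:R * e <= g w) = (w <= z).
    move=> k; have [/andP[k0 kN]|_] := boolP (0 < k < N.+1)%N; last by exists 0.
    have ke : 0 < k%:R * e < 1.
      by rewrite mulr_gt0 ?ltr0n//= ltr_pdivrMr ?ltr0n// mul1r ltr_nat.
    have [h1 h2] := smooth_clamp_levels nu a dl0 ke.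
    have [z zP] := level_set K0 (smooth_clamp_ninc nu a dl0) glip h1 h2.
    by exists z.
  pose h w := e * \sum_(1 <= k < N.+1) (\1_(`]-oo, z k]%classic) w : R).
  have hE w : h w = e * \sum_(1 <= k < N.+1) ((k%:R <= N.+1%:R * g w)%R)%:R.
    congr (_ * _); apply: eq_big_nat => k kN; rewrite indicE.
    rewrite -(ler_pdivrMl _ _ (ltr0Sn _ _)) mulrC zP//.
    rewrite (_ : (w \in `]-oo, z k]%classic) = (w <= z k))//.
    by apply/idP/idP; rewrite inE/= in_itv.
  have h_le w : h w <= g w /\ g w <= h w + e.
    have /andP[gw0 gw1] := g01 w.
    have /andP[s1 s2] : N.+1%:R * g w - 1 <=
        \sum_(1 <= k < N.+1) ((k%:R <= N.+1%:R * g w)%R)%:R <= N.+1%:R * g w.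
      by apply: sum_levels; rewrite mulr_ge0//= ler_piMr.
    rewrite hE; move: s1 s2; set s := \sum_(_ <= _ < _) _ => s1 s2.
    have Ne : e * N.+1%:R = 1 by rewrite /e mulVf// pnatr_eq0.
    have ge : g w = e * (N.+1%:R * g w) by rewrite mulrA Ne mul1r.
    have se : e * s + e = e * (s + 1) by ring.
    by split; rewrite ?se ge ler_pM2l//; lra.
  have bind k : bm (\1_(`]-oo, z k]%classic) : R -> R) by exact: bm_halfline.
  have bh : bm h.
    apply: bmM; first exact: bm_cst.
    by apply: bm_sum => k _; exact: bind.
  have Ah i : A i h = e * \sum_(1 <= k < N.+1) H i (z k).
    by rewrite AZ ?A_sum//; apply: bm_sum => k _; exact: bind.
  have intH (q : R) : \int[M]_w h (w + q) = e * \sum_(1 <= k < N.+1) Fr (z k - q).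
    have bq k : bounded_measurable (fun w : measurableTypeR R =>
        \1_(`]-oo, z k]%classic) (w + q) : R).
      by under eq_fun do rewrite addrC; exact: (bm_shift q (bind k)).
    rewrite RintZl; last by apply: bm_sum => k _; exact: bq.
    rewrite Rint_sum//; congr (_ * _); apply: eq_bigr => k _.
    rewrite -cM /cumul -(@Rint_indic _ _ _ M); last exact: measurable_itv.
    apply: eq_Rintegral => w _; rewrite !indicE.
    rewrite (_ : (w + q \in `]-oo, z k]%classic) = (w \in `]-oo, z k - q]%classic))//.
    by apply/idP/idP; rewrite !inE/= !in_itv/= lerBrDr.
  pose S0 := e * \sum_(1 <= k < N.+1) F0 (z k).
  have AhS : A i h @[i --> F] --> S0.
    under eq_fun do rewrite Ah.
    apply: cvgM; first exact: cvg_cst.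
    by apply: cvg_sumr => k _; exact: HF0.
  have AE : A i (fun=> e) @[i --> F] --> e.
    have -> : (fun i => A i (fun=> e)) = fun i => e * A i (fun=> 1).
      by apply/funext => i; rewrite -AZ; [congr (A i); apply/funext => ?; rewrite mulr1|exact: bm_cst].
    rewrite -[X in _ --> X]mulr1; apply: cvgM => //; exact: cvg_cst.
  have S0l : S0 <= l.
    apply: (le_cvg_to FF AhS (@AL a dl dl0)) => i.
    by apply: Ale => // w; have [] := h_le w.
  have lS0 : l <= S0 + e.
    have HR : A i h + A i (fun=> e) @[i --> F] --> S0 + e by exact: cvgD.
    apply: (le_cvg_to FF (@AL a dl dl0) HR) => i.
    rewrite -AD//; last exact: bm_cst.
    apply: Ale => //; first by apply: bmD => //; exact: bm_cst.
    by move=> w; have [] := h_le w.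
  have intM0 : \int[M]_w h w = e * \sum_(1 <= k < N.+1) Fr (z k).
    have := intH 0; under eq_Rintegral do rewrite addr0.
    by move=> ->; congr (_ * _); apply: eq_bigr => k _; rewrite subr0.
  have bhq : bounded_measurable (fun w : measurableTypeR R => h (w + eta)).
    by under eq_fun do rewrite addrC; exact: (bm_shift eta bh).
  split.
    apply: (le_trans lS0); rewrite lerD2r; apply: (@le_trans _ _ (\int[M]_w h w)).
      by rewrite intM0 /S0 ler_pM2l//; apply: ler_sum => k _; exact: F0Fr.
    by apply: Rint_le => // w; have [] := h_le w.
  have : \int[M]_w h (w + eta) <= l.
    rewrite intH; apply: le_trans S0l; rewrite /S0 ler_pM2l//.
    by apply: ler_sum => k _; apply: FrF0; rewrite ltrBlDr ltrDl.
  have : \int[M]_w g w <= \int[M]_w (h (w + eta) + (e + K * eta)).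
    apply: Rint_le => //; first by apply: bmD => //; exact: bm_cst.
    move=> w; have [_ h2] := h_le (w + eta); have := glip w (w + eta).
    rewrite opprD addrA subrr sub0r normrN (gtr0_norm eta0) => /(le_trans (ler_norm _)).
    by lra.
  rewrite RintD//; last exact: bm_cst.
  by rewrite Rint_cst; lra.
apply/eqP; rewrite eq_le; apply/andP; split; apply/ler_addgt0Pr => e e0.
- have e3 : 0 < e / 2 by rewrite divr_gt0.
  have [N] := ltr_add_invr e3; rewrite add0r => Ne.
  have [_ h] := close N (e / 2 / K) (divr_gt0 e3 K0).
  apply: (le_trans h); rewrite [K * _]mulrC divfK ?gt_eqF//.
  by rewrite -addrA lerD2l [leRHS]splitr lerD2r ltW.
- have [N] := ltr_add_invr e0; rewrite add0r => Ne.
  have [h _] := close N 1 ltr01.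
  by apply: (le_trans h); rewrite lerD2l ltW.
Unshelve. all: by end_near. Qed.

End limit_deconvolution.

Section deconvolution.
Context (R : realType) (nu L : probability (measurableTypeR R) R).

Let add2 (z : measurableTypeR R * measurableTypeR R) : measurableTypeR R :=
  z.1 + z.2.

Let measurable_add2 : measurable_fun setT add2.
Proof. by apply: measurable_funD; [exact: measurable_fst|exact: measurable_snd]. Qed.

#[local] HB.instance Definition _ :=
  isMeasurableFun.Build _ _ _ _ add2 measurable_add2.

Lemma convolutionP (M : probability (measurableTypeR R) R) :
  (forall a dl : R, 0 < dl ->
    \int[M]_w smooth nu (clamp a dl) w = \int[L]_y clamp a dl y) ->
  forall B, measurable B -> L B = convolution nu M B.
Proof.
move=> H B mB.
rewrite (_ : convolution nu M B = distribution (nu \x M)%E add2 B); last by [].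
move: B mB; apply: eq_prob_clamp => a dl dl0.
rewrite -H// (Rint_distribution (nu \x M)%E _ (bm_clamp a dl0)).
have b2 : bounded_measurable (fun z => clamp a dl (add2 z)).
  exact: (bm_comp measurable_add2 (bm_clamp a dl0)).
rewrite (Rint_prodr nu M b2) /smooth; apply: eq_Rintegral => w _.
by apply: eq_Rintegral => z _; rewrite /add2/= addrC.
Qed.

(** The filter is refined to an ultrafilter, and the assumed limits survive the refinement. *)
Lemma limit_deconvolution (I : Type) (F : set_system I) (A : I -> (R -> R) -> R) :
  ProperFilter F ->
  (forall i (f g : measurableTypeR R -> R), bounded_measurable f -> bounded_measurable g ->
    A i (fun x => f x + g x) = A i f + A i g) ->
  (forall i (c : R) (f : measurableTypeR R -> R), bounded_measurable f ->
    A i (fun x => c * f x) = c * A i f) ->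
  (forall i (f g : measurableTypeR R -> R), bounded_measurable f -> bounded_measurable g ->
    (forall x, f x <= g x) -> A i f <= A i g) ->
  A i (fun=> 1) @[i --> F] --> (1 : R) ->
  (forall a dl : R, 0 < dl ->
    A i (smooth nu (clamp a dl)) @[i --> F] --> \int[L]_y clamp a dl y) ->
  exists M : probability (measurableTypeR R) R,
    forall B, measurable B -> L B = convolution nu M B.
Proof.
move=> FF AD AZ Ale A1 AL; have [U [UU FU]] := ultraFilterLemma FF.
have [M HM] : exists M : probability (measurableTypeR R) R, forall a dl : R, 0 < dl ->
    \int[M]_w smooth nu (clamp a dl) w = \int[L]_y clamp a dl y.
  apply: (@limit_deconvolution_ultra _ nu L I U _ A) => //.
  - exact: cvg_trans (cvg_app _ FU) A1.
  - by move=> a dl dl0; exact: cvg_trans (cvg_app _ FU) (AL a dl dl0).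
by exists M; exact: convolutionP.
Qed.

End deconvolution.

(** * Gaussian integrals over the line and over a window *)

Section gaussian_tilt.
Context (R : realType) (V : R) (V0 : 0 < V).
Local Notation mu := (@lebesgue_measure R).
Local Notation nu := (centered_normal V).

(* The likelihood ratio of the tilt of parameter - r / sqrt n, with D the
   normalized sum of the scores; the half-line s >= 0 is r <= 0. *)
Definition lik (r D : R) : R := expR (- (r * D) - r ^+ 2 * V / 2).

(** This is $\int e^{-r^2V/2}\,dr=\sqrt{2\pi/V}$. *)
Definition gauss_mass : R := (normal_peak (Num.sqrt V) * V)^-1.

Let s0 : Num.sqrt V != 0. Proof. by rewrite gt_eqF// sqrtr_gt0. Qed.

Let peak0 : 0 < normal_peak (Num.sqrt V). Proof. exact: normal_peak_gt0. Qed.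

Lemma gauss_mass_gt0 : 0 < gauss_mass.
Proof. by rewrite invr_gt0 mulr_gt0. Qed.

Let pdf := normal_pdf 0 (Num.sqrt V).

(** Completing the square: $(D+rV)^2/(2V)=D^2/(2V)+rD+r^2V/2$. *)
Let pdf_affine (D r : R) :
  pdf (D + r * V) = normal_peak (Num.sqrt V) * expR (- (D ^+ 2 / (2 * V))) * lik r D.
Proof.
rewrite /pdf normal_pdfE// /normal_fun /lik -mulrA -expRD; congr (_ * expR _).
rewrite subr0 sqr_sqrtr ?ltW// -mulr_natr; field.
by rewrite gt_eqF.
Qed.

Variables (f : R -> R) (cf : continuous f) (f01 : forall y, 0 <= f y <= 1).

Let bf : bounded_measurable (f : measurableTypeR R -> R).
Proof.
split; first exact: continuous_measurable_fun cf.
by exists 1 => x; have /andP[? ?] := f01 x; rewrite ger0_norm.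
Qed.

Lemma smooth_density (w : R) :
  ((smooth nu f w)%:E = \int[mu]_z (f (w + z) * pdf z)%:E)%E.
Proof.
have mpdf : measurable_fun setT (pdf : R -> R) by exact: measurable_normal_pdf.
have pdf0 z : 0 <= pdf z by exact: normal_pdf_ge0.
have [i1 i2] := @Rint_density _ (measurableTypeR R) R mu nu pdf mpdf pdf0
  (fun B mB => erefl) _ (bm_shift w bf).
rewrite /smooth i2 /Rintegral fineK//.
exact: integrable_fin_num.
Qed.

(** The substitution $z=D+rV$ turns [lik r D] into the density of $N(0,V)$ and $S+rV$ into
    $(S-D)+z$. The Jacobian [V] and the peak of the density make up [gauss_mass]. Thus the Gaussian
    noise splits off, and the sample enters [f] only through the residual [S - D]. *)
Lemma gauss_identity (S D : R) :
  (\int[mu]_r (f (S + r * V) * lik r D)%:E =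
   (gauss_mass * expR (D ^+ 2 / (2 * V)) * smooth nu f (S - D))%:E)%E.
Proof.
pose F (r : R) := D + r * V.
have dF (r : R) : is_derive r (1 : R) F V.
  apply: is_derive_eq; rewrite /= scaler0 !add0r mul1r /GRing.scale/= mulr1.
  by [].
have F'E : F^`()%classic = cst V.
  by apply/funext => r; rewrite derive1E; apply: derive_val.
pose G z := f (S - D + z) * pdf z.
have cG : continuous G.
  move=> z; apply: cvgM; last exact: continuous_normal_pdf.
  apply: (cvg_comp (fun z => S - D + z) f); last exact: cf.
  by apply: cvgD; [exact: cvg_cst|exact: cvg_id].
have G0 z : 0 <= G z.
  by rewrite mulr_ge0 ?normal_pdf_ge0//; have /andP[] := f01 (S - D + z).
have FV : (\int[mu]_z (G z)%:E = \int[mu]_r (((G \o F) * F^`()%classic) r)%:E)%E.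
  apply: increasing_ge0_integration_by_substitutionT => //.
  - by move=> x y xy; rewrite /F ltrD2l ltr_pM2r.
  - by rewrite F'E => ?; exact: cvg_cst.
  - by rewrite F'E; exact: is_cvg_cst.
  - by rewrite F'E; exact: is_cvg_cst.
  - apply: (cvg_comp (fun r => r * V) (fun x => D + x)); last exact: cvg_addrl_Ny.
    by apply: gt0_cvgMlNy => //; exact: cvg_id.
  - apply: (cvg_comp (fun r => r * V) (fun x => D + x)); last exact: cvg_addrl.
    by apply: gt0_cvgMly => //; exact: cvg_id.
have c0 : 0 <= gauss_mass * expR (D ^+ 2 / (2 * V)).
  by rewrite mulr_ge0 ?expR_ge0// ltW// gauss_mass_gt0.
rewrite EFinM smooth_density -/(G _) FV -ge0_integralZl//.
- apply: eq_integral => r _; rewrite F'E -EFinM; congr EFin => /=.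
  rewrite (_ : ((G \o F) * cst V) r = f (S - D + (D + r * V)) * pdf (D + r * V) * V)//.
  rewrite pdf_affine expRN /gauss_mass.
  have -> : S - D + (D + r * V) = S + r * V by ring.
  field.
  by rewrite !gt_eqF ?expR_gt0// ?peak0.
- apply/measurable_EFinP; rewrite F'E; apply: measurable_funM => //.
  apply: measurableT_comp; first exact: continuous_measurable_fun.
  by apply: continuous_measurable_fun => x; apply/differentiable_continuous/derivable1_diffP; have [] := dF x.
- by move=> r _; rewrite F'E lee_fin mulr_ge0//= ltW.
Qed.

End gaussian_tilt.

Section gaussian_window.
Context (R : realType) (V : R) (V0 : 0 < V).
Local Notation mu := (@lebesgue_measure R).
Local Notation nu := (centered_normal V).
Local Notation lk := (lik V).
Local Notation gm := (gauss_mass V).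

Lemma gauss_total (D : R) :
  (\int[mu]_r (lk r D)%:E = (gm * expR (D ^+ 2 / (2 * V)))%:E)%E.
Proof.
have c1 : continuous (fun _ : R => 1 : R) by move=> x; exact: cvg_cst.
have h1 : forall y : R, 0 <= (fun=> 1 : R) y <= 1 by move=> y /=; rewrite ler01 lexx.
have := gauss_identity V0 c1 h1 0 D; rewrite /smooth Rint_cst mulr1 => <-.
by apply: eq_integral => r _; rewrite mul1r.
Qed.

Lemma measurable_lik (D : R) : measurable_fun setT (lk ^~ D).
Proof.
apply: measurableT_comp => //; apply: measurable_funB.
  by apply: measurableT_comp => //; apply: measurable_funM.
by apply: measurable_funM => //; apply: measurable_funM => //; exact: measurable_funX.
Qed.

Lemma lik_ge0 r D : 0 <= lk r D. Proof. exact: expR_ge0. Qed.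

Variables (tau : R) (tau0 : 0 < tau).

Let window (r : R) : R := \1_(`[- tau, 0]%classic) r.
Let good (D : R) : R := \1_(`[0, tau * V]%classic) D.

(** Two Gaussian bumps in [r], centred at the ends [0] and [- tau] of the window; the product of the
    last two factors is $e^{-(r+\tau)^2V/2}$. The heights are the values of [lik] at these ends,
    whose means over the sample stay bounded. *)
Definition tail_bound (r D : R) : R :=
  lk r 0 + lk (- tau) D * (expR (- (tau ^+ 2 * V / 2)) * lk r (tau * V)).

Lemma tail_bound_total (D : R) :
  (\int[mu]_r (tail_bound r D)%:E = (gm * (1 + lk (- tau) D))%:E)%E.
Proof.
have m1 := measurable_lik.
under eq_integral do rewrite /tail_bound EFinD mulrA EFinM.
rewrite ge0_integralD//; last 4 first.
- by move=> r _; rewrite lee_fin lik_ge0.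
- by apply/measurable_EFinP; exact: m1.
- by move=> r _; rewrite -EFinM lee_fin !mulr_ge0 ?expR_ge0 ?lik_ge0.
- by apply/measurable_EFinP; apply: measurable_funM => //; exact: m1.
rewrite ge0_integralZl//; last 3 first.
- by apply/measurable_EFinP; exact: m1.
- by move=> r _; rewrite lee_fin lik_ge0.
- by rewrite lee_fin mulr_ge0 ?expR_ge0 ?lik_ge0.
rewrite !gauss_total -EFinM -EFinD; congr EFin.
rewrite expr0n/= mul0r expR0 mulr1 mulrDr mulr1; congr (_ + _).
have -> : (tau * V) ^+ 2 / (2 * V) = tau ^+ 2 * V / 2 by field; rewrite gt_eqF.
rewrite expRN; field.
by rewrite gt_eqF// expR_gt0.
Qed.

(** If exactly one of [r] and the maximizer [- D / V] lies in the window, an end of the window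
    separates them. From that end to [r] the likelihood decays at least as fast as a Gaussian bump
    centred at the end. *)
Lemma lik_outside (r D : R) : window r != good D -> lk r D <= tail_bound r D.
Proof.
move=> wg.
(* The two signs say that [0], respectively [- tau], separates [r] from [- D / V]. *)
have [h|h] : 0 <= r * D \/ (r + tau) * (tau * V - D) <= 0.
  move: wg; rewrite /window /good !indicE !mem_setE.
  rewrite !in_itv/=; have [r0|r0] := leP r 0; have [D0|D0] := leP 0 D.
  - have [rt|rt] := leP (- tau) r; have [Dt|Dt] := leP D (tau * V); rewrite ?eqxx// => _; right.
    + by apply: mulr_ge0_le0; lra.
    + by apply: mulr_le0_ge0; lra.
  - by left; apply: mulr_le0 => //; exact: ltW.
  - by left; apply: mulr_ge0 => //; exact: ltW.
  - by rewrite andbF/= eqxx.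
- apply: (@le_trans _ _ (lk r 0)); last first.
    by rewrite /tail_bound lerDl !mulr_ge0 ?expR_ge0 ?lik_ge0.
  by rewrite /lik ler_expR mulr0 oppr0; lra.
- apply: (@le_trans _ _ (lk (- tau) D * (expR (- (tau ^+ 2 * V / 2)) * lk r (tau * V)))); last first.
    by rewrite /tail_bound lerDr lik_ge0.
  (* The two exponents differ by [(r + tau) * (tau * V - D)], which [h] makes nonpositive. *)
  by rewrite /lik -!expRD ler_expR; nra.
Qed.

Variables (f : R -> R) (cf : continuous f) (f01 : forall y, 0 <= f y <= 1).

(* Up to an error controlled by [tail_bound], integrating [lik] over the window
   [- tau, 0] is integrating it over the whole line when the maximizer - D / V
   lies in the window, and gives 0 otherwise. *)
Definition window_weight (D : R) : R :=
  good D * (gm * expR (D ^+ 2 / (2 * V))).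

(** Two inequalities between extended reals rather than a bound on a difference, so that they can be
    integrated over the sample before [I1] is known to be finite. *)
Lemma gauss_window (S D : R) :
  let I1 := (\int[mu]_r (window r * (f (S + r * V) * lk r D))%:E)%E in
  let I2 := window_weight D * smooth nu f (S - D) in
  let B := gm * (1 + lk (- tau) D) in
  (I1 <= (I2 + B)%:E)%E /\ (I2%:E <= I1 + B%:E)%E.
Proof.
move=> I1 I2 B.
have mfl : measurable_fun setT (fun r : R => f (S + r * V) * lk r D).
  apply: measurable_funM; last exact: measurable_lik.
  apply: measurableT_comp; first exact: continuous_measurable_fun.
  by apply: measurable_funD => //; exact: measurable_funM.
have fl0 r : 0 <= f (S + r * V) * lk r D.
  by rewrite mulr_ge0 ?lik_ge0//; have /andP[] := f01 (S + r * V).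
have good0 : 0 <= good D by rewrite /good indicE.
have w0 r : 0 <= window r by rewrite /window indicE.
have mw : measurable_fun setT window by apply: measurable_indic; exact: measurable_itv.
have I2E : (I2%:E = \int[mu]_r (good D * (f (S + r * V) * lk r D))%:E)%E.
  rewrite /I2 /window_weight -mulrA EFinM -(gauss_identity V0 cf f01).
  rewrite -ge0_integralZl//; first exact/measurable_EFinP.
  by move=> r _; rewrite lee_fin.
have mt : measurable_fun setT (tail_bound ^~ D).
  apply: measurable_funD; first exact: measurable_lik.
  by apply: measurable_funM => //; apply: measurable_funM => //; exact: measurable_lik.
have t0 r : 0 <= tail_bound r D.
  by rewrite addr_ge0 ?mulr_ge0 ?lik_ge0 ?expR_ge0.
(* Symmetric in the two cutoffs [window r] and [good D], so that it yields both inequalities. *)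
have key r (u v : R) : (u == window r) && (v == good D) || (u == good D) && (v == window r) ->
    u * (f (S + r * V) * lk r D) <= v * (f (S + r * V) * lk r D) + tail_bound r D.
  move=> uv; have [e|ne] := eqVneq (window r) (good D).
    have -> : u = v by move: uv; rewrite e orbb => /andP[/eqP -> /eqP ->].
    by rewrite lerDl.
  have v0 : 0 <= v by case/orP: uv => /andP[_ /eqP ->].
  have u1 : u <= 1.
    by case/orP: uv => /andP[/eqP -> _]; rewrite /window /good indicE lern1; case: (_ \in _).
  apply: (@le_trans _ _ (tail_bound r D)); last by rewrite lerDr mulr_ge0.
  apply: le_trans (lik_outside ne).
  apply: (@le_trans _ _ (1 * (1 * lk r D))); last by rewrite !mul1r.
  apply: ler_pM => //; first by case/orP: uv => /andP[/eqP -> _].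
  by apply: ler_wpM2r; [exact: lik_ge0|have /andP[] := f01 (S + r * V)].
have n1 r : (0 <= (window r * (f (S + r * V) * lk r D))%:E)%E.
  by rewrite lee_fin mulr_ge0.
have n2 r : (0 <= (good D * (f (S + r * V) * lk r D))%:E)%E.
  by rewrite lee_fin mulr_ge0.
have n3 r : (0 <= (tail_bound r D)%:E)%E by rewrite lee_fin.
have m1 : measurable_fun setT (fun r => (window r * (f (S + r * V) * lk r D))%:E).
  by apply/measurable_EFinP; exact: measurable_funM.
have m2 : measurable_fun setT (fun r : R => (good D * (f (S + r * V) * lk r D))%:E).
  by apply/measurable_EFinP; apply: measurable_funM => //.
have m3 : measurable_fun setT (fun r : R => (tail_bound r D)%:E) by exact/measurable_EFinP.
rewrite EFinD /B -tail_bound_total I2E /I1 -!ge0_integralD//.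
split; apply: ge0_le_integral.
- exact: measurableT.
- by move=> r _; exact: n1.
- exact: m1.
- exact: (emeasurable_funD m2 m3).
- by move=> r _; rewrite -EFinD lee_fin; apply: key; rewrite !eqxx.
- exact: measurableT.
- by move=> r _; exact: n2.
- exact: m2.
- exact: (emeasurable_funD m1 m3).
- by move=> r _; rewrite -EFinD lee_fin; apply: key; rewrite !eqxx orbT.
Qed.

End gaussian_window.

(** * Asymptotics of the averaged experiment under tilts *)

Section local_asymptotics.
Context d (T : measurableType d) (R : realType) (P : probability T R).
Variables (psi : T -> R) (bpsi : bounded_measurable psi).
Hypothesis psi0 : \int[P]_x psi x = 0.
Let V := \int[P]_x (psi x ^+ 2).
Hypothesis V0 : 0 < V.
Variables (Tn : forall n, n.-tuple T -> R)
  (mTn : forall n, measurable_fun setT (@Tn n)).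
Variables (theta : R -> nat -> R) (theta0 : R).
Hypothesis theta_cvg : forall s, 0 <= s ->
  Num.sqrt n%:R * (theta s n - theta0) @[n --> \oo] --> s * V.
Variable (L : probability (measurableTypeR R) R).
Hypothesis TnL : forall s, 0 <= s ->
  cvg_in_law (fun n => iid (tilt P bpsi (s / Num.sqrt n%:R)) n)
    (fun n (t : n.-tuple T) => Num.sqrt n%:R * (Tn t - theta s n)) L.

Local Notation mu := (@lebesgue_measure R).
Local Notation nu := (centered_normal V).
Local Notation lk := (lik V).

Definition score_sum n (t : n.-tuple T) : R := sample_sum psi t / Num.sqrt n%:R.
(** Centred at the fixed value [theta0]; the drift of the target along a path reappears as the shift
    [r * V] in [tilted_mean]. *)
Definition rescaled n (t : n.-tuple T) : R := Num.sqrt n%:R * (Tn t - theta0).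

Lemma bm_score_sum n : bounded_measurable (@score_sum n).
Proof. by apply: bmM; [exact: bm_sample_sum|exact: bm_cst]. Qed.

Lemma measurable_rescaled n : measurable_fun setT (@rescaled n).
Proof.
apply: measurable_funM; first exact: measurable_cst.
by apply: measurable_funB; [exact: mTn|exact: measurable_cst].
Qed.

Lemma bm_lik n r : bounded_measurable (fun t : n.-tuple T => lk r (score_sum t)).
Proof.
apply: bm_expR; apply: bmB; last exact: bm_cst.
by apply: bmN; apply: bmM; [exact: bm_cst|exact: bm_score_sum].
Qed.

(** [lik] differs from the exact likelihood ratio of the tilt by this deterministic factor, which
    tends to 1 by [cvg_mgf]. *)
Lemma Rint_lik n r : \int[iid P n]_t lk r (score_sum t) =
  mgf P psi (- r / Num.sqrt n%:R) ^+ n * expR (- (r ^+ 2 * V / 2)).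
Proof.
have := Rint_iid_tilt P bpsi (- r / Num.sqrt n%:R) (@bm_cst _ (n.-tuple T) R 1).
have m0 : mgf P psi (- r / Num.sqrt n%:R) ^+ n != 0 by rewrite expf_neq0// gt_eqF// mgf_gt0.
rewrite Rint_cst => /esym/(canRL (divfK m0)); rewrite mul1r => <-.
rewrite -RintZr; last by apply: bmM; [exact: bm_cst|exact: bm_exp_sum].
apply: eq_Rintegral => t _; rewrite mul1r -expRD; congr expR.
by rewrite /score_sum; ring.
Qed.

Lemma cvg_Rint_lik r : \int[iid P n]_t lk r (score_sum t) @[n --> \oo] --> (1 : R).
Proof.
under eq_fun do rewrite Rint_lik.
have : mgf P psi (- r / Num.sqrt n%:R) ^+ n * expR (- (r ^+ 2 * V / 2)) @[n --> \oo]
    --> expR ((- r) ^+ 2 * V / 2) * expR (- (r ^+ 2 * V / 2)).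
  by apply: cvgM; [exact: (@cvg_mgf _ _ _ _ _ bpsi psi0 (- r))|exact: cvg_cst].
by rewrite -expRD sqrrN subrr expR0.
Qed.

Variables (f : R -> R) (K : R).
Hypotheses (f01 : forall y, 0 <= f y <= 1) (K0 : 0 <= K)
  (flip : forall x y, `|f x - f y| <= K * `|x - y|).

Let cf : continuous f.
Proof.
move=> x; have K1 : 0 < K + 1 by exact: ltr_wpDl K0 ltr01.
apply/cvgrPdist_le => e e0; near=> y.
apply: (le_trans (flip _ _)); apply: (@le_trans _ _ ((K + 1) * `|x - y|)).
  by rewrite ler_wpM2r// lerDl ler01.
rewrite mulrC -ler_pdivlMr//.
near: y; apply: cvgr_dist_le => //; exact: divr_gt0.
Unshelve. all: by end_near. Qed.

Let bf : bounded_measurable (f : measurableTypeR R -> R).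
Proof.
split; first exact: continuous_measurable_fun cf.
by exists 1 => x; have /andP[? ?] := f01 x; rewrite ger0_norm.
Qed.

Let ell := \int[L]_y f y.

Lemma bm_f_shift n c : bounded_measurable (fun t : n.-tuple T => f (rescaled t + c)).
Proof.
have mt : measurable_fun setT (fun t : n.-tuple T => rescaled t + c : measurableTypeR R).
  by apply: measurable_funD => //; exact: measurable_rescaled.
exact: (bm_comp mt bf).
Qed.

Definition tilted_mean n (r : R) : R :=
  \int[iid P n]_t (f (rescaled t + r * V) * lk r (score_sum t)).

Lemma bm_tilted n r :
  bounded_measurable (fun t : n.-tuple T => f (rescaled t + r * V) * lk r (score_sum t)).
Proof. by apply: bmM; [exact: bm_f_shift|exact: bm_lik]. Qed.

Lemma tilted_meanE n r : tilted_mean n r =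
  \int[iid P n]_t lk r (score_sum t) *
  \int[iid (tilt P bpsi (- r / Num.sqrt n%:R)) n]_t f (rescaled t + r * V).
Proof.
rewrite Rint_lik Rint_iid_tilt; last exact: bm_f_shift.
have m0 : mgf P psi (- r / Num.sqrt n%:R) ^+ n != 0 by rewrite expf_neq0// gt_eqF// mgf_gt0.
move: m0; set m := _ ^+ n; set e := expR (- _); set X := \int[_]_t _ => m0.
have -> : m * e * (X / m) = X * e by field.
rewrite -RintZr; last by apply: bmM; [exact: bm_f_shift|exact: bm_exp_sum].
apply: eq_Rintegral => t _; rewrite -mulrA -expRD; congr (_ * expR _).
by rewrite /score_sum; ring.
Qed.

Lemma tilted_mean_bound n r : 0 <= tilted_mean n r <= \int[iid P n]_t lk r (score_sum t).
Proof.
apply/andP; split.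
  apply: Rintegral_ge0 => t _; rewrite mulr_ge0 ?lik_ge0//.
  by have /andP[] := f01 (rescaled t + r * V).
apply: Rint_le; [exact: bm_tilted|exact: bm_lik|] => t.
by rewrite ler_piMl ?lik_ge0//; have /andP[] := f01 (rescaled t + r * V).
Qed.

(** After a change of measure this is the regularity hypothesis at [s = - r], whence the sign
    condition. Replacing the target [theta s n] by [theta0] plus its linear drift costs $o(1)$
    because [f] is Lipschitz. *)
Lemma cvg_tilted_mean r : r <= 0 -> tilted_mean n r @[n --> \oo] --> ell.
Proof.
move=> r0; under eq_fun do rewrite tilted_meanE.
rewrite -[ell]mul1r; apply: cvgM; first exact: cvg_Rint_lik.
have s0 : 0 <= - r by rewrite oppr_ge0.
pose X n := \int[iid (tilt P bpsi (- r / Num.sqrt n%:R)) n]_t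
   f (Num.sqrt n%:R * (Tn t - theta (- r) n)).
have bX n : bounded_measurable (fun t : n.-tuple T =>
    f (Num.sqrt n%:R * (Tn t - theta (- r) n))).
  have mt : measurable_fun setT (fun t : n.-tuple T =>
     Num.sqrt n%:R * (Tn t - theta (- r) n) : measurableTypeR R).
    apply: measurable_funM; first exact: measurable_cst.
    by apply: measurable_funB; [exact: mTn|exact: measurable_cst].
  exact: (bm_comp mt bf).
have Xcvg : X n @[n --> \oo] --> ell.
  have := TnL s0 cf (ex_intro _ 1 (fun y => _)).
  have H1 y : `|f y| <= 1 by have /andP[? ?] := f01 y; rewrite ger0_norm.
  move=> /(_ H1); rewrite (bm_expectation _ bf) => /fine_cvg; apply: cvg_trans.
  apply: near_eq_cvg; near=> n; rewrite /= (bm_expectation _ (bX n))//.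
have dcvg : K * `|Num.sqrt n%:R * (theta (- r) n - theta0) + r * V| @[n --> \oo] --> (0 : R).
  have h : Num.sqrt n%:R * (theta (- r) n - theta0) + r * V @[n --> \oo] --> - r * V + r * V.
    by apply: cvgD; [exact: (theta_cvg s0)|exact: cvg_cst].
  have : K * `|Num.sqrt n%:R * (theta (- r) n - theta0) + r * V| @[n --> \oo]
      --> K * `|- r * V + r * V|.
    by apply: cvgM; [exact: cvg_cst|exact: cvg_norm h].
  by rewrite mulNr addNr normr0 mulr0.
apply: (@squeeze_cvgr _ _ _ _
  (fun n => X n - K * `|Num.sqrt n%:R * (theta (- r) n - theta0) + r * V|)
  (fun n => X n + K * `|Num.sqrt n%:R * (theta (- r) n - theta0) + r * V|)).
- near=> n; rewrite -ler_distl /X -(RintB _ (@bm_f_shift n (r * V)) (bX n)).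
  apply: Rint_norm_le_cst; first exact: bmB (@bm_f_shift n (r * V)) (bX n).
  move=> t; apply: (le_trans (flip _ _)); rewrite le_eqVlt; apply/orP; left.
  by apply/eqP; congr (_ * `|_|); rewrite /rescaled; ring.
- by rewrite -[X in _ --> X]subr0; exact: cvgB.
- by rewrite -[X in _ --> X]addr0; exact: cvgD.
Unshelve. all: by end_near. Qed.

Variables (tau : R) (tau0 : 0 < tau).
Local Notation win := (\1_(`[- tau, 0]%classic) : R -> R).

Lemma measurable_joint n : measurable_fun setT (fun z : n.-tuple T * R =>
  win z.2 * (f (rescaled z.1 + z.2 * V) * lk z.2 (score_sum z.1))).
Proof.
have m1 : measurable_fun setT (fun z : n.-tuple T * R => rescaled z.1).
  exact: measurableT_comp (@measurable_rescaled n) measurable_fst.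
have m2 : measurable_fun setT (fun z : n.-tuple T * R => score_sum z.1).
  exact: measurableT_comp (@bm_score_sum n).1 measurable_fst.
have m3 : measurable_fun setT (fun z : n.-tuple T * R => z.2) by exact: measurable_snd.
apply: measurable_funM.
  exact: measurableT_comp (measurable_indic (measurable_itv _)) m3.
apply: measurable_funM.
  apply: (measurableT_comp (f := f)); first exact: continuous_measurable_fun cf.
  by apply: measurable_funD => //; apply: measurable_funM.
apply: measurableT_comp => //; apply: measurable_funB.
  by apply: measurableT_comp => //; apply: measurable_funM.
by apply: measurable_funM => //; apply: measurable_funM => //; exact: measurable_funX.
Qed.

Lemma win_ge0 r : 0 <= win r. Proof. by rewrite indicE. Qed.

Lemma joint_ge0 n (t : n.-tuple T) r :
  0 <= win r * (f (rescaled t + r * V) * lk r (score_sum t)).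
Proof.
rewrite mulr_ge0 ?win_ge0// mulr_ge0 ?lik_ge0//.
by have /andP[] := f01 (rescaled t + r * V).
Qed.

Lemma joint_tonelli n :
  (\int[iid P n]_t \int[mu]_r (win r * (f (rescaled t + r * V) * lk r (score_sum t)))%:E =
   \int[mu]_r (win r * tilted_mean n r)%:E)%E.
Proof.
rewrite (fubini_tonelli (m1 := iid P n) (m2 := mu) (fun z : n.-tuple T * R =>
  (win z.2 * (f (rescaled z.1 + z.2 * V) * lk z.2 (score_sum z.1)))%:E)).
- apply: eq_integral => r _ /=.
  have b1 : bounded_measurable (fun t : n.-tuple T =>
      win r * (f (rescaled t + r * V) * lk r (score_sum t))).
    by apply: bmM; [exact: bm_cst|exact: bm_tilted].
  by rewrite (bm_int_fin _ b1) RintZl//; exact: bm_tilted.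
- by apply/measurable_EFinP; exact: measurable_joint.
- by move=> z; rewrite lee_fin joint_ge0.
Qed.

Lemma measurable_win_tilted n : measurable_fun setT (fun r : R => win r * tilted_mean n r).
Proof.
have := @measurable_fun_fubini_tonelli_G _ _ _ _ R (iid P n) (fun z : n.-tuple T * R =>
  (win z.2 * (f (rescaled z.1 + z.2 * V) * lk z.2 (score_sum z.1)))%:E).
move=> H; apply/measurable_EFinP.
rewrite (_ : _ \o _ = fubini_G (iid P n) (fun z : n.-tuple T * R =>
  (win z.2 * (f (rescaled z.1 + z.2 * V) * lk z.2 (score_sum z.1)))%:E)); last first.
  apply/funext => r; rewrite /fubini_G /=.
  have b1 : bounded_measurable (fun t : n.-tuple T =>
      win r * (f (rescaled t + r * V) * lk r (score_sum t))).
    by apply: bmM; [exact: bm_cst|exact: bm_tilted].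
  by rewrite (bm_int_fin _ b1) RintZl//; exact: bm_tilted.
apply: H; first by apply/measurable_EFinP; exact: measurable_joint.
by move=> z; rewrite lee_fin joint_ge0.
Qed.

Lemma win_tilted_bound : exists2 C : R, 0 <= C & forall n r,
  `|win r * tilted_mean n r| <= C * win r.
Proof.
have [C C0 HC] := mgf_growth bpsi psi0.
exists (expR (tau ^+ 2 * C * expR (tau * C))); first exact: expR_ge0.
move=> n r; rewrite normrM (ger0_norm (win_ge0 r)) mulrC.
have [->|rw] : win r = 0 \/ - tau <= r <= 0.
- rewrite indicE mem_setE in_itv/=; case: (_ <= r <= 0); [by right|by left].
- by rewrite !mulr0.
have /andP[h0 h1] := tilted_mean_bound n r.
rewrite ler_wpM2r ?win_ge0// ger0_norm//; apply: (le_trans h1).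
rewrite Rint_lik -[leRHS]mulr1; apply: ler_pM; rewrite ?expR_ge0//.
- by rewrite exprn_ge0// ltW// mgf_gt0.
- apply: (le_trans (HC _ _)); rewrite ler_expR normrN sqrrN.
  have rt : `|r| <= tau by rewrite ler0_norm; lra.
  apply: ler_pM.
  + by rewrite mulr_ge0// sqr_ge0.
  + exact: expR_ge0.
  + rewrite ler_wpM2r// -(real_normK (num_real r)) lerXn2r// ?nnegrE//.
    exact: ltW.
  + by rewrite ler_expR ler_wpM2r.
- by rewrite -[leRHS]expR0 ler_expR oppr_le0 divr_ge0// mulr_ge0 ?sqr_ge0// ltW.
Qed.

Lemma cvg_window_mean :
  (\int[mu]_r (win r * tilted_mean n r)%:E @[n --> \oo] --> (tau * ell)%:E)%E.
Proof.
have [C C0 HC] := win_tilted_bound.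
have iw : mu.-integrable setT (EFin \o (fun r => C * win r)).
  rewrite (_ : _ \o _ = fun r => (C%:E * (EFin \o win) r)%E); last first.
    by apply/funext => r; rewrite /= EFinM.
  apply: integrableZl => //.
  exact: (@integrable_indic_itv R (- tau) 0 true false).
have -> : ((tau * ell)%:E = \int[mu]_r (win r * ell)%:E)%E.
  under eq_integral do rewrite mulrC EFinM.
  rewrite integralZl//; last first.
    exact: (@integrable_indic_itv R (- tau) 0 true false).
  rewrite integral_indic//= setIT lebesgue_measure_itv/= lte_fin oppr_lt0 tau0.
  by rewrite add0e opprK -EFinM mulrC.
have := @dominated_convergence _ _ R mu setT measurableT
  (fun n r => (win r * tilted_mean n r)%:E) (fun r => (win r * ell)%:E)
  (EFin \o (fun r => C * win r)).
case=> //.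
- by move=> n; apply/measurable_EFinP; exact: measurable_win_tilted.
- apply/measurable_EFinP; apply: measurable_funM; last exact: measurable_cst.
  by apply: measurable_indic; exact: measurable_itv.
- apply: aeW => r _; apply/cvg_EFin; first exact: nearW.
  have [->|rw] : win r = 0 \/ - tau <= r <= 0.
  + rewrite indicE mem_setE in_itv/=; case: (_ <= r <= 0); [by right|by left].
  + under eq_fun do rewrite mul0r; rewrite mul0r; exact: cvg_cst.
  apply: cvgM; first exact: cvg_cst.
  by apply: cvg_tilted_mean; lra.
- by apply: aeW => r n _; rewrite /= lee_fin.
Qed.

Lemma bm_smooth : bounded_measurable (smooth nu f : measurableTypeR R -> R).
Proof.
have bs w := bm_shift w bf.
split.
  apply: continuous_measurable_fun => x; have K1 : 0 < K + 1 by exact: ltr_wpDl K0 ltr01.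
  apply/cvgrPdist_le => e e0; near=> y.
  rewrite /smooth -RintB//; apply: Rint_norm_le_cst; first exact: bmB.
  move=> z; apply: (le_trans (flip _ _)); rewrite opprD addrACA subrr addr0.
  apply: (@le_trans _ _ ((K + 1) * `|x - y|)); first by rewrite ler_wpM2r// lerDl ler01.
  rewrite mulrC -ler_pdivlMr//.
  near: y; apply: cvgr_dist_le => //; exact: divr_gt0.
exists 1 => x; apply: Rint_norm_le_cst => // z.
by have /andP[? ?] := f01 (x + z); rewrite ger0_norm.
Unshelve. all: by end_near. Qed.

(** A positive functional of [g]: the integral of [g] for the law of the residual
    [rescaled t - score_sum t], reweighted by [window_weight] and divided by [tau]. Its total mass
    is close to 1 only once [n] and then [tau] are large. *)
Definition averaged n (g : R -> R) : R := tau^-1 * \int[iid P n]_t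
  (window_weight V tau (score_sum t) * g (rescaled t - score_sum t)).

Lemma bm_weight n :
  bounded_measurable (fun t : n.-tuple T => window_weight V tau (score_sum t)).
Proof.
apply: bmM.
  apply: (bm_comp (h := @score_sum n) (f := \1_(`[0, tau * V]%classic) : R -> R)).
    exact: (@bm_score_sum n).1.
  by apply: bm_indic; exact: measurable_itv.
apply: bmM; first exact: bm_cst.
apply: bm_expR; apply: bmM; last exact: bm_cst.
under eq_fun do rewrite expr2; apply: bmM; exact: bm_score_sum.
Qed.

Lemma bm_residual n (g : R -> R) : bounded_measurable (g : measurableTypeR R -> R) ->
  bounded_measurable (fun t : n.-tuple T => g (rescaled t - score_sum t)).
Proof.
move=> bg.
have mt : measurable_fun setT (fun t : n.-tuple T =>
    rescaled t - score_sum t : measurableTypeR R).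
  by apply: measurable_funB; [exact: measurable_rescaled|exact: (@bm_score_sum n).1].
exact: (bm_comp mt bg).
Qed.

(** The error in [gauss_window] has mean tending to [2 * gauss_mass V], since [lik] has mean tending
    to 1. The third [gauss_mass V] absorbs what remains of the limits in [n]. *)
Lemma averaged_smooth_cvg :
  \forall n \near \oo, `|averaged n (smooth nu f) - ell| <= 3 * gauss_mass V / tau.
Proof.
have gm0 := gauss_mass_gt0 V0.
pose I2 n (t : n.-tuple T) :=
  window_weight V tau (score_sum t) * smooth nu f (rescaled t - score_sum t).
pose B n (t : n.-tuple T) := gauss_mass V * (1 + lk (- tau) (score_sum t)).
pose J n := fine (\int[mu]_r (win r * tilted_mean n r)%:E).
have bI2 n : bounded_measurable (@I2 n).
  by apply: bmM; [exact: bm_weight|apply: bm_residual; exact: bm_smooth].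
have bB n : bounded_measurable (@B n).
  by apply: bmM; [exact: bm_cst|apply: bmD; [exact: bm_cst|exact: bm_lik]].
have I20 n t : 0 <= @I2 n t.
  rewrite !mulr_ge0 ?expR_ge0//; [exact: ltW|].
  by apply: Rintegral_ge0 => z _; have /andP[] := f01 (rescaled t - score_sum t + z).
have B0 n t : 0 <= @B n t by rewrite mulr_ge0 ?(ltW gm0)// addr_ge0 ?lik_ge0.
have /fine_cvgP[Jfin Jcvg] := cvg_window_mean.
have EB : \int[iid P n]_t B n t @[n --> \oo] --> 2 * gauss_mass V.
  have -> : (fun n => \int[iid P n]_t B n t) =
      fun n => gauss_mass V * (1 + \int[iid P n]_t lk (- tau) (score_sum t)).
    apply/funext => n; rewrite RintZl; last by apply: bmD; [exact: bm_cst|exact: bm_lik].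
    by rewrite RintD ?Rint_cst//; [exact: bm_cst|exact: bm_lik].
  rewrite mulrC; apply: cvgM; first exact: cvg_cst.
  by apply: cvgD; [exact: cvg_cst|exact: cvg_Rint_lik].
have h1 : gauss_mass V * 4^-1 > 0 by rewrite mulr_gt0.
have EBn : \forall n \near \oo, \int[iid P n]_t B n t <= 2 * gauss_mass V + gauss_mass V * 4^-1.
  by apply: (cvgr_le _ EB); rewrite ltrDl.
have Jn : \forall n \near \oo, `|tau * ell - J n| <= gauss_mass V * 4^-1.
  by move/cvgrPdist_le : Jcvg => /(_ _ h1).
near=> n.
have Jf : (\int[mu]_r (win r * tilted_mean n r)%:E = (J n)%:E)%E.
  by rewrite /J fineK//; near: n.
have mt : measurable_fun setT (fun t : n.-tuple T =>
    (\int[mu]_r (win r * (f (rescaled t + r * V) * lk r (score_sum t)))%:E)%E).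
  have := @measurable_fun_fubini_tonelli_F _ _ _ _ R mu (fun z : n.-tuple T * R =>
    (win z.2 * (f (rescaled z.1 + z.2 * V) * lk z.2 (score_sum z.1)))%:E).
  apply; first by apply/measurable_EFinP; exact: measurable_joint.
  by move=> z; rewrite lee_fin joint_ge0.
have inner0 (t : n.-tuple T) :
    (0 <= \int[mu]_r (win r * (f (rescaled t + r * V) * lk r (score_sum t)))%:E)%E.
  by apply: integral_ge0 => r _; rewrite lee_fin joint_ge0.
have up : J n <= \int[iid P n]_t I2 n t + \int[iid P n]_t B n t.
  rewrite -(RintD _ (bI2 n) (bB n)) -lee_fin -Jf -joint_tonelli -(bm_int_fin _ (bmD (bI2 n) (bB n))).
  apply: ge0_le_integral => //.
  - by apply/measurable_EFinP; have [] := bmD (bI2 n) (bB n).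
  - move=> t _; have [h _] := gauss_window V0 tau cf f01 (rescaled t) (score_sum t).
    exact: h.
have lo : \int[iid P n]_t I2 n t <= J n + \int[iid P n]_t B n t.
  rewrite -lee_fin EFinD -Jf -joint_tonelli -(bm_int_fin _ (bI2 n)) -(bm_int_fin _ (bB n)).
  rewrite -ge0_integralD//; last 2 first.
  - by move=> t _; rewrite lee_fin.
  - by apply/measurable_EFinP; have [] := bB n.
  apply: ge0_le_integral => //.
  - by move=> t _; rewrite lee_fin.
  - by apply/measurable_EFinP; have [] := bI2 n.
  - by apply: emeasurable_funD => //; apply/measurable_EFinP; have [] := bB n.
  - move=> t _; have [_ h] := gauss_window V0 tau cf f01 (rescaled t) (score_sum t).
    exact: h.
have EBn' : \int[iid P n]_t B n t <= 2 * gauss_mass V + gauss_mass V * 4^-1 by near: n.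
have Jn' : `|tau * ell - J n| <= gauss_mass V * 4^-1 by near: n.
have -> : averaged n (smooth nu f) - ell = (\int[iid P n]_t I2 n t - tau * ell) / tau.
  by rewrite /averaged -/(I2 n); field; rewrite gt_eqF.
rewrite normrM [`|tau^-1|]ger0_norm ?invr_ge0 ?(ltW tau0)// ler_pM2r ?invr_gt0//.
rewrite ler_norml; move: Jn'; rewrite ler_norml => /andP[j1 j2].
by apply/andP; split; lra.
Unshelve. all: by end_near. Qed.

End local_asymptotics.

(** * The iterated limit and the half-line convolution theorem *)

Section iterated_limit.

(** The pair holds the index of the window, of length [k.+1], and the sample size. How large [n]
    must be may depend on [k], and no rate linking them is available. *)
Definition iter_infty : set_system (nat * nat) :=
  [set A | \forall k \near \oo, \forall n \near \oo, A (k, n)].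

Lemma iter_infty_proper : ProperFilter iter_infty.
Proof.
split.
  move=> H; have : \forall k \near \oo, False.
    near=> k; have : \forall n \near \oo, set0 (k, n) by near: k.
    by move=> /filter_ex[].
  by move=> /filter_ex[].
split.
- rewrite /iter_infty/=; near=> k; exact: filterT.
- move=> A B HA HB; rewrite /iter_infty/=; near=> k.
  have hA : \forall n \near \oo, A (k, n) by near: k.
  have hB : \forall n \near \oo, B (k, n) by near: k.
  by near=> n; split; near: n.
- move=> A B AB HA; rewrite /iter_infty/=; near=> k.
  have hA : \forall n \near \oo, A (k, n) by near: k.
  by near=> n; apply: AB; near: n.
Unshelve. all: by end_near. Qed.

Lemma cvg_iter_infty (R : realType) (h : nat * nat -> R) (l c : R) :
  (forall k, \forall n \near \oo, `|h (k, n) - l| <= c / k.+1%:R) ->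
  h x @[x --> iter_infty] --> l.
Proof.
move=> H; have FF := iter_infty_proper.
apply/cvgrPdist_le => e e0.
have : c / k.+1%:R @[k --> \oo] --> c * 0.
  by apply: cvgM; [exact: cvg_cst|exact: cvg_harmonic].
rewrite mulr0 => /cvgr_le/(_ _ e0) ke.
suff: \forall k \near \oo, \forall n \near \oo, `|l - h (k, n)| <= e by [].
near=> k.
have ke' : c / k.+1%:R <= e by near: k.
have Hk := H k; near=> n; rewrite distrC; apply: le_trans ke'; near: n.
exact: Hk.
Unshelve. all: by end_near. Qed.

End iterated_limit.

Section halfline_convolution.
Context d (T : measurableType d) (R : realType) (P : probability T R).
Variables (psi : T -> R) (bpsi : bounded_measurable psi).
Hypothesis psi0 : \int[P]_x psi x = 0.
Let V := \int[P]_x (psi x ^+ 2).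
Hypothesis V0 : 0 < V.
Variables (Tn : forall n, n.-tuple T -> R)
  (mTn : forall n, measurable_fun setT (@Tn n)).
Variables (theta : R -> nat -> R) (theta0 : R).
Hypothesis theta_cvg : forall s, 0 <= s ->
  Num.sqrt n%:R * (theta s n - theta0) @[n --> \oo] --> s * V.
Variable (L : probability (measurableTypeR R) R).
Hypothesis TnL : forall s, 0 <= s ->
  cvg_in_law (fun n => iid (tilt P bpsi (s / Num.sqrt n%:R)) n)
    (fun n (t : n.-tuple T) => Num.sqrt n%:R * (Tn t - theta s n)) L.

Theorem halfline_convolution : is_normal_convolution V L.
Proof.
pose A (kn : nat * nat) (g : R -> R) : R := (kn.1.+1%:R : R)^-1 *
  \int[iid P kn.2]_t (window_weight V kn.1.+1%:R (score_sum psi t) *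
     g (rescaled Tn theta0 t - score_sum psi t)).
have bw (kn : nat * nat) : bounded_measurable (fun t : kn.2.-tuple T =>
    window_weight V (kn.1.+1%:R : R) (score_sum psi t)).
  exact: bm_weight.
have bg (kn : nat * nat) (g : measurableTypeR R -> R) : bounded_measurable g ->
    bounded_measurable (fun t : kn.2.-tuple T => g (rescaled Tn theta0 t - score_sum psi t)).
  exact: bm_residual.
have w0 (kn : nat * nat) (t : kn.2.-tuple T) :
    0 <= window_weight V (kn.1.+1%:R : R) (score_sum psi t).
  rewrite /window_weight indicE mulr_ge0// mulr_ge0 ?expR_ge0//.
  by apply/ltW; exact: gauss_mass_gt0.
have Acvg (f : R -> R) (K : R) : (forall y, 0 <= f y <= 1) -> 0 <= K ->
    (forall x y, `|f x - f y| <= K * `|x - y|) ->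
    A kn (smooth (centered_normal V) f) @[kn --> iter_infty] --> \int[L]_y f y.
  move=> f01 K0 flip; apply: (@cvg_iter_infty _ _ _ (3 * gauss_mass V)) => k.
  exact: (averaged_smooth_cvg psi0 V0 mTn theta_cvg TnL f01 K0 flip (ltr0Sn R k)).
apply: (@limit_deconvolution _ (centered_normal V) L _ _ A).
- exact: iter_infty_proper.
- move=> kn f g bf bg'; rewrite /A -mulrDr -RintD; last 2 first.
  + exact: bmM (bw kn) (bg kn _ bf).
  + exact: bmM (bw kn) (bg kn _ bg').
  by congr (_ * _); apply: eq_Rintegral => t _; rewrite mulrDr.
- move=> kn c f bf; rewrite /A mulrCA -(RintZl _ c (bmM (bw kn) (bg kn _ bf))).
  by congr (_ * _); apply: eq_Rintegral => t _; rewrite mulrCA.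
- move=> kn f g bf bg' fg; rewrite /A ler_pM2l ?invr_gt0//.
  apply: Rint_le; [exact: bmM (bw kn) (bg kn _ bf)|exact: bmM (bw kn) (bg kn _ bg')|].
  by move=> t; rewrite ler_wpM2l.
(* The constant function 1 is its own smoothing, so the convergence on test functions also gives the
   total mass. *)
- have h : forall y : R, 0 <= (fun=> 1 : R) y <= 1 by move=> y /=; rewrite ler01 lexx.
  have h2 : forall x y : R, `|(fun=> 1 : R) x - (fun=> 1 : R) y| <= 0 * `|x - y|.
    by move=> x y; rewrite subrr normr0 mul0r.
  have := Acvg (fun=> 1) 0 h (lexx _) h2.
  rewrite Rint_cst (_ : smooth (centered_normal V) (fun=> 1) = fun=> 1)//.
  by apply/funext => w; rewrite /smooth Rint_cst.
- move=> a dl dl0; apply: (Acvg _ dl^-1).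
  + by move=> y; rewrite clamp_ge0 clamp_le1.
  + by rewrite invr_ge0 ltW.
  + by move=> x y; exact: clamp_lip.
Qed.

End halfline_convolution.

(** * Square-integrable scores and the tangent space *)

Section integrable_linear.
Context d (T : measurableType d) (R : realType) (mu : {measure set T -> \bar R}).
Implicit Types f h : T -> R.

Lemma integrable_scale (a : R) f : mu.-integrable setT (EFin \o f) ->
  mu.-integrable setT (EFin \o (fun x => a * f x)).
Proof.
move=> intf; rewrite (_ : _ \o _ = fun x => (a%:E * (EFin \o f) x)%E).
  by apply: integrableZl.
by apply/funext => x; rewrite /= EFinM.
Qed.

Lemma integrable_lin (a : R) f h : mu.-integrable setT (EFin \o f) ->
  mu.-integrable setT (EFin \o h) ->
  mu.-integrable setT (EFin \o (fun x => a * f x + h x)).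
Proof.
move=> intf inth.
rewrite (_ : _ \o _ = (EFin \o (fun x => a * f x)%R) \+ (EFin \o h))%E; last first.
  by apply/funext => x; rewrite /= EFinD.
by apply: integrableD => //; exact: integrable_scale.
Qed.

Lemma Rint_lin (a : R) f h : mu.-integrable setT (EFin \o f) ->
  mu.-integrable setT (EFin \o h) ->
  \int[mu]_x (a * f x + h x) = a * \int[mu]_x f x + \int[mu]_x h x.
Proof.
move=> intf inth; rewrite RintegralD// ?RintegralZl//.
exact: integrable_scale.
Qed.

Lemma integrable_bigsum (I : Type) (s : seq I) (F : I -> T -> R) :
  (forall i, mu.-integrable setT (EFin \o F i)) ->
  mu.-integrable setT (EFin \o (fun x => \sum_(i <- s) F i x)) /\
  \int[mu]_x (\sum_(i <- s) F i x) = \sum_(i <- s) \int[mu]_x F i x.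
Proof.
move=> iF; elim: s => [|i s [IH1 IH2]].
  rewrite (_ : (fun x => _) = fun=> 0); last by apply/funext => x; rewrite big_nil.
  rewrite big_nil; split; first exact: integrable0.
  by rewrite Rintegral_cst// mul0r.
rewrite (_ : (fun x => _) = fun x => 1 * F i x + \sum_(j <- s) F j x); last first.
  by apply/funext => x; rewrite big_cons mul1r.
by split; [exact: integrable_lin|rewrite Rint_lin// big_cons IH2 mul1r].
Qed.

End integrable_linear.

Section square_integrable.
Context d (T : measurableType d) (R : realType) (P : probability T R).
Implicit Types f g h phi : T -> R.

Lemma L2P f : f \in Lfun P 2%:E <->
  measurable_fun setT f /\ P.-integrable setT (EFin \o (fun x => f x ^+ 2)).
Proof.
split=> [f2|[mf if2]].
  split; last exact: Lfun2_integrable_sqr.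
  by move: f2; rewrite inE => /andP[]; rewrite inE.
rewrite inE; apply/andP; split; rewrite inE//=.
rewrite /finite_norm unlock poweR_lty//.
under eq_integral => x _ do rewrite /= powR_mulrn// real_normK ?num_real//.
exact: integrable_lty.
Qed.

Lemma L2_measurable f : f \in Lfun P 2%:E -> measurable_fun setT f.
Proof. by move=> /L2P[]. Qed.

Lemma L2_integrable f : f \in Lfun P 2%:E -> P.-integrable setT (EFin \o f).
Proof.
move=> f2; apply/Lfun1_integrable; apply: Lfun_subset12 => //.
by rewrite fin_num_measure.
Qed.

Lemma L2_bm f : bounded_measurable f -> f \in Lfun P 2%:E.
Proof.
move=> bf; apply/L2P; split; first by case: bf.
by apply: bm_integrable; under eq_fun do rewrite expr2; exact: bmM.
Qed.

Lemma bmM_integrable phi f : bounded_measurable phi ->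
  P.-integrable setT (EFin \o f) ->
  P.-integrable setT (EFin \o (fun x => phi x * f x)).
Proof.
move=> [mphi [M phiM]] intf.
have mf : measurable_fun setT f by apply/measurable_EFinP; exact: (measurable_int P).
apply: (le_integrable measurableT _ _ (integrableZl measurableT M intf)).
  by apply/measurable_EFinP; exact: measurable_funM.
move=> x _; rewrite /= lee_fin !normrM; apply: ler_pM => //.
exact: le_trans (phiM x) (ler_norm _).
Qed.

Lemma L2_mul_integrable f g : f \in Lfun P 2%:E -> g \in Lfun P 2%:E ->
  P.-integrable setT (EFin \o (fun x => f x * g x)).
Proof. by move=> f2 g2; apply/Lfun1_integrable; exact: Lfun2_mul_Lfun1. Qed.

Lemma L2_lin (a : R) f h : f \in Lfun P 2%:E -> h \in Lfun P 2%:E ->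
  a *: f + h \in Lfun P 2%:E.
Proof.
move=> f2 h2; apply/L2P; split.
  apply: measurable_funD; last exact: L2_measurable.
  by apply: measurable_funM => //; exact: L2_measurable.
have /L2P[_ i1] := f2; have /L2P[_ i2] := h2.
have i3 := L2_mul_integrable f2 h2.
rewrite (_ : (fun x => _) = fun x => a ^+ 2 * f x ^+ 2 + (2 * a * (f x * h x) + h x ^+ 2)).
  have i4 := integrable_lin (2 * a) i3 i2.
  exact: (integrable_lin (a ^+ 2) i1 i4).
by apply/funext => x; rewrite (_ : (a *: f + h) x = a * f x + h x)//; ring.
Qed.

Lemma tangentP h : tangent P h <->
  h \in Lfun P 2%:E /\ \int[P]_x h x = 0.
Proof.
rewrite /tangent/= unlock; split=> -[h2 h0]; split=> //.
  by rewrite /Rintegral; have -> := h0.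
have := integrable_fin_num measurableT (L2_integrable h2) => hf.
by rewrite -[LHS]fineK//; congr EFin.
Qed.

Lemma tangent_subspace : linear_subspace (tangent P).
Proof.
split.
  apply/tangentP; split; first by apply: L2_bm; exact: bm_cst.
  by rewrite Rint_cst.
move=> a f h /tangentP[f2 f0] /tangentP[h2 h0]; apply/tangentP; split; first exact: L2_lin.
rewrite Rint_lin; [by rewrite f0 h0 mulr0 addr0|exact: L2_integrable|exact: L2_integrable].
Qed.

End square_integrable.

(** * From Hellinger differentiability to derivatives of means *)

Section hellinger.
Context d (T : measurableType d) (R : realType).
Variables (nu : {sigma_finite_measure set T -> \bar R}) (P Q : probability T R)
  (f g h phi : T -> R) (B t : R).
Hypotheses (mf : measurable_fun setT f) (f0 : forall x, 0 <= f x)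
  (Qf : forall A, measurable A -> Q A = (\int[nu]_(x in A) (f x)%:E)%E).
Hypotheses (mg : measurable_fun setT g) (g0 : forall x, 0 <= g x)
  (Pg : forall A, measurable A -> P A = (\int[nu]_(x in A) (g x)%:E)%E).
Hypotheses (h2 : h \in Lfun P 2%:E) (bphi : bounded_measurable phi)
  (phiB : forall x, `|phi x| <= B) (t0 : 0 < t).

Let r x := (Num.sqrt (f x) - Num.sqrt (g x)) / t - 2^-1 * h x * Num.sqrt (g x).

(** With $a=\sqrt f$, $b=\sqrt g$ and $u$ the remainder [r x], the left side is the absolute value
    of $(a+b)u+t(u+hb/2)hb/2$. Weighted arithmetic-geometric inequalities take the place of
    Cauchy-Schwarz, so that the terms can be integrated one by one; the weight [lam] stays free. *)
Lemma hellinger_pointwise (lam : R) x : 0 < lam ->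
  `|(f x - g x) / t - h x * g x| <=
  lam * (f x + g x) + r x ^+ 2 * ((2 * lam)^-1 + t / 4) + t / 2 * (h x ^+ 2 * g x).
Proof.
move=> lam0; rewrite /r.
have := sqr_sqrtr (f0 x); have := sqr_sqrtr (g0 x).
move: (Num.sqrt (f x)) (Num.sqrt (g x)) (h x) => a b c <- <-.
set u := (a - b) / t - 2^-1 * c * b.
have ab : a - b = t * (u + c * b / 2).
  by rewrite /u; field; rewrite gt_eqF.
have -> : (a ^+ 2 - b ^+ 2) / t - c * b ^+ 2 = (a + b) * u + t * (u + c * b / 2) * (c * b) / 2.
  have -> : (a ^+ 2 - b ^+ 2) / t = (a + b) * (u + c * b / 2).
    by rewrite subr_sqr ab; field; rewrite gt_eqF.
  by rewrite -ab; field.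
(* This combines $|(a+b)u|\le\lambda(a+b)^2/2+u^2/(2\lambda)$ with $(a+b)^2/2\le a^2+b^2$. *)
have h1 : `|(a + b) * u| <= lam * (a ^+ 2 + b ^+ 2) + u ^+ 2 * (2 * lam)^-1.
  have k0 : 0 < (2 * lam)^-1 by rewrite invr_gt0 mulr_gt0.
  have kl : lam * (2 * lam)^-1 = 2^-1 by field; rewrite gt_eqF.
  move: k0 kl; set k := (2 * lam)^-1 => k0 kl.
  have e1 : 0 <= k * (lam * (a + b) - u) ^+ 2 by rewrite mulr_ge0 ?sqr_ge0 ?ltW.
  have e2 : 0 <= k * (lam * (a + b) + u) ^+ 2 by rewrite mulr_ge0 ?sqr_ge0 ?ltW.
  have e3 : 0 <= lam * (a - b) ^+ 2 by rewrite mulr_ge0 ?sqr_ge0 ?ltW.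
  have E1 : k * (lam * (a + b) - u) ^+ 2 = (lam * k) * lam * (a + b) ^+ 2
      - (lam * k) * 2 * (a + b) * u + k * u ^+ 2 by ring.
  have E2 : k * (lam * (a + b) + u) ^+ 2 = (lam * k) * lam * (a + b) ^+ 2
      + (lam * k) * 2 * (a + b) * u + k * u ^+ 2 by ring.
  rewrite E1 kl in e1; rewrite E2 kl in e2.
  by rewrite ler_norml; apply/andP; split; lra.
have h3 : `|t * (u + c * b / 2) * (c * b) / 2| <= u ^+ 2 * (t / 4) + t / 2 * (c ^+ 2 * b ^+ 2).
  have -> : t * (u + c * b / 2) * (c * b) / 2 = t * ((u + c * b / 2) * (c * b) / 2) by ring.
  rewrite normrM (gtr0_norm t0).
  have -> : u ^+ 2 * (t / 4) + t / 2 * (c ^+ 2 * b ^+ 2) = t * (u ^+ 2 / 4 + (c * b) ^+ 2 / 2) by field.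
  rewrite ler_pM2l//; set w := c * b.
  have q1 := sqr_ge0 (u - w); have q2 := sqr_ge0 (u + w); have q3 := sqr_ge0 w.
  by rewrite ler_norml; apply/andP; split; lra.
apply: (le_trans (ler_normD _ _)); apply: (le_trans (lerD h1 h3)).
by rewrite le_eqVlt; apply/orP; left; apply/eqP; ring.
Qed.

(** [2 * lam] is the integral of [lam * (f x + g x)], both densities having mass 1. In use, [lam] is
    fixed by the tolerance while [rho] and [t] tend to 0. *)
Lemma hellinger_bound (lam rho : R) : 0 < lam ->
  (\int[nu]_x (r x ^+ 2)%:E = rho%:E)%E ->
  `|t^-1 * (\int[Q]_x phi x - \int[P]_x phi x) - \int[P]_x (phi x * h x)| <=
  B * (2 * lam + rho * ((2 * lam)^-1 + t / 4) + t / 2 * \int[P]_x (h x ^+ 2)).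
Proof.
move=> lam0 rhoE.
have [i1 e1] := Rint_density mf f0 Qf bphi.
have [i2 e2] := Rint_density mg g0 Pg bphi.
have ih := L2_integrable h2.
have [i3 e3] := density_integral mg g0 Pg (bmM_integrable bphi ih).
have /L2P[mh ih2] := h2.
have [i4 e4] := density_integral mg g0 Pg ih2.
have [i5 e5] := Rint_density mf f0 Qf (@bm_cst _ T R 1).
have [i6 e6] := Rint_density mg g0 Pg (@bm_cst _ T R 1).
rewrite Rint_cst in e5; rewrite Rint_cst in e6.
have mr : measurable_fun setT r.
  have ms (k : T -> R) : measurable_fun setT k -> measurable_fun setT (fun x => Num.sqrt (k x)).
    by move=> mk; apply: measurableT_comp mk; apply: continuous_measurable_fun; exact: sqrt_continuous.
  apply: measurable_funB; first by apply: measurable_funM => //; apply: measurable_funB; exact: ms.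
  by apply: measurable_funM; [exact: measurable_funM|exact: ms].
have ir : nu.-integrable setT (EFin \o (fun x => r x ^+ 2)).
  apply/integrableP; split; first by apply/measurable_EFinP; exact: measurable_funX.
  under eq_integral do rewrite /= ger0_norm ?sqr_ge0//.
  by rewrite rhoE ltry.
set G1 := fun x => phi x * f x in i1 e1; set G2 := fun x => phi x * g x in i2 e2.
set G3 := fun x => phi x * h x * g x in i3 e3.
set G4 := fun x => h x ^+ 2 * g x in i4 e4.
set G5 := fun x => 1 * f x in i5 e5; set G6 := fun x => 1 * g x in i6 e6.
have i21 := integrable_lin (-1) i2 i1.
have i321 := integrable_lin (- t) i3 i21.
pose c := (2 * lam)^-1 + t / 4.
have i4r := integrable_lin (t / 2) i4 (integrable_scale c ir).
have i64r := integrable_lin lam i6 i4r.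
have i564r := integrable_lin lam i5 i64r.
have -> : t^-1 * (\int[Q]_x phi x - \int[P]_x phi x) - \int[P]_x (phi x * h x) =
    t^-1 * \int[nu]_x (- t * G3 x + (-1 * G2 x + G1 x)).
  rewrite (Rint_lin (- t) i3 i21) (Rint_lin (-1) i2 i1) -e1 -e2 -e3.
  by field; rewrite gt_eqF.
have Be : B * (2 * lam + rho * c + t / 2 * \int[P]_x (h x ^+ 2)) =
    B * \int[nu]_x (lam * G5 x + (lam * G6 x + (t / 2 * G4 x + c * r x ^+ 2))).
  rewrite (Rint_lin lam i5 i64r) (Rint_lin lam i6 i4r) (Rint_lin (t / 2) i4 (integrable_scale c ir)).
  rewrite RintegralZl// -e5 -e6 -e4 /Rintegral rhoE /=.
  by congr (_ * _); ring.
rewrite Be -(RintegralZl _ _ i321)// -(RintegralZl _ _ i564r)//.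
have ib := integrable_scale B i564r.
have ia := integrable_scale t^-1 i321.
apply: (le_trans (le_normr_Rintegral _ ia)) => //.
apply: le_Rintegral => //; first exact: integrable_norm.
move=> x _.
have -> : t^-1 * (- t * G3 x + (-1 * G2 x + G1 x)) =
    phi x * ((f x - g x) / t - h x * g x).
  by rewrite /G3 /G2 /G1; field; rewrite gt_eqF.
rewrite normrM; apply: ler_pM => //; apply: (le_trans (hellinger_pointwise x lam0)).
rewrite /G4 /G5 /G6 /c !mul1r le_eqVlt; apply/orP; left; apply/eqP; ring.
Qed.

End hellinger.

(** * One-sided derivatives *)

Section right_derivative.
Context (R : realType).

(** The base value [u0] is a separate argument, so that a path of laws need not be evaluated at
    [t = 0]. *)
Definition right_diff (u : R -> R) (u0 D : R) : Prop :=
  t^-1 * (u t - u0) @[t --> 0^'+] --> D.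

Lemma right_diff_cvg (u : R -> R) (u0 D : R) : right_diff u u0 D -> u t @[t --> 0^'+] --> u0.
Proof.
move=> du.
have t0 : t @[t --> 0^'+] --> (0 : R) by apply: cvg_within_filter; exact: cvg_id.
have : t * (t^-1 * (u t - u0)) + u0 @[t --> 0^'+] --> 0 * D + u0.
  by apply: cvgD; [exact: cvgM|exact: cvg_cst].
rewrite mul0r add0r; apply: cvg_trans; apply: near_eq_cvg; near=> t.
have t_gt0 : 0 < t by near: t; exact: nbhs_right_gt.
by rewrite mulrA divff ?gt_eqF// mul1r subrK.
Unshelve. all: by end_near. Qed.

Lemma right_diffM (u v : R -> R) (u0 v0 D E : R) : right_diff u u0 D -> right_diff v v0 E ->
  right_diff (fun t => u t * v t) (u0 * v0) (D * v0 + u0 * E).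
Proof.
move=> du dv; have cv := right_diff_cvg dv.
rewrite /right_diff (_ : (fun t => _) = fun t =>
  t^-1 * (u t - u0) * v t + u0 * (t^-1 * (v t - v0))).
  apply: cvgD; first exact: cvgM.
  by apply: cvgM => //; exact: cvg_cst.
by apply/funext => t; ring.
Qed.

Lemma right_diff_div (u v : R -> R) (u0 v0 D E : R) : v0 != 0 ->
  right_diff u u0 D -> right_diff v v0 E ->
  right_diff (fun t => u t / v t) (u0 / v0) ((D - u0 / v0 * E) / v0).
Proof.
move=> v00 du dv; have cv := right_diff_cvg dv.
have : (t^-1 * (u t - u0) - u0 / v0 * (t^-1 * (v t - v0))) / v t @[t --> 0^'+] -->
    (D - u0 / v0 * E) / v0.
  apply: cvgM; last exact: cvgV.
  by apply: cvgB => //; apply: cvgM => //; exact: cvg_cst.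
apply: cvg_trans; apply: near_eq_cvg; near=> t.
have vt0 : v t != 0.
  by near: t; exact: (cvgr_neq0 _ cv).
rewrite /=; have t0 : 0 < t by near: t; exact: nbhs_right_gt.
by field; rewrite v00 vt0 gt_eqF.
Unshelve. all: by end_near. Qed.

Lemma right_diff_sum (I : finType) (u : I -> R -> R) (u0 D : I -> R) :
  (forall i, right_diff (u i) (u0 i) (D i)) ->
  right_diff (fun t => \sum_i u i t) (\sum_i u0 i) (\sum_i D i).
Proof.
move=> du; rewrite /right_diff.
rewrite (_ : (fun t => _) = fun t => \sum_i t^-1 * (u i t - u0 i)).
  by apply: cvg_sumr => i _; exact: du.
by apply/funext => t; rewrite -mulr_sumr sumrB.
Qed.

Lemma sup_fin (I : finType) (A : set I) (u : I -> R) : A !=set0 ->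
  (forall i, A i -> u i <= sup (u @` A)) /\ (exists2 i, A i & sup (u @` A) = u i).
Proof.
move=> [i0 Ai0].
pose B := [pred i | `[< A i >]].
have Bi0 : B i0 by exact/asboolP.
pose m := [arg max_(i > i0 | B i) u i]%O.
have [Bm um] : B m /\ forall i, B i -> u i <= u m by rewrite /m; case: arg_maxP.
have Am : A m by move/asboolP: Bm.
have hs : has_sup (u @` A).
  split; first by exists (u m), m.
  by exists (u m) => _ [i /asboolP Ai <-]; exact: um.
have sm : sup (u @` A) = u m.
  apply/eqP; rewrite eq_le; apply/andP; split.
    apply: ge_sup; first by exists (u m), m.
    by move=> _ [i /asboolP Ai <-]; exact: um.
  by apply: (sup_upper_bound hs); exists m.
by split=> [i /asboolP Ai|]; [rewrite sm; exact: um|exists m].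
Qed.

(* Danskin: only the maximizers at [t = 0] matter for small [t]. *)
Lemma right_diff_sup (I : finType) (i0 : I) (u : I -> R -> R) (u0 D : I -> R) :
  (forall i, right_diff (u i) (u0 i) (D i)) ->
  right_diff (fun t => sup (range (fun i => u i t))) (sup (range u0))
    (sup [set D i | i in [set i | forall j, u0 j <= u0 i]]).
Proof.
move=> du; set S := [set i | _].
have supT (v : I -> R) : (forall i, v i <= sup (range v)) /\ exists i, sup (range v) = v i.
  have [h1 [i _ h2]] := @sup_fin I setT v (ex_intro _ i0 Logic.I).
  by split=> [j|]; [exact: h1|exists i].
have [q1 [m qm]] := supT u0.
set q := sup (range u0) in q1 qm *.
have Sm : S m by move=> j; rewrite -qm.
have Sq i : S i -> u0 i = q.
  by move=> Si; apply/eqP; rewrite eq_le q1 qm Si.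
have [D1 [k Sk Dk]] := sup_fin D (ex_intro _ m Sm).
set Dm := sup _ in D1 Dk *.
apply/cvgrPdist_le => e e0.
have upper i : \forall t \near 0^'+, t^-1 * (u i t - q) <= Dm + e.
  have [Si|nSi] := pselect (S i).
    near=> t; rewrite -(Sq i Si); apply: (@le_trans _ _ (D i + e)).
      by near: t; apply: (cvgr_le _ (du i)); rewrite ltrDl.
    by rewrite lerD2r D1.
  (* A nonmaximizer starts below [q] by a fixed gap, so its difference quotient tends to minus
     infinity; it is eventually at most [- M], and [- M <= Dm + e]. *)
  have uq : u0 i < q.
    rewrite lt_neqAle q1 andbT; apply/eqP => uq; apply: nSi => j.
    by rewrite uq.
  have c := right_diff_cvg (du i).
  pose M := `|Dm + e| + 1.
  have M0 : 0 < M by rewrite ltr_wpDl.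
  near=> t.
  have t0 : 0 < t by near: t; exact: nbhs_right_gt.
  have ut : u i t <= (u0 i + q) / 2 by near: t; apply: (cvgr_le _ c); lra.
  have tM : t <= (q - u0 i) / 2 / M.
    by near: t; apply: nbhs_right_le; rewrite !divr_gt0// subr_gt0.
  apply: (@le_trans _ _ (- M)); last first.
    have := ler_norm (- (Dm + e)); rewrite normrN /M; lra.
  rewrite mulrC ler_pdivrMr//; move: tM; rewrite ler_pdivlMr//; lra.
have all_upper : \forall t \near 0^'+, forall i, t^-1 * (u i t - q) <= Dm + e.
  by apply: filter_forall => i; exact: upper.
near=> t.
have t0 : 0 < t by near: t; exact: nbhs_right_gt.
have [v1 [j vj]] := supT (fun i => u i t).
rewrite ler_distl; apply/andP; split.
  have ut : forall i, t^-1 * (u i t - q) <= Dm + e by near: t.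
  by rewrite vj; have := ut j; lra.
(* For the lower bound, the maximizer with the largest derivative is one competitor in the
   supremum. *)
have kt : D k - e <= t^-1 * (u k t - u0 k).
  by near: t; apply: (cvgr_ge _ (du k)); rewrite ltrBlDr ltrDl.
have : t^-1 * (u k t - u0 k) <= t^-1 * (sup (range (fun i => u i t)) - q).
  by rewrite ler_pM2l ?invr_gt0// (Sq k Sk) lerB.
rewrite Dk; lra.
Unshelve. all: by end_near. Qed.

End right_derivative.

Section dqm.
Context (R : realType) (J K : nat) (B0 eps : R).
Notation O := ('I_J.+1 * 'I_K.+1 * R)%type.
Variables (P : probability O R) (h : O -> R) (Pt : R -> probability O R).
Hypotheses (h2 : h \in Lfun P 2%:E) (hPt : dqm_path B0 eps P h Pt).

Lemma dqm_linear (phi : O -> R) : bounded_measurable phi ->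
  right_diff (fun t => \int[Pt t]_o phi o) (\int[P]_o phi o) (\int[P]_o (phi o * h o)).
Proof.
move=> bphi; have [e [nu [f [g [e0 He _ Hcvg]]]]] := hPt.
have [B B_gt0 phiB] := bm_bound_gt0 bphi.
have /fine_cvgP[rfin rcvg] := Hcvg.
pose rho t := fine (\int[nu t]_o (((Num.sqrt (f t o) - Num.sqrt (g t o)) / t
  - 2^-1 * h o * Num.sqrt (g t o)) ^+ 2)%R%:E)%E.
have {}rcvg : rho t @[t --> 0^'+] --> (0 : R) := rcvg.
set H := \int[P]_o (h o ^+ 2).
have H0 : 0 <= H by apply: Rintegral_ge0 => o _; exact: sqr_ge0.
apply/cvgrPdist_le => d d0.
(* Multiplied by [B], the three error terms become at most [d / 4], [d / 8] and [d / 4]. *)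
pose lam := d / (8 * B).
have lam0 : 0 < lam by rewrite divr_gt0// mulr_gt0.
pose c := (2 * lam)^-1 + 1.
have c0 : 0 < c by rewrite addr_gt0// invr_gt0 mulr_gt0.
near=> t.
have t0 : 0 < t by near: t; exact: nbhs_right_gt.
have te : t < e by near: t; exact: nbhs_right_lt.
have t1 : t <= 1 by near: t; exact: nbhs_right_le.
have tH : t <= d / (2 * B) / (H + 1).
  by near: t; apply: nbhs_right_le; rewrite !divr_gt0 ?mulr_gt0// ltr_wpDl.
have te' : 0 <= t < e by rewrite (ltW t0).
have [_ [mf f0 fE] [mg g0 gE]] := He t te'.
have rhoE : (\int[nu t]_o (((Num.sqrt (f t o) - Num.sqrt (g t o)) / t
    - 2^-1 * h o * Num.sqrt (g t o)) ^+ 2)%R%:E)%E = (rho t)%:E.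
  by rewrite /rho fineK//; near: t.
have rc : rho t <= d / (8 * B * c).
  by near: t; apply: (cvgr_le _ rcvg); rewrite divr_gt0// !mulr_gt0.
have r0 : 0 <= rho t by apply: fine_ge0; apply: integral_ge0 => o _; rewrite lee_fin sqr_ge0.
rewrite distrC.
apply: (le_trans (hellinger_bound mf f0 fE mg g0 gE h2 bphi phiB t0 lam0 rhoE)).
have b1 : rho t * ((2 * lam)^-1 + t / 4) <= d / (8 * B).
  apply: (@le_trans _ _ (rho t * c)); first by rewrite ler_wpM2l// lerD2l; lra.
  move: rc; rewrite ler_pdivlMr ?mulr_gt0// => rc.
  by rewrite ler_pdivlMr ?mulr_gt0//; apply: le_trans rc; rewrite le_eqVlt; apply/orP; left; apply/eqP; ring.
have b2 : t / 2 * H <= d / (4 * B).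
  move: tH; rewrite ler_pdivlMr ?ltr_wpDl// => tH.
  have e1 : d / (4 * B) = d / (2 * B) / 2 by field; rewrite gt_eqF.
  by rewrite e1; move: tH; set dd := d / (2 * B); rewrite mulrDr mulr1; lra.
apply: (@le_trans _ _ (B * (2 * lam + d / (8 * B) + d / (4 * B)))).
  by rewrite ler_pM2l// !lerD.
rewrite /lam (_ : B * _ = d * (5 / 8)); last by field; rewrite gt_eqF.
lra.
Unshelve. all: by end_near. Qed.

End dqm.

(** * Truncated outcomes, cell residuals and [mudot] *)

Section observations.
Context (R : realType) (J K : nat) (B0 : R).
Notation O := ('I_J.+1 * 'I_K.+1 * R)%type.
Implicit Types (P Q : probability O R) (x : 'I_J.+1) (a : 'I_K.+1).

Lemma measurable_stratum x : measurable (@stratum R J K x).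
Proof.
have m : measurable_fun setT (fun o : O => o.1.1).
  exact: measurableT_comp measurable_fst measurable_fst.
have := m measurableT [set x] Logic.I; rewrite setTI.
by rewrite (_ : _ @^-1` _ = stratum x).
Qed.

Lemma measurable_cell x a : measurable (@cell R J K x a).
Proof.
have m : measurable_fun setT (fun o : O => o.1.2).
  exact: measurableT_comp measurable_snd measurable_fst.
have := m measurableT [set a] Logic.I; rewrite setTI => ma.
rewrite (_ : cell x a = stratum x `&` (fun o : O => o.1.2) @^-1` [set a]) //.
exact: measurableI (measurable_stratum x) ma.
Qed.

Lemma bm_stratum_fun (G : 'I_J.+1 -> R) : bounded_measurable (fun o : O => G o.1.1).
Proof.
split.
  have mG : measurable_fun setT G by move=> _ Y _; exact: Logic.I.
  apply: (measurableT_comp mG).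
  exact: measurableT_comp measurable_fst measurable_fst.
exists (\sum_x `|G x|) => o.
by rewrite (bigD1 o.1.1)//= lerDl sumr_ge0.
Qed.

Definition bounded_outcome : set O := [set o | `|o.2| <= B0].

Lemma measurable_bounded_outcome : measurable bounded_outcome.
Proof.
have m : measurable_fun setT (fun o : O => `|o.2|).
  by apply: measurableT_comp => //; exact: measurable_snd.
have := m measurableT `]-oo, B0]%classic (measurable_itv _); rewrite setTI.
rewrite (_ : _ @^-1` _ = bounded_outcome)//.
Qed.

(** Almost surely equal to the outcome under every law of the model, but bounded everywhere, as
    [bounded_measurable] requires. *)
Definition trunc_outcome (o : O) : R := o.2 * \1_bounded_outcome o.

Lemma bm_trunc_outcome : bounded_measurable trunc_outcome.
Proof.
split.
  apply: measurable_funM; first exact: measurable_snd.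
  by apply: measurable_indic; exact: measurable_bounded_outcome.
exists `|B0| => o; rewrite /trunc_outcome indicE.
case: (boolP (_ \in _)) => [|_]; last by rewrite mulr0 normr0.
by rewrite inE/= mulr1 => /le_trans; apply; exact: ler_norm.
Qed.

Lemma trunc_outcome_ae Q : Q bounded_outcome = 1%E ->
  {ae Q, forall o, trunc_outcome o = o.2}.
Proof.
move=> Q1; exists (~` bounded_outcome); split.
- exact: measurableC measurable_bounded_outcome.
- rewrite probability_setC; last exact: measurable_bounded_outcome.
  by rewrite Q1 subee.
- move=> o /= no bo; apply: no; rewrite /trunc_outcome indicE mem_set ?mulr1//.
Qed.

Lemma cond_expE Q (f g : O -> R) (E : set O) : measurable E ->
  measurable_fun setT f -> measurable_fun setT g -> {ae Q, forall o, f o = g o} ->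
  cond_exp Q f E = \int[Q]_o (g o * \1_E o) / fine (Q E).
Proof.
move=> mE mf mg fg; rewrite /cond_exp unlock /Rintegral; congr (fine _ / _).
have mi : measurable_fun setT (\1_E : O -> R) by exact: measurable_indic.
apply: ae_eq_integral => //.
- by apply/measurable_EFinP; exact: measurable_funM.
- by apply/measurable_EFinP; exact: measurable_funM.
- by apply: filterS fg => o /= ->.
Qed.

Lemma Psi_sum Q : Psi Q = \sum_x pX Q x * qmax Q x.
Proof.
rewrite /Psi (bm_expectation _ (bm_stratum_fun (qmax Q)))/=.
have -> : (fun o : O => qmax Q o.1.1) = fun o => \sum_x qmax Q x * \1_(stratum x) o.
  apply/funext => o; rewrite (bigD1 o.1.1)//= big1; last first.
    by move=> x xo; rewrite indicE memNset ?mulr0// => /= e; rewrite e eqxx in xo.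
  by rewrite addr0 indicE mem_set ?mulr1.
rewrite Rint_sum; last first.
  by move=> x _; apply: bmM; [exact: bm_cst|apply: bm_indic; exact: measurable_stratum].
apply: eq_bigr => x _; rewrite RintZl; last by apply: bm_indic; exact: measurable_stratum.
by rewrite (Rint_indic _ (measurable_stratum x)) -/(pX Q x) mulrC.
Qed.

(** A ratio of integrals of bounded functions that do not depend on the law: the form to which
    [dqm_linear] and the quotient rule apply. *)
Lemma muE Q a x : Q bounded_outcome = 1%E ->
  mu Q a x = \int[Q]_o (trunc_outcome o * \1_(cell x a) o) / fine (Q (cell x a)).
Proof.
move=> Q1; apply: cond_expE.
- exact: measurable_cell.
- exact: measurable_snd.
- by case: bm_trunc_outcome.
- by apply: filterS (trunc_outcome_ae Q1) => o ->.
Qed.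

End observations.

Section centred_cells.
Context (R : realType) (J K : nat) (B0 : R).
Notation O := ('I_J.+1 * 'I_K.+1 * R)%type.
Variable P : probability O R.
Hypotheses (P_bounded : P (@bounded_outcome R J K B0) = 1%E)
  (P_cell : forall x a, 0 < fine (P (cell x a)))
  (P_strata : forall x, 0 < pX P x).

Local Notation pc x a := (fine (P (cell x a))).
Local Notation yt := (@trunc_outcome R J K B0).

(* The residual Y - mu_a(x) on the cell (x, a), with Y truncated to make it
   bounded everywhere and not only almost surely. *)
Definition cell_resid (x : 'I_J.+1) (a : 'I_K.+1) (o : O) : R :=
  (yt o - mu P a x) * \1_(cell x a) o.

Lemma bm_cell x a : bounded_measurable (\1_(@cell R J K x a) : O -> R).
Proof. by apply: bm_indic; exact: measurable_cell. Qed.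

Lemma bm_cell_resid x a : bounded_measurable (cell_resid x a).
Proof.
apply: bmM; last exact: bm_cell.
by apply: bmB; [exact: bm_trunc_outcome|exact: bm_cst].
Qed.

Lemma propensityE x a : propensity P a x = pc x a / pX P x.
Proof. by []. Qed.

Lemma propensity_gt0 x a : 0 < propensity P a x.
Proof. by rewrite divr_gt0. Qed.

Lemma pXpropensity x a : pX P x * propensity P a x = pc x a.
Proof. by rewrite propensityE mulrC divfK// gt_eqF. Qed.

Lemma Rint_cell_resid x a : \int[P]_o cell_resid x a o = 0.
Proof.
rewrite /cell_resid; under eq_Rintegral do rewrite mulrBl.
have b1 : bounded_measurable (fun o : O => yt o * \1_(cell x a) o).
  by apply: bmM; [exact: bm_trunc_outcome|exact: bm_cell].
have b2 : bounded_measurable (fun o : O => mu P a x * \1_(cell x a) o).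
  by apply: bmM; [exact: bm_cst|exact: bm_cell].
rewrite (RintB _ b1 b2) (RintZl _ _ (bm_cell x a)) (Rint_indic _ (measurable_cell x a)).
by rewrite (muE _ _ P_bounded) divfK ?subrr// gt_eqF.
Qed.

Lemma cell_resid_disjoint x a x' a' : (x, a) != (x', a') ->
  forall o, cell_resid x a o * cell_resid x' a' o = 0.
Proof.
move=> ne o; rewrite /cell_resid !indicE.
case: (boolP (o \in cell x a)) => [|_]; last by rewrite mulr0 mul0r.
case: (boolP (o \in cell x' a')) => [|_]; last by rewrite mulr0 mulr0.
rewrite !inE => -[e1 e2] [e3 e4]; move: ne.
by rewrite -e1 -e2 -e3 -e4 eqxx.
Qed.

Lemma Rint_cell_resid_sqr x a :
  \int[P]_o (cell_resid x a o * cell_resid x a o) = sigma2 P a x * pc x a.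
Proof.
rewrite /sigma2 (cond_expE (g := fun o => (yt o - mu P a x) ^+ 2)).
- rewrite divfK ?gt_eqF//; apply: eq_Rintegral => o _.
  by rewrite /cell_resid indicE; case: (_ \in _); rewrite ?mulr1 ?mulr0 ?expr2.
- exact: measurable_cell.
- apply: measurable_funX; apply: measurable_funB; [exact: measurable_snd|exact: measurable_cst].
- apply: measurable_funX; apply: measurable_funB; [by case: (bm_trunc_outcome J K B0)|exact: measurable_cst].
- by apply: filterS (trunc_outcome_ae P_bounded) => o ->.
Qed.

Definition trunc_resid (a : 'I_K.+1) (o : O) : R :=
  (o.1.2 == a)%:R / propensity P a o.1.1 * (yt o - mu P a o.1.1).

Lemma trunc_residE a x o : trunc_resid a o * \1_(stratum x) o =
  (propensity P a x)^-1 * cell_resid x a o.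
Proof.
rewrite /trunc_resid /cell_resid !indicE.
case: (boolP (o \in stratum x)) => [|ns].
  rewrite inE => /= ox; rewrite ox.
  rewrite (_ : (o \in cell x a) = (o.1.2 == a)); last first.
    by apply/idP/eqP; rewrite inE; [case|move=> ?; split].
  by case: (_ == _); rewrite /= ?mulr1 ?mul1r// !mul0r !mulr0.
rewrite (_ : (o \in cell x a) = false); first by rewrite !mulr0.
apply: contraNF ns; rewrite !inE; by case.
Qed.

Lemma trunc_resid_sum a o : trunc_resid a o =
  \sum_x (propensity P a x)^-1 * cell_resid x a o.
Proof.
under eq_bigr => x _ do rewrite -trunc_residE.
rewrite -mulr_sumr (bigD1 o.1.1)//= big1 ?addr0.
  by rewrite indicE mem_set ?mulr1.
by move=> x xo; rewrite indicE memNset// => /= e; rewrite e eqxx in xo.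
Qed.

Lemma resid_ae a : {ae P, forall o, resid P a o = trunc_resid a o}.
Proof. by apply: filterS (trunc_outcome_ae P_bounded) => o; rewrite /trunc_resid /resid => ->. Qed.

Lemma measurable_resid a : measurable_fun setT (resid P a).
Proof.
have m1 := (@bm_stratum_fun R J K (fun x => (propensity P a x)^-1)).1.
have m2 := (@bm_stratum_fun R J K (fun x => mu P a x)).1.
apply: measurable_funM; last by apply: measurable_funB => //; exact: measurable_snd.
apply: measurable_funM => //.
have mG : measurable_fun setT (fun b : 'I_K.+1 => (b == a)%:R : R) by move=> _ Y _; exact: Logic.I.
apply: (measurableT_comp mG).
exact: measurableT_comp measurable_snd measurable_fst.
Qed.

Lemma bm_trunc_resid a : bounded_measurable (trunc_resid a).
Proof.
rewrite (_ : trunc_resid a = fun o => \sum_x (propensity P a x)^-1 * cell_resid x a o).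
  by apply: bm_sum => x _; apply: bmM; [exact: bm_cst|exact: bm_cell_resid].
by apply/funext => o; exact: trunc_resid_sum.
Qed.

(** The propensity in [resid] and the stratum mass in [cond_exp] multiply to the mass of the cell,
    so [mudot] is a pairing of [h] with a bounded function. *)
Lemma mudotE a h x : h \in Lfun P 2%:E ->
  mudot P a h x = \int[P]_o (cell_resid x a o * h o) / pc x a.
Proof.
move=> h2; have mh := L2_measurable h2.
have mt := (bm_trunc_resid a).1.
rewrite /mudot (cond_expE (g := fun o => trunc_resid a o * h o)).
- rewrite (_ : \int[P]_o _ = (propensity P a x)^-1 * \int[P]_o (cell_resid x a o * h o)).
    rewrite propensityE -/(pX P x).
    by field; rewrite !gt_eqF.
  rewrite -RintegralZl//; last first.
    by apply: bmM_integrable; [exact: bm_cell_resid|exact: L2_integrable].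
  by apply: eq_Rintegral => o _; rewrite mulrAC trunc_residE mulrA.
- exact: measurable_stratum.
- by apply: measurable_funM => //; exact: measurable_resid.
- exact: measurable_funM.
- by apply: filterS (resid_ae a) => o /= ->.
Qed.

(** The constant [Psi P] drops out because [h] has mean zero. *)
Lemma gammaE h : tangent P h -> gamma P h =
  \int[P]_o (qmax P o.1.1 * h o) +
  \sum_x pX P x * sup [set mudot P a h x | a in [set` best P x]].
Proof.
move=> /tangentP[h2 h0]; rewrite /gamma unlock; congr (_ + _).
rewrite -[LHS]/(\int[P]_o ((qmax P o.1.1 - Psi P) * h o)).
have ih := L2_integrable h2.
have i1 := bmM_integrable (@bm_stratum_fun R J K (qmax P)) ih.
transitivity (\int[P]_o (- Psi P * h o + qmax P o.1.1 * h o)).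
  by apply: eq_Rintegral => o _; ring.
by rewrite Rint_lin// h0 mulr0 add0r.
Qed.

Lemma best_range x : [set` best P x] = [set a | forall b, mu P b x <= mu P a x].
Proof.
apply/seteqP; split=> a /=; rewrite inE.
  by move=> /forallP.
by move=> h; apply/forallP.
Qed.

Lemma mudot_lin (c : R) f h a x : f \in Lfun P 2%:E -> h \in Lfun P 2%:E ->
  mudot P a (c *: f + h) x = c * mudot P a f x + mudot P a h x.
Proof.
move=> f2 h2; rewrite !mudotE//; last exact: L2_lin.
have ifz := bmM_integrable (bm_cell_resid x a) (L2_integrable f2).
have ihz := bmM_integrable (bm_cell_resid x a) (L2_integrable h2).
rewrite mulrA -mulrDl -(Rint_lin c ifz ihz); congr (_ / _).
apply: eq_Rintegral => o _.
by rewrite (_ : (c *: f + h) o = c * f o + h o)//; ring.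
Qed.

Lemma Rint_strata (G : 'I_J.+1 -> R) (h : O -> R) :
  P.-integrable setT (EFin \o h) ->
  \int[P]_o (G o.1.1 * h o) = \sum_x \int[P]_o (\1_(stratum x) o * h o) * G x.
Proof.
move=> ih.
have ist x : P.-integrable setT (EFin \o (fun o => \1_(stratum x) o * h o)).
  by apply: bmM_integrable => //; apply: bm_indic; exact: measurable_stratum.
have [_] := integrable_bigsum (index_enum _) (fun x => integrable_scale (G x) (ist x)).
under [X in _ = X -> _]eq_bigr => x _ do rewrite RintegralZl// mulrC.
move=> <-; apply: eq_Rintegral => o _.
rewrite (bigD1 o.1.1)//= big1 ?addr0; last first.
  by move=> x xo; rewrite indicE memNset ?mul0r ?mulr0// => /= e; rewrite e eqxx in xo.
by rewrite indicE mem_set// mul1r.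
Qed.

End centred_cells.

(** * The directional derivative and its linearity subspaces *)

Section directional_derivative.
Context (R : realType) (J K : nat) (B0 eps : R).
Notation O := ('I_J.+1 * 'I_K.+1 * R)%type.
Variable P : probability O R.
Hypotheses (P_bounded : P (@bounded_outcome R J K B0) = 1%E)
  (P_cell : forall x a, 0 < fine (P (cell x a)))
  (P_strata : forall x, 0 < pX P x).

Lemma directional_derivativeP : directional_derivative B0 eps P (gamma P).
Proof.
move=> h Pt th hPt; have /tangentP[h2 h0] := th.
have ih := L2_integrable h2.
have lin phi : bounded_measurable phi ->
    right_diff (fun t => \int[Pt t]_o phi o) (\int[P]_o phi o) (\int[P]_o (phi o * h o)).
  exact: (dqm_linear h2 hPt).
have Pt_bounded : \forall t \near 0^'+, Pt t (@bounded_outcome R J K B0) = 1%E.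
  have [e [nu [f [g [e0 He _ _]]]]] := hPt.
  near=> t; have t0 : 0 < t by near: t; exact: nbhs_right_gt.
  have te : t < e by near: t; exact: nbhs_right_lt.
  by have [[] ] := He t (introT andP (conj (ltW t0) te)).
pose c x a t := fine (Pt t (cell x a)).
pose m x a t := \int[Pt t]_o (trunc_outcome B0 o * \1_(cell x a) o).
have bz x a : bounded_measurable (fun o : O => trunc_outcome B0 o * \1_(cell x a) o).
  by apply: bmM; [exact: bm_trunc_outcome|exact: bm_cell].
have dc x a : right_diff (c x a) (fine (P (cell x a))) (\int[P]_o (\1_(cell x a) o * h o)).
  have := lin _ (@bm_cell R J K x a); rewrite (Rint_indic _ (@measurable_cell R J K x a)).
  by under eq_fun do rewrite (Rint_indic _ (@measurable_cell R J K x a)).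
(* The quotient rule gives $\{\int y1_{xa}h-\mu_a(x)\int1_{xa}h\}/P(\mathrm{cell})$, with $y$ the
   truncated outcome and $1_{xa}$ the indicator of the cell. This is [mudot], because [cell_resid]
   is centred at $\mu_a(x)$. *)
have dmu x a : right_diff (fun t => m x a t / c x a t) (mu P a x) (mudot P a h x).
  have c0 : fine (P (cell x a)) != 0 by rewrite gt_eqF.
  have := right_diff_div c0 (lin _ (bz x a)) (dc x a).
  rewrite -(muE _ _ P_bounded) (mudotE P_bounded P_cell P_strata)//.
  set D1 := (_ - _) / _; set D2 := _ / _; suff -> : D1 = D2 by [].
  rewrite /D1 /D2; congr (_ / _).
  have i1 := bmM_integrable (bz x a) ih.
  have i2 := bmM_integrable (@bm_cell R J K x a) ih.
  transitivity (\int[P]_o (- mu P a x * (\1_(cell x a) o * h o) +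
      trunc_outcome B0 o * \1_(cell x a) o * h o)).
    by rewrite (Rint_lin _ i2 i1); ring.
  by apply: eq_Rintegral => o _; rewrite /cell_resid; ring.
pose Dq x := sup [set mudot P a h x | a in [set` best P x]].
have dq x : right_diff (fun t => sup (range (fun a => m x a t / c x a t))) (qmax P x) (Dq x).
  rewrite /Dq best_range; exact: (right_diff_sup ord0 (dmu x)).
have dp x : right_diff (fun t => pX (Pt t) x) (pX P x) (\int[P]_o (\1_(stratum x) o * h o)).
  have bs : bounded_measurable (\1_(@stratum R J K x) : O -> R).
    by apply: bm_indic; exact: measurable_stratum.
  have := lin _ bs; rewrite (Rint_indic _ (@measurable_stratum R J K x)).
  by under eq_fun do rewrite (Rint_indic _ (@measurable_stratum R J K x)).
have := right_diff_sum (fun x => right_diffM (dp x) (dq x)).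
rewrite -Psi_sum gammaE// big_split/=.
have -> : \int[P]_o (qmax P o.1.1 * h o) =
    \sum_x (\int[P]_o (\1_(stratum x) o * h o)) * qmax P x.
  exact: Rint_strata.
move=> H; apply: cvg_trans H; apply: near_eq_cvg; near=> t.
have tb : Pt t (@bounded_outcome R J K B0) = 1%E by near: t.
congr (_ * (_ - _)); rewrite Psi_sum; apply: eq_bigr => x _; congr (_ * sup _).
by apply/seteqP; split=> _ [a _ <-]; exists a => //; rewrite (muE _ _ tb).
Unshelve. all: by end_near. Qed.

End directional_derivative.

Section linearity.
Context (R : realType) (J K : nat) (B0 : R).
Notation O := ('I_J.+1 * 'I_K.+1 * R)%type.
Variable P : probability O R.
Hypotheses (P_bounded : P (@bounded_outcome R J K B0) = 1%E)
  (P_cell : forall x a, 0 < fine (P (cell x a)))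
  (P_strata : forall x, 0 < pX P x).

Local Notation pc x a := (fine (P (cell x a))).
Let mudot_lin := mudot_lin P_bounded P_cell P_strata.

Lemma exists_optimal_rule : exists d : 'I_J.+1 -> 'I_K.+1, optimal_rule P d.
Proof.
have /choice[d dP] : forall x, exists a, a \in best P x.
  move=> x; have [_ [a _ ha]] := @sup_fin R 'I_K.+1 setT (mu P ^~ x) (ex_intro _ ord0 Logic.I).
  exists a; rewrite inE; apply/forallP => b; rewrite -ha.
  have [h _] := @sup_fin R 'I_K.+1 setT (mu P ^~ x) (ex_intro _ ord0 Logic.I).
  exact: h.
by exists d.
Qed.

Lemma mudot0 a x : mudot P a 0 x = 0.
Proof.
have z2 : (0 : O -> R) \in Lfun P 2%:E by apply: L2_bm; exact: bm_cst.
by have := mudot_lin 1 a x z2 z2; rewrite scale1r addr0; lra.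
Qed.

Lemma mudot_scale (c : R) h a x : h \in Lfun P 2%:E ->
  mudot P a (c *: h) x = c * mudot P a h x.
Proof.
have z2 : (0 : O -> R) \in Lfun P 2%:E by apply: L2_bm; exact: bm_cst.
by move=> h2; have := mudot_lin c a x h2 z2; rewrite addr0 mudot0 addr0.
Qed.

Lemma mudotD f h a x : f \in Lfun P 2%:E -> h \in Lfun P 2%:E ->
  mudot P a (f + h) x = mudot P a f x + mudot P a h x.
Proof. by move=> f2 h2; have := mudot_lin 1 a x f2 h2; rewrite scale1r mul1r. Qed.

Lemma tangent_L2 h : tangent P h -> h \in Lfun P 2%:E.
Proof. by case/tangentP. Qed.

Lemma sup_mudot_rule d h x : optimal_rule P d -> Ccone P d h ->
  sup [set mudot P a h x | a in [set` best P x]] = mudot P (d x) h x.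
Proof.
move=> dP [th hd].
have [h1 [a /= ha e]] := @sup_fin R 'I_K.+1 [set` best P x]
  (fun a => mudot P a h x) (ex_intro _ (d x) (dP x)).
by apply/eqP; rewrite eq_le h1 ?andbT ?e ?hd//; exact: dP.
Qed.

(** On the cone the maximum over the best treatments is attained at [d x], so [gamma] coincides
    there with a linear functional. *)
Lemma gamma_rule d h : optimal_rule P d -> Ccone P d h -> gamma P h =
  \int[P]_o (qmax P o.1.1 * h o) + \sum_x pX P x * mudot P (d x) h x.
Proof.
move=> dP hC; rewrite gammaE; last by case: hC.
by congr (_ + _); apply: eq_bigr => x _; rewrite (sup_mudot_rule x dP hC).
Qed.

Lemma Hkappa_Ccone d : optimal_rule P d -> Hkappa P `<=` Ccone P d.
Proof.
by move=> dP h [th hh]; split=> // x a ha; rewrite (hh x a (d x))//; exact: dP.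
Qed.

Lemma tangentZ (c : R) h : tangent P h -> tangent P (c *: h).
Proof.
by move=> th; have := (tangent_subspace P).2 c h 0 th (tangent_subspace P).1; rewrite addr0.
Qed.

Lemma tangentD f h : tangent P f -> tangent P h -> tangent P (f + h).
Proof.
by move=> tf th; have := (tangent_subspace P).2 1 f h tf th; rewrite scale1r.
Qed.

Lemma Hkappa_subspace : linear_subspace (Hkappa P).
Proof.
split; first by split=> [|x a b _ _]; [exact: (tangent_subspace P).1|rewrite !mudot0].
move=> c f h [tf hf] [th hh]; split; first exact: (tangent_subspace P).2.
move=> x a b ha hb; rewrite !mudot_lin ?tangent_L2//.
by rewrite (hf x a b)// (hh x a b).
Qed.

Lemma Ccone_convex_cone d : convex_cone (Ccone P d).
Proof.
split.
- exists 0; split=> [|x a _]; first exact: (tangent_subspace P).1.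
  by rewrite !mudot0.
- move=> c h c0 [th hh]; split=> [|x a ha]; first exact: tangentZ.
  by rewrite !mudot_scale ?tangent_L2// ler_pM2l// hh.
- move=> f h [tf hf] [th hh]; split=> [|x a ha]; first exact: tangentD.
  by rewrite !mudotD ?tangent_L2// lerD ?hf ?hh.
Qed.

Lemma Rint_q_lin (c : R) f h : tangent P f -> tangent P h ->
  \int[P]_o (qmax P o.1.1 * (c *: f + h) o) =
  c * \int[P]_o (qmax P o.1.1 * f o) + \int[P]_o (qmax P o.1.1 * h o).
Proof.
move=> /tangent_L2/L2_integrable fi /tangent_L2/L2_integrable hi.
have i1 := bmM_integrable (@bm_stratum_fun R J K (qmax P)) fi.
have i2 := bmM_integrable (@bm_stratum_fun R J K (qmax P)) hi.
rewrite -(Rint_lin c i1 i2); apply: eq_Rintegral => o _.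
by rewrite (_ : (c *: f + h) o = c * f o + h o)//; ring.
Qed.

(** [Hkappa P] lies in the cone of any optimal rule, where [gamma] is given by a linear formula. *)
Lemma gamma_linear_Hkappa : linear_on (Hkappa P) (gamma P).
Proof.
have [d dP] := exists_optimal_rule.
move=> c f h hf hh; have HC := Hkappa_Ccone dP.
have hfh := Hkappa_subspace.2 c f h hf hh.
rewrite !(gamma_rule dP); [|exact: HC..].
have [tf _] := hf; have [th _] := hh.
rewrite Rint_q_lin// mulrDr mulr_sumr addrACA -big_split/=; congr (_ + _).
apply: eq_bigr => x _; rewrite mudot_lin ?tangent_L2//; ring.
Qed.

(** Linearity forces $\gamma(h)+\gamma(-h)=0$. This sum is $\sum_xp_x$ times the spread, maximum
    minus minimum, of [mudot] over the best treatments; as the terms are nonnegative and $p_x>0$,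
    every spread is zero. *)
Lemma linearity_sub_Hkappa (S : set (O -> R)) :
  linearity_subspace P (gamma P) S -> S `<=` Hkappa P.
Proof.
move=> [St [S0 Slin] Sg] h Sh; have th := St h Sh.
split=> // x a b ha hb.
have g0 : gamma P 0 = 0.
  by have := Sg 1 0 0 S0 S0; rewrite scaler0 addr0; lra.
have := Sg (-1) h 0 Sh S0; rewrite g0 !addr0.
rewrite !gammaE//; last exact: tangentZ.
have -> : \int[P]_o (qmax P o.1.1 * (-1 *: h) o) = - \int[P]_o (qmax P o.1.1 * h o).
  have := Rint_q_lin (-1) th (tangent_subspace P).1; rewrite addr0 => ->.
  rewrite (_ : (fun o => qmax P o.1.1 * 0 o) = fun=> 0); last first.
    by apply/funext => o; rewrite (_ : (0 : O -> R) o = 0)// mulr0.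
  by rewrite Rint_cst; ring.
set up := fun y => sup [set mudot P c h y | c in [set` best P y]].
set dn := fun y => sup [set mudot P c (-1 *: h) y | c in [set` best P y]].
move=> e.
have e0 : \sum_y pX P y * (up y + dn y) = 0.
  by under eq_bigr do rewrite mulrDr; rewrite big_split/=; move: e; rewrite /up /dn; lra.
have sup_ge (f : O -> R) y c : c \in best P y ->
    mudot P c f y <= sup [set mudot P c f y | c in [set` best P y]].
  move=> hc; have [h1 _] := @sup_fin R 'I_K.+1 [set` best P y]
    (fun a => mudot P a f y) (ex_intro _ c hc).
  exact: h1.
have pair y c1 c2 : c1 \in best P y -> c2 \in best P y ->
    mudot P c1 h y - mudot P c2 h y <= up y + dn y.
  move=> h1 h2; apply: lerD; first exact: sup_ge.
  by have := sup_ge (-1 *: h) _ _ h2; rewrite mudot_scale ?tangent_L2// mulN1r.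
have nn y : 0 <= up y + dn y.
  have [d dP] := exists_optimal_rule.
  by have := pair y (d y) (d y) (dP y) (dP y); rewrite subrr.
have ud0 : up x + dn x = 0.
  have := psumr_eq0P (fun y _ => mulr_ge0 (ltW (P_strata y)) (nn y)) e0 => /(_ x isT).
  by move/eqP; rewrite mulf_eq0 gt_eqF//= => /eqP.
by apply/eqP; rewrite eq_le -subr_le0 -ud0 pair//= -subr_le0 -ud0 pair.
Qed.

(** [Hkappa P] contains every linearity subspace, so it is the largest one; maximality and
    uniqueness both follow. *)
Lemma Hkappa_unique_maximal :
  unique_maximal_linearity_subspace P (gamma P) (Hkappa P).
Proof.
have HL : linearity_subspace P (gamma P) (Hkappa P).
  split; [by move=> h []|exact: Hkappa_subspace|exact: gamma_linear_Hkappa].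
split; first split=> //.
  by move=> S' /linearity_sub_Hkappa S'H HS'; apply/seteqP.
by move=> S' [S'L S'max]; rewrite (S'max _ HL (linearity_sub_Hkappa S'L)).
Qed.

End linearity.

(** * Efficient scores and variance bounds *)

Section scores.
Context (R : realType) (J K : nat) (B0 : R).
Notation O := ('I_J.+1 * 'I_K.+1 * R)%type.
Variable P : probability O R.
Hypotheses (P_bounded : P (@bounded_outcome R J K B0) = 1%E)
  (P_cell : forall x a, 0 < fine (P (cell x a)))
  (P_strata : forall x, 0 < pX P x).

Local Notation pc x a := (fine (P (cell x a))).
Local Notation cr := (cell_resid B0 P).
Let bcr x a : bounded_measurable (cr x a) := bm_cell_resid B0 P x a.
Let mudotE := mudotE P_bounded P_cell P_strata.

(** The common form of both efficient scores, built on truncated residuals so that it is bounded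
    everywhere. *)
Definition cell_score (W : 'I_J.+1 -> 'I_K.+1 -> R) (o : O) : R :=
  qmax P o.1.1 - Psi P + \sum_x \sum_a W x a * cr x a o.

Let bWcr (W : 'I_J.+1 -> 'I_K.+1 -> R) x :
  bounded_measurable (fun o => \sum_a W x a * cr x a o).
Proof. by apply: bm_sum => a _; apply: bmM => //; exact: bm_cst. Qed.

Lemma bm_cell_score W : bounded_measurable (cell_score W).
Proof.
apply: bmD; last by apply: bm_sum => x _; exact: bWcr.
by apply: bmB; [exact: bm_stratum_fun|exact: bm_cst].
Qed.

Let bsum W : bounded_measurable (fun o => \sum_x \sum_a W x a * cr x a o).
Proof. by apply: bm_sum => x _; exact: bWcr. Qed.

Let bq : bounded_measurable (fun o : O => qmax P o.1.1 - Psi P).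
Proof. by apply: bmB; [exact: bm_stratum_fun|exact: bm_cst]. Qed.

Lemma Rint_q : \int[P]_o (qmax P o.1.1 - Psi P) = 0.
Proof.
rewrite RintB; [|exact: bm_stratum_fun|exact: bm_cst].
rewrite Rint_cst /Psi (bm_expectation _ (@bm_stratum_fun R J K (qmax P))) subrr//.
Qed.

Lemma Rint_cell_score_mul W (h : O -> R) : P.-integrable setT (EFin \o h) ->
  \int[P]_o (cell_score W o * h o) = \int[P]_o ((qmax P o.1.1 - Psi P) * h o) +
  \sum_x \sum_a W x a * \int[P]_o (cr x a o * h o).
Proof.
move=> ih.
have i0 := bmM_integrable bq ih.
have ia x a : P.-integrable setT (EFin \o (fun o => W x a * (cr x a o * h o))).
  by apply: integrable_scale; exact: bmM_integrable (bcr x a) ih.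
have [_ e2] := integrable_bigsum (index_enum _)
  (fun x => (integrable_bigsum (index_enum _) (ia x)).1).
have [i2 _] := integrable_bigsum (index_enum _)
  (fun x => (integrable_bigsum (index_enum _) (ia x)).1).
transitivity (\int[P]_o (1 * ((qmax P o.1.1 - Psi P) * h o) +
    \sum_x \sum_a W x a * (cr x a o * h o))).
  apply: eq_Rintegral => o _; rewrite /cell_score mulrDl mul1r; congr (_ + _).
  rewrite mulr_suml; apply: eq_bigr => x _; rewrite mulr_suml.
  by apply: eq_bigr => a _; rewrite mulrA.
rewrite (Rint_lin _ i0 i2) mul1r e2; congr (_ + _); apply: eq_bigr => x _.
rewrite (integrable_bigsum (index_enum _) (ia x)).2; apply: eq_bigr => a _.
by rewrite RintegralZl//; exact: bmM_integrable (bcr x a) ih.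
Qed.

(** Residuals of distinct cells have disjoint supports, and the term in [qmax] is constant on the
    cell, where the residual is centred; only the weight [W x a] survives. *)
Lemma Rint_cell_resid_score W x a :
  \int[P]_o (cr x a o * cell_score W o) = W x a * (sigma2 P a x * pc x a).
Proof.
under eq_Rintegral do rewrite mulrC.
rewrite Rint_cell_score_mul; last exact: bm_integrable.
have -> : \int[P]_o ((qmax P o.1.1 - Psi P) * cr x a o) = 0.
  transitivity (\int[P]_o ((qmax P x - Psi P) * cr x a o)).
    apply: eq_Rintegral => o _; rewrite /cell_resid indicE.
    case: (boolP (o \in cell x a)) => [|_]; last by rewrite !mulr0.
    by rewrite inE => -[-> _].
  by rewrite RintZl// (Rint_cell_resid P_bounded P_cell) mulr0.
rewrite add0r (bigD1 x)//= (bigD1 a)//= big1 => [|b ba]; last first.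
  rewrite (_ : (fun o => _) = fun=> 0) ?Rint_cst ?mulr0//.
  by apply/funext => o; apply: cell_resid_disjoint; rewrite xpair_eqE (negbTE ba) andbF.
rewrite big1 => [|y yx]; last first.
  apply: big1 => b _; rewrite (_ : (fun o => _) = fun=> 0) ?Rint_cst ?mulr0//.
  by apply/funext => o; apply: cell_resid_disjoint; rewrite xpair_eqE (negbTE yx).
by rewrite !addr0 (Rint_cell_resid_sqr P_bounded P_cell).
Qed.

Lemma tangent_cell_score W : tangent P (cell_score W).
Proof.
apply/tangentP; split; first by apply: L2_bm; exact: bm_cell_score.
rewrite /cell_score RintD// Rint_q add0r Rint_sum//.
apply: big1 => x _; rewrite Rint_sum; last by move=> a _; apply: bmM => //; exact: bm_cst.
apply: big1 => a _; rewrite RintZl//.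
by rewrite (Rint_cell_resid P_bounded P_cell) mulr0.
Qed.

Lemma mudot_cell_score W a x : mudot P a (cell_score W) x = W x a * sigma2 P a x.
Proof.
rewrite mudotE; last by apply: L2_bm; exact: bm_cell_score.
by rewrite Rint_cell_resid_score mulrA mulfK// gt_eqF.
Qed.

Lemma Rint_cell_score_tangent W h : tangent P h ->
  \int[P]_o (cell_score W o * h o) = \int[P]_o (qmax P o.1.1 * h o) +
  \sum_x pX P x * \sum_a W x a * propensity P a x * mudot P a h x.
Proof.
move=> th; have /tangentP[h2 h0] := th; have ih := L2_integrable h2.
rewrite Rint_cell_score_mul//; congr (_ + _).
  have i1 := bmM_integrable (@bm_stratum_fun R J K (qmax P)) ih.
  transitivity (\int[P]_o (- Psi P * h o + qmax P o.1.1 * h o)).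
    by apply: eq_Rintegral => o _; ring.
  by rewrite Rint_lin// h0 mulr0 add0r.
apply: eq_bigr => x _; rewrite mulr_sumr; apply: eq_bigr => a _.
rewrite mudotE// -(pXpropensity P_strata).
have p0 := propensity_gt0 P_cell P_strata x a.
by field; rewrite !gt_eqF.
Qed.

Lemma var_qE : var_q P = \int[P]_o ((qmax P o.1.1 - Psi P) ^+ 2).
Proof.
rewrite /var_q /variance unlock /=.
have bs : bounded_measurable (fun o : O => (qmax P o.1.1 - Psi P) ^+ 2).
  rewrite (_ : (fun _ => _) = fun o : O => (qmax P o.1.1 - Psi P) * (qmax P o.1.1 - Psi P)).
    exact: bmM.
  by apply/funext => o; rewrite expr2.
transitivity (fine ('E_P[fun o : O => ((qmax P o.1.1 - Psi P) ^+ 2)%R])%E).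
  by congr (fine ('E_P[_])%E); apply/funext => o; rewrite expr2.
by rewrite (bm_expectation _ bs).
Qed.

Lemma Rint_cell_score_sqr W : \int[P]_o (cell_score W o * cell_score W o) =
  var_q P + \sum_x pX P x * \sum_a W x a ^+ 2 * propensity P a x * sigma2 P a x.
Proof.
rewrite Rint_cell_score_mul; last by apply: bm_integrable; exact: bm_cell_score.
congr (_ + _).
  under eq_Rintegral do rewrite mulrC.
  rewrite Rint_cell_score_mul; last exact: bm_integrable.
  rewrite var_qE big1 ?addr0; last first.
    move=> x _; apply: big1 => a _.
    transitivity (W x a * ((qmax P x - Psi P) * \int[P]_o cr x a o)).
      congr (_ * _); rewrite -RintZl//; apply: eq_Rintegral => o _.
      rewrite /cell_resid indicE; case: (boolP (o \in cell x a)) => [|_].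
        by rewrite inE => -[-> _]; ring.
      by rewrite !mulr0 mul0r.
    by rewrite (Rint_cell_resid P_bounded P_cell) !mulr0.
  by apply: eq_Rintegral => o _; rewrite expr2.
apply: eq_bigr => x _; rewrite mulr_sumr; apply: eq_bigr => a _.
by rewrite Rint_cell_resid_score -(pXpropensity P_strata); ring.
Qed.

End scores.

Section almost_everywhere.
Context d (T : measurableType d) (R : realType) (P : probability T R).
Implicit Types f g : T -> R.

Lemma L2_ae f g : measurable_fun setT f -> {ae P, forall x, f x = g x} ->
  g \in Lfun P 2%:E -> f \in Lfun P 2%:E.
Proof.
move=> mf fg /L2P[mg /integrableP[mg2 ig2]]; apply/L2P; split=> //.
have mf2 : measurable_fun setT (EFin \o (fun x => f x ^+ 2)).
  by apply/measurable_EFinP; exact: measurable_funX.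
apply/integrableP; split=> //; apply: le_lt_trans ig2.
rewrite le_eqVlt; apply/orP; left; apply/eqP; apply: ae_eq_integral => //.
- exact: measurableT_comp.
- exact: measurableT_comp.
- by apply: filterS fg => x fgx _; rewrite /= fgx.
Qed.

Lemma tangent_ae f g : measurable_fun setT f -> {ae P, forall x, f x = g x} ->
  tangent P g -> tangent P f.
Proof.
move=> mf fg /tangentP[g2 g0]; apply/tangentP; split; first exact: L2_ae fg g2.
by rewrite -g0; apply: Rint_ae => //; exact: (L2_measurable g2).
Qed.

End almost_everywhere.

Section efficient_scores.
Context (R : realType) (J K : nat) (B0 : R).
Notation O := ('I_J.+1 * 'I_K.+1 * R)%type.
Variable P : probability O R.
Hypotheses (P_bounded : P (@bounded_outcome R J K B0) = 1%E)
  (P_cell : forall x a, 0 < fine (P (cell x a)))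
  (P_strata : forall x, 0 < pX P x)
  (P_var : forall x a, 0 < sigma2 P a x).

Local Notation pc x a := (fine (P (cell x a))).
Local Notation cr := (cell_resid B0 P).

Lemma propensity_neq0 x a : propensity P a x != 0.
Proof. by rewrite gt_eqF// (propensity_gt0 P_cell P_strata). Qed.

Lemma cvar_gt0 x a : 0 < cvar P a x.
Proof. by rewrite divr_gt0// (propensity_gt0 P_cell P_strata). Qed.

Lemma sum_inv_cvar_gt0 x : 0 < \sum_(a in best P x) (cvar P a x)^-1.
Proof.
have [d dP] := exists_optimal_rule P.
rewrite (bigD1 (d x)) ?dP//= ltr_wpDr ?invr_gt0 ?cvar_gt0// sumr_ge0// => a _.
by rewrite invr_ge0 ltW// cvar_gt0.
Qed.

Lemma sum_weight x : \sum_a weight P a x = 1.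
Proof.
rewrite (bigID (mem (best P x)))/= addrC big1 ?add0r; last first.
  by move=> a; rewrite /weight => /negbTE ->.
rewrite (eq_bigr (fun a => (cvar P a x)^-1 / \sum_(b in best P x) (cvar P b x)^-1)).
  by rewrite -mulr_suml divff// gt_eqF// sum_inv_cvar_gt0.
by move=> a; rewrite /weight => ->.
Qed.

(** Inverse-variance weights make this product the same for all best treatments. As the product is
    the [mudot] of [kappa_score], this is what puts that score in [Hkappa P]. *)
Lemma weight_cvar x a : a \in best P x ->
  weight P a x * cvar P a x = (\sum_(b in best P x) (cvar P b x)^-1)^-1.
Proof.
move=> ha; rewrite /weight ha mulrAC mulVf ?mul1r//.
by rewrite gt_eqF// cvar_gt0.
Qed.

Definition kappa_score : O -> R :=
  cell_score B0 P (fun x a => weight P a x / propensity P a x).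

(** The influence function of the mean outcome under the fixed rule [d], with truncated
    residuals. *)
Definition rule_score (d : 'I_J.+1 -> 'I_K.+1) : O -> R :=
  cell_score B0 P (fun x a => (a == d x)%:R / propensity P a x).

Lemma mudot_kappa_score x a : a \in best P x ->
  mudot P a kappa_score x = (\sum_(b in best P x) (cvar P b x)^-1)^-1.
Proof.
move=> ha; rewrite (mudot_cell_score P_bounded P_cell P_strata) -(weight_cvar ha) /cvar.
by rewrite mulrAC mulrA.
Qed.

Lemma mudot_rule_score d x a :
  mudot P a (rule_score d) x = (a == d x)%:R * cvar P a x.
Proof.
by rewrite (mudot_cell_score P_bounded P_cell P_strata) /cvar mulrAC mulrA.
Qed.

Lemma tangent_kappa_score : tangent P kappa_score.
Proof. exact: (tangent_cell_score P_bounded P_cell). Qed.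

Lemma Hkappa_kappa_score : Hkappa P kappa_score.
Proof.
by split=> [|x a b ha hb]; [exact: tangent_kappa_score|rewrite !mudot_kappa_score].
Qed.

(** [mudot] of this score is positive at [d x] and 0 at all other treatments. Its negative therefore
    leaves the cone as soon as some [d x] is tied. *)
Lemma Ccone_rule_score d : Ccone P d (rule_score d).
Proof.
split=> [|x a ha]; first exact: (tangent_cell_score P_bounded P_cell).
rewrite !mudot_rule_score eqxx mul1r; case: eqP => [->|_]; first by rewrite mul1r.
by rewrite mul0r ltW// cvar_gt0.
Qed.

(** All best treatments have the same [mudot] for [h], which can thus be replaced by its weighted
    mean, the weights summing to 1. *)
Lemma gamma_kappa_score h : Hkappa P h ->
  gamma P h = \int[P]_o (kappa_score o * h o).
Proof.
move=> hh; have [d dP] := exists_optimal_rule P.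
rewrite (gamma_rule dP (Hkappa_Ccone dP hh)); have [th hE] := hh.
rewrite (Rint_cell_score_tangent P_bounded P_cell P_strata)//.
congr (_ + _); apply: eq_bigr => x _; congr (_ * _).
under eq_bigr => a _ do rewrite divfK ?propensity_neq0//.
rewrite -[LHS]mul1r -(sum_weight x) mulr_suml; apply: eq_bigr => a _.
have [ha|/negbTE na] := boolP (a \in best P x); first by rewrite (hE x a (d x)).
by rewrite /weight na !mul0r.
Qed.

Lemma gamma_rule_score d h : optimal_rule P d -> Ccone P d h ->
  gamma P h = \int[P]_o (rule_score d o * h o).
Proof.
move=> dP hh; rewrite (gamma_rule dP hh); have [th _] := hh.
rewrite (Rint_cell_score_tangent P_bounded P_cell P_strata)//.
congr (_ + _); apply: eq_bigr => x _; congr (_ * _).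
rewrite (bigD1 (d x))//= eqxx divfK ?propensity_neq0// mul1r big1 ?addr0// => a.
by move=> /negbTE ->; rewrite !mul0r.
Qed.

(** In the squared weight times [cvar], one weight is absorbed by [weight_cvar] and the other sums
    to 1. *)
Lemma Rint_kappa_score_sqr : \int[P]_o (kappa_score o ^+ 2) = Vkappa P.
Proof.
under eq_Rintegral do rewrite expr2.
rewrite (Rint_cell_score_sqr P_bounded P_cell P_strata); congr (_ + _).
apply: eq_bigr => x _; congr (_ * _).
under [in RHS]eq_bigr => a _ do rewrite -invf_div -/(cvar P a x).
rewrite -[RHS]mul1r -(sum_weight x) mulr_suml; apply: eq_bigr => a _.
have [ha|/negbTE na] := boolP (a \in best P x); last first.
  by rewrite /weight na !mul0r expr0n/= !mul0r.
by rewrite -(weight_cvar ha) /cvar; field; exact: propensity_neq0.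
Qed.

Lemma Rint_rule_score_sqr d : \int[P]_o (rule_score d o ^+ 2) = Vrule P d.
Proof.
under eq_Rintegral do rewrite expr2.
rewrite (Rint_cell_score_sqr P_bounded P_cell P_strata); congr (_ + _).
apply: eq_bigr => x _; congr (_ * _).
rewrite (bigD1 (d x))//= eqxx big1 ?addr0; last first.
  by move=> a /negbTE ->; rewrite mul0r expr0n/= !mul0r.
by rewrite /cvar; rewrite mulr1n; field; exact: propensity_neq0.
Qed.

Lemma var_q_ge0 : 0 <= var_q P.
Proof. by rewrite var_qE Rintegral_ge0// => o _; exact: sqr_ge0. Qed.

Lemma Vkappa_gt0 : 0 < Vkappa P.
Proof.
apply: ltr_wpDl; first exact: var_q_ge0.
rewrite (bigD1 ord0)//= ltr_wpDr//.
  apply: sumr_ge0 => x _; apply: mulr_ge0; first exact: ltW.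
  rewrite invr_ge0; apply: sumr_ge0 => a _.
  by rewrite divr_ge0// ltW// (propensity_gt0 P_cell P_strata).
rewrite mulr_gt0// invr_gt0.
under eq_bigr => a _ do rewrite -invf_div -/(cvar P a _).
exact: sum_inv_cvar_gt0.
Qed.

Lemma Vrule_gt0 d : 0 < Vrule P d.
Proof.
apply: ltr_wpDl; first exact: var_q_ge0.
rewrite (bigD1 ord0)//= ltr_wpDr//; last by rewrite mulr_gt0// cvar_gt0.
by apply: sumr_ge0 => x _; rewrite mulr_ge0 ?ltW// cvar_gt0.
Qed.

Lemma psi_kappa_ae : {ae P, forall o, psi_kappa P o = kappa_score o}.
Proof.
have : {ae P, forall o a, resid P a o = trunc_resid B0 P a o}.
  by apply: filter_forall => a; exact: resid_ae.
apply: filterS => o ho; rewrite /psi_kappa /kappa_score /cell_score; congr (_ + _).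
rewrite exchange_big/=; apply: eq_bigr => a _; rewrite ho trunc_resid_sum mulr_sumr.
apply: eq_bigr => x _; rewrite /cell_resid indicE.
case: (boolP (o \in cell x a)) => [|_]; last by rewrite !mulr0.
by rewrite inE => -[-> _]; rewrite [LHS]mulrA.
Qed.

Lemma measurable_psi_kappa : measurable_fun setT (psi_kappa P).
Proof.
apply: measurable_funD.
  by apply: measurable_funB => //; case: (@bm_stratum_fun R J K (qmax P)).
apply: measurable_sum => a; apply: measurable_funM; last exact: measurable_resid.
by case: (@bm_stratum_fun R J K (weight P a)).
Qed.

(** [psi_kappa] involves the untruncated outcome; membership and pairings are transferred from
    [kappa_score], with which it agrees almost surely. *)
Lemma psi_kappa_riesz : riesz_representer P (gamma P) (Hkappa P) (psi_kappa P).
Proof.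
have mk := (bm_cell_score B0 P (fun x a => weight P a x / propensity P a x)).1.
have tp : tangent P (psi_kappa P).
  exact: tangent_ae measurable_psi_kappa psi_kappa_ae tangent_kappa_score.
have mp a x : mudot P a (psi_kappa P) x = mudot P a kappa_score x.
  rewrite !(mudotE P_bounded P_cell P_strata)//;
    [|exact: tangent_L2 tangent_kappa_score|exact: tangent_L2 tp].
  congr (_ / _); have mc := (bm_cell_resid B0 P x a).1.
  apply: Rint_ae; [apply: measurable_funM => //; exact: measurable_psi_kappa|exact: measurable_funM|].
  by apply: filterS psi_kappa_ae => o ->.
split=> [|h hh].
  by split=> // x a b ha hb; rewrite !mp (Hkappa_kappa_score.2 x a b).
have mh := L2_measurable (tangent_L2 hh.1).
have ii : P.-integrable setT (EFin \o (fun o => kappa_score o * h o)).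
  by apply: L2_mul_integrable; [exact: tangent_L2 tangent_kappa_score|exact: tangent_L2 hh.1].
rewrite gamma_kappa_score// /Rintegral fineK; last exact: integrable_fin_num.
rewrite unlock; apply: ae_eq_integral => //.
- apply/measurable_EFinP; apply: measurable_funM => //; exact: measurable_psi_kappa.
- by apply/measurable_EFinP; exact: measurable_funM.
- by apply: filterS psi_kappa_ae => o /= ->.
Qed.

Lemma psi_kappa_norm :
  ('E_P[fun o => (psi_kappa P o ^+ 2)%R] = (Vkappa P)%:E)%E.
Proof.
have bk := bm_cell_score B0 P (fun x a => weight P a x / propensity P a x).
have b2 : bounded_measurable (fun o => kappa_score o ^+ 2).
  by under eq_fun do rewrite expr2; exact: bmM.
rewrite -Rint_kappa_score_sqr -(bm_expectation P b2) unlock.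
apply: ae_eq_integral => //.
- by apply/measurable_EFinP; apply: measurable_funX; exact: measurable_psi_kappa.
- by apply/measurable_EFinP; case: b2.
- by apply: filterS psi_kappa_ae => o /= ->.
Qed.

Lemma Ccone_span d : optimal_rule P d -> linear_span (Ccone P d) = tangent P.
Proof.
move=> dP; apply/seteqP; split=> h.
  move=> [n [c [f [fC ->]]]]; elim/big_rec : _ => [|i g _ tg].
    exact: (tangent_subspace P).1.
  exact: (tangent_subspace P).2 (fC i).1 tg.
move=> th; pose r := rule_score d; have rC : Ccone P d r := Ccone_rule_score d.
(* Adding a large multiple of [r] to h brings it into the cone. *)
pose M := \sum_x \sum_a `|mudot P a h x - mudot P (d x) h x| / cvar P (d x) x.
have M_ge x a : mudot P a h x - mudot P (d x) h x <= M * cvar P (d x) x.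
  rewrite -ler_pdivrMr ?cvar_gt0//.
  have t0 y b : 0 <= `|mudot P b h y - mudot P (d y) h y| / cvar P (d y) y.
    by rewrite divr_ge0// ltW// cvar_gt0.
  rewrite /M (bigD1 x)//= (bigD1 a)//= -addrA; apply: ler_wpDr.
    by apply: addr_ge0; apply: sumr_ge0 => // y _; exact: sumr_ge0.
  by rewrite ler_pM2r ?invr_gt0 ?cvar_gt0// ler_norm.
have r2 := tangent_L2 rC.1; have h2 := tangent_L2 th.
have hC : Ccone P d (M *: r + h).
  split=> [|x a ha]; first exact: (tangent_subspace P).2 rC.1 th.
  rewrite !(mudot_lin P_bounded P_cell P_strata)// !mudot_rule_score eqxx mul1r.
  case: (eqVneq a (d x)) => [->|_]; first by rewrite mul1r.
  by rewrite mul0r mulr0 add0r -lerBlDr.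
(* The decomposition is [h = (M *: r + h) - M *: r]. *)
exists 2%N, (fun i => if i == ord0 then 1 else - M),
  (fun i => if i == ord0 then M *: r + h else r); split; first by move=> i; case: ifP.
rewrite big_ord_recl big_ord1 /= scale1r scaleNr addrAC subrr add0r//.
Qed.

Lemma Vrule_sub_Vkappa d : Vrule P d - Vkappa P = \sum_x pX P x *
  (cvar P (d x) x - (\sum_(a in best P x) (cvar P a x)^-1)^-1).
Proof.
rewrite /Vrule /Vkappa opprD addrACA subrr add0r -sumrB; apply: eq_bigr => x _.
rewrite mulrBr; congr (_ - _ * _^-1); apply: eq_bigr => a _.
by rewrite /cvar [RHS]invf_div.
Qed.

(** The sum of inverses contains the term of [d x], and reduces to it exactly when [d x] is the only
    best treatment. The equality case is recorded because it decides between a strict increase and a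
    zero one. *)
Lemma inv_sum_inv_cvar_le d x : optimal_rule P d ->
  (\sum_(a in best P x) (cvar P a x)^-1)^-1 <= cvar P (d x) x ?= iff (#|best P x| <= 1)%N.
Proof.
move=> dP; have c0 := cvar_gt0 x; have s0 := sum_inv_cvar_gt0 x.
set S := \sum_(a in best P x) _ in s0 *.
have -> : (cvar P (d x) x) = ((cvar P (d x) x)^-1)^-1 by rewrite invrK.
have SE : S = (cvar P (d x) x)^-1 + \sum_(a in best P x | a != d x) (cvar P a x)^-1.
  by rewrite /S (bigD1 (d x)) ?dP.
have [b1|b1] := leqP #|best P x| 1.
  split; rewrite SE big1 ?addr0 ?eqxx// => a /andP[ha /eqP[]];
  exact: esym (card_le1_eqP b1 a (d x) ha (dP x)).
have [a /andP[ha ad]] : exists a, (a \in best P x) && (a != d x).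
  have := b1; rewrite (cardsD1 (d x)) dP add1n ltnS card_gt0 => /set0Pn[a].
  by rewrite !inE => /andP[h1 h2]; exists a; rewrite inE h2.
have lt : (cvar P (d x) x)^-1 < S.
  rewrite SE ltrDl (bigD1 a) ?ha//= ltr_wpDr ?invr_gt0//.
  by apply: sumr_ge0 => b _; rewrite invr_ge0 ltW.
split; first by rewrite lef_pV2 ?posrE ?invr_gt0// ltW.
by rewrite lt_eqF// ltf_pV2 ?posrE ?invr_gt0.
Qed.

Lemma Vkappa_lt_Vrule d : optimal_rule P d ->
  (exists x, (1 < #|best P x|)%N) -> 0 < Vrule P d - Vkappa P.
Proof.
move=> dP [x bx]; rewrite Vrule_sub_Vkappa (bigD1 x)//= ltr_wpDr//.
  apply: sumr_ge0 => y _; apply: mulr_ge0; first exact: ltW.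
  by rewrite subr_ge0; have [] := inv_sum_inv_cvar_le y dP.
rewrite mulr_gt0// subr_gt0 lt_neqAle; have [-> ->] := inv_sum_inv_cvar_le x dP.
by rewrite -ltnNge bx.
Qed.

Lemma Vkappa_eq_Vrule d : optimal_rule P d ->
  ~ (exists x, (1 < #|best P x|)%N) -> Vrule P d - Vkappa P = 0.
Proof.
move=> dP nb; rewrite Vrule_sub_Vkappa big1// => x _.
have [_] := inv_sum_inv_cvar_le x dP.
rewrite (_ : (_ <= 1)%N = true) => [/eqP ->|]; first by rewrite subrr mulr0.
by rewrite leqNgt; apply/negP => h; apply: nb; exists x.
Qed.

End efficient_scores.

(** * Exponential tilts as DQM paths in the model *)

Section tilt_bounds.
Context d (T : measurableType d) (R : realType) (P : probability T R).
Variables (psi : T -> R) (bpsi : bounded_measurable psi).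

Lemma tilt0 B : measurable B -> tilt P bpsi 0 B = P B.
Proof.
move=> mB; rewrite tiltE (eq_integral (cst 1%E)) ?integral_cst ?mul1e// => x _.
rewrite /tilt_density /mgf mul0r expR0; congr (_%:E).
under eq_Rintegral do rewrite mul0r expR0.
by rewrite Rint_cst divr1.
Qed.

Lemma fine_tilt t B : measurable B ->
  fine (tilt P bpsi t B) = (\int[P]_x (\1_B x * expR (t * psi x))) / mgf P psi t.
Proof. by move=> mB; rewrite -(Rint_indic _ mB) Rint_tilt//; exact: bm_indic. Qed.

Lemma tilt_full t B : measurable B -> P B = 1%E -> tilt P bpsi t B = 1%E.
Proof.
move=> mB PB; rewrite -[LHS]fineK ?fin_num_measure// fine_tilt//; congr (_%:E).
rewrite (_ : \int[P]_x _ = mgf P psi t) ?divff ?gt_eqF ?mgf_gt0//.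
have b1 := bm_exp_psi bpsi t.
have inB : {ae P, forall x, \1_B x * expR (t * psi x) = expR (t * psi x)}.
  exists (~` B); split; [exact: measurableC|by rewrite probability_setC// PB subee|].
  by move=> x /= nx Bx; apply: nx; rewrite indicE mem_set// mul1r.
by apply: Rint_ae inB; [case: (bmM (bm_indic _ mB) b1)|case: b1].
Qed.

Variables (M : R) (psiM : forall x, `|psi x| <= M).

Lemma exp_psi_bounds t x :
  expR (- (`|t| * M)) <= expR (t * psi x) <= expR (`|t| * M).
Proof.
rewrite !ler_expR -ler_norml normrM.
by rewrite ler_wpM2l.
Qed.

(** Kept multiplied by [mgf P psi t], which cancels in the ratio defining a propensity. *)
Lemma tilt_bounds t B : measurable B ->
  expR (- (`|t| * M)) * fine (P B) <= fine (tilt P bpsi t B) * mgf P psi t <=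
  expR (`|t| * M) * fine (P B).
Proof.
move=> mB; rewrite fine_tilt// divfK ?gt_eqF ?mgf_gt0//.
have bi : bounded_measurable (\1_B : T -> R) := bm_indic R mB; have be := bm_exp_psi bpsi t.
rewrite -(Rint_indic _ mB) -!RintZl//; apply/andP; split; apply: Rint_le => [||x].
- by apply: bmM => //; exact: bm_cst.
- exact: bmM.
- by rewrite mulrC ler_wpM2l//; case/andP: (exp_psi_bounds t x).
- exact: bmM.
- by apply: bmM => //; exact: bm_cst.
- by rewrite mulrC ler_wpM2r//; case/andP: (exp_psi_bounds t x).
Qed.

Hypothesis psi0 : \int[P]_x psi x = 0.

Lemma mgf_ge1 t : 1 <= mgf P psi t.
Proof.
have b1 : bounded_measurable (fun x => 1 + t * psi x).
  by apply: bmD; [exact: bm_cst|apply: bmM => //; exact: bm_cst].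
apply: (@le_trans _ _ (\int[P]_x (1 + t * psi x))).
  by rewrite RintD ?Rint_cst ?RintZl ?psi0 ?mulr0 ?addr0//; [exact: bm_cst|apply: bmM => //; exact: bm_cst].
by apply: Rint_le => //; [exact: bm_exp_psi|move=> x; exact: expR_ge1Dx].
Qed.

Lemma mgf_le t : `|t| * M <= 1 -> mgf P psi t <= 1 + t ^+ 2 * M ^+ 2 * expR 1.
Proof.
move=> tM; have bt : bounded_measurable (fun x => t * psi x).
  by apply: bmM => //; exact: bm_cst.
pose c := t ^+ 2 * M ^+ 2 * expR 1.
have b1 : bounded_measurable (fun x => 1 + c + t * psi x) by apply: bmD => //; exact: bm_cst.
apply: (@le_trans _ _ (\int[P]_x (1 + c + t * psi x))); last first.
  by rewrite RintD ?Rint_cst ?RintZl ?psi0 ?mulr0 ?addr0//; exact: bm_cst.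
apply: Rint_le => //; first exact: bm_exp_psi.
move=> x; have := expR_taylor1 (t * psi x); rewrite ler_norml => /andP[_].
have tp : `|t * psi x| <= `|t| * M by rewrite normrM ler_wpM2l.
have : `|t * psi x| ^+ 2 * expR `|t * psi x| <= c.
  have M0 : 0 <= M by apply: le_trans (psiM x).
  apply: ler_pM; rewrite ?exprn_ge0 ?expR_ge0//.
    rewrite -exprMn -[leRHS]ger0_norm ?sqr_ge0// normrX [in leRHS]normrM (ger0_norm M0).
    by rewrite lerXn2r ?nnegrE ?mulr_ge0.
  by rewrite ler_expR (le_trans tp).
lra.
Qed.

Lemma sqrt_tilt_density t x : Num.sqrt (tilt_density P psi t x) =
  expR (t / 2 * psi x) / Num.sqrt (mgf P psi t).
Proof.
rewrite /tilt_density sqrtrM ?expR_ge0// sqrtrV ?ltW ?mgf_gt0//; congr (_ / _).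
rewrite (_ : t * psi x = t / 2 * psi x + t / 2 * psi x); last by field.
by rewrite expRD -expr2 sqrtr_sqr ger0_norm ?expR_ge0.
Qed.

(** The root of the tilt density is $e^{t\psi/2}$ over the root of the moment generating function.
    The latter is $1+O(t^2)$ because [psi] is centred, so the error is quadratic in [t], uniformly
    in [x]. *)
Lemma sqrt_tilt_expansion t x : `|t| * M <= 1 ->
  `|Num.sqrt (tilt_density P psi t x) - 1 - t / 2 * psi x| <=
  M ^+ 2 * expR 1 * (1 + expR 1) * t ^+ 2.
Proof.
move=> tM; rewrite sqrt_tilt_density; set m := mgf P psi t; set y := t / 2 * psi x.
have M0 : 0 <= M by apply: le_trans (psiM x).
have ym : `|y| <= `|t| * M.
  rewrite /y normrM ler_pM//; rewrite normrM [X in _ * X]ger0_norm ?invr_ge0//.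
  rewrite ler_piMr// ; lra.
have y1 : `|y| <= 1 by exact: le_trans ym tM.
have m1 : 1 <= m := mgf_ge1 t; have m0 : 0 < m by exact: lt_le_trans m1.
have s1 : 1 <= Num.sqrt m by rewrite -[leLHS]sqrtr1 ler_wsqrtr.
have s0 : 0 < Num.sqrt m by exact: lt_le_trans s1.
have sm : 0 <= 1 - (Num.sqrt m)^-1 <= t ^+ 2 * M ^+ 2 * expR 1.
  rewrite subr_ge0 invf_le1// s1/=.
  apply: (@le_trans _ _ (m - 1)); last by have := mgf_le tM; rewrite -/m; lra.
  have -> : 1 - (Num.sqrt m)^-1 = (Num.sqrt m - 1) / Num.sqrt m by field; rewrite gt_eqF.
  have mE := sqr_sqrtr (ltW m0).
  rewrite ler_pdivrMr//; move: s1 mE; set r := Num.sqrt m => s1 <-.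
  (* This product is [(r ^+ 2 - 1) * r - (r - 1)], the claim cleared of its denominator. *)
  have : 0 <= (r - 1) * (r * r + r - 1) by apply: mulr_ge0; nra.
  nra.
have e1 : expR y <= expR 1 by rewrite ler_expR (le_trans (ler_norm y)).
have t1 : `|expR y - 1 - y| <= t ^+ 2 * M ^+ 2 * expR 1.
  apply: (le_trans (expR_taylor1 y)); apply: ler_pM; rewrite ?exprn_ge0 ?expR_ge0//.
    rewrite -exprMn -[leRHS]ger0_norm ?sqr_ge0// normrX [in leRHS]normrM (ger0_norm M0).
    by rewrite lerXn2r ?nnegrE ?mulr_ge0.
  by rewrite ler_expR.
have -> : expR y / Num.sqrt m - 1 - y =
    (expR y - 1 - y) - expR y * (1 - (Num.sqrt m)^-1) by ring.
apply: (le_trans (ler_normB _ _)).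
have t2 : `|expR y * (1 - (Num.sqrt m)^-1)| <= expR 1 * (t ^+ 2 * M ^+ 2 * expR 1).
  case/andP: sm => sm0 sm1; rewrite ger0_norm ?mulr_ge0 ?expR_ge0//.
  by apply: ler_pM; rewrite ?expR_ge0.
apply: (le_trans (lerD t1 t2)); rewrite le_eqVlt; apply/orP; left; apply/eqP; ring.
Qed.

End tilt_bounds.

Section tilt_path.
Context (R : realType) (J K : nat) (B0 eps eta : R).
Notation O := ('I_J.+1 * 'I_K.+1 * R)%type.
Variable P : probability O R.
Hypotheses (eps_gt0 : 0 < eps) (eta_gt0 : 0 < eta)
  (P_bounded : P (@bounded_outcome R J K B0) = 1%E)
  (P_overlap : forall x a, eps + eta <= propensity P a x)
  (P_strata : forall x, 0 < pX P x).

Lemma overlap_cell_gt0 x a : 0 < fine (P (cell x a)).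
Proof.
have := P_overlap x a; rewrite /propensity ler_pdivlMr//; apply: lt_le_trans.
by rewrite mulr_gt0// addr_gt0.
Qed.

Variables (psi : O -> R) (bpsi : bounded_measurable psi).
Hypothesis psi0 : \int[P]_o psi o = 0.

(** The slack [eta] is spent here. With $u=|t|M$, tilting multiplies a propensity by at least
    $e^{-2u}\ge1-2u$, and the condition on [t] is exactly [(eps + eta) * (1 - 2 * u) >= eps]. *)
Lemma tilt_in_model (M t : R) : (forall o, `|psi o| <= M) ->
  2 * (`|t| * M) * (eps + eta) <= eta -> in_model B0 eps (tilt P bpsi t).
Proof.
move=> psiM tM; split.
  exact: tilt_full (@measurable_bounded_outcome R J K B0) P_bounded.
move=> x a; rewrite /propensity.
have /andP[lo _] := tilt_bounds P bpsi psiM t (@measurable_cell R J K x a).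
have /andP[_ up] := tilt_bounds P bpsi psiM t (@measurable_stratum R J K x).
move: lo up; rewrite -/(pX _ x) -/(pX P x).
set m := mgf P psi t; have m0 : 0 < m := mgf_gt0 P bpsi t.
set u := `|t| * M in tM *; set c := fine (tilt _ _ _ _); set p := pX _ x.
move=> lo up p0; rewrite ler_pdivlMr// -(ler_pM2r m0); apply: le_trans lo.
apply: (@le_trans _ _ (eps * (expR u * pX P x))); first by rewrite -mulrA ler_pM2l.
have := P_overlap x a; rewrite /propensity ler_pdivlMr// -/(pX P x) => ov.
apply: (@le_trans _ _ (expR (- u) * ((eps + eta) * pX P x))); last first.
  by rewrite ler_pM2l ?expR_gt0.
rewrite !mulrA ler_pM2r//.
have -> : eps * expR u = expR (- u) * (eps * expR (2 * u)).
  rewrite mulrCA -expRD; congr (_ * expR _); ring.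
rewrite ler_pM2l ?expR_gt0//.
have : expR (2 * u) * (1 - 2 * u) <= 1.
  rewrite -[leRHS](expRxMexpNx_1 (2 * u)) ler_pM2l ?expR_gt0//.
  by have := expR_ge1Dx (- (2 * u)); lra.
have e0 : 0 < expR (2 * u) := expR_gt0 _.
have ee : 0 < eps + eta by rewrite addr_gt0.
have h : eps <= (eps + eta) * (1 - 2 * u) by move: tM; lra.
move=> h2; apply: (@le_trans _ _ ((eps + eta) * (1 - 2 * u) * expR (2 * u))).
  by rewrite ler_pM2r.
by rewrite -mulrA ger_pMr// mulrC.
Qed.

(** [P] itself dominates every tilt and has density 1, so the uniform expansion of the root density
    bounds the DQM integral by a multiple of $t^2$. *)
Lemma tilt_path_dqm (s : R) :
  dqm_path B0 eps P (s *: psi) (fun t => tilt P bpsi (s * t)).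
Proof.
have [M M0 psiM] := bm_bound_gt0 bpsi.
have ee : 0 < eps + eta by rewrite addr_gt0.
pose e := eta / (2 * (eps + eta) * M * (`|s| + 1)).
have s1 : 0 < `|s| + 1 by rewrite ltr_wpDl.
exists e, (fun=> P), (fun t => tilt_density P psi (s * t)), (fun=> fun=> 1); split.
- by rewrite divr_gt0// !mulr_gt0.
- move=> t /andP[t0 te]; split.
  + apply: (tilt_in_model psiM); rewrite normrM (ger0_norm t0).
    move: te; rewrite ltr_pdivlMr ?mulr_gt0// => /ltW; apply: le_trans.
    rewrite (_ : 2 * (`|s| * t * M) * (eps + eta) =
      t * (2 * (eps + eta) * M * `|s|)); last by ring.
    by rewrite ler_wpM2l// ler_pM2l ?mulr_gt0// lerDl.
  + split; [exact: (bm_tilt_density P bpsi _).1|exact: (tilt_density_ge0 P bpsi)|].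
    by move=> B _; rewrite tiltE.
  + split=> //.
    by move=> B mB; rewrite -[X in (_ = \int[_]_(o in _) X o)%E]/(cst 1%E) integral_cst// mul1e.
- by move=> B mB; rewrite mulr0 tilt0.
pose r t (o : O) : R :=
  ((Num.sqrt (tilt_density P psi (s * t) o) - 1) / t - 2^-1 * (s * psi o)) ^+ 2.
have br t : bounded_measurable (r t).
  have b0 : bounded_measurable (fun o : O =>
      (Num.sqrt (tilt_density P psi (s * t) o) - 1) / t - 2^-1 * (s * psi o)).
    apply: bmB; last by apply: bmM; [exact: bm_cst|apply: bmM => //; exact: bm_cst].
    apply: bmM; last exact: bm_cst.
    apply: bmB; last exact: bm_cst.
    under eq_fun do rewrite (sqrt_tilt_density P bpsi).
    by apply: bmM; [exact: bm_exp_psi|exact: bm_cst].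
  by rewrite /r; under eq_fun do rewrite expr2; exact: bmM.
rewrite (_ : (fun t => _) = fun t => (\int[P]_o r t o)%:E); last first.
  apply/funext => t; rewrite -(bm_int_fin P (br t)).
  by apply: eq_integral => o _; rewrite sqrtr1 mulr1.
apply: cvg_EFin; first exact: nearW.
rewrite (_ : fine \o _ = fun t => \int[P]_o r t o)//.
pose C := M ^+ 2 * expR 1 * (1 + expR 1) * s ^+ 2.
have ub (t : R) : 0 < t -> `|s * t| * M <= 1 -> 0 <= \int[P]_o r t o <= (C * t) ^+ 2.
  move=> t0 st; rewrite Rintegral_ge0/=; last by move=> o _; exact: sqr_ge0.
  apply: Rint_le_cst => // o; rewrite /r.
  rewrite (_ : _ - _ =
    (Num.sqrt (tilt_density P psi (s * t) o) - 1 - s * t / 2 * psi o) / t); last first.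
    by field; rewrite gt_eqF.
  rewrite -ler_sqrt ?sqr_ge0// !sqrtr_sqr normrM normfV (gtr0_norm t0).
  rewrite ler_pdivrMr//; apply: (le_trans (sqrt_tilt_expansion bpsi psiM psi0 o st)).
  apply: le_trans (ler_wpM2r (ltW t0) (ler_norm _)).
  by rewrite le_eqVlt; apply/orP; left; apply/eqP; rewrite /C; ring.
have C2 : (C * t) ^+ 2 @[t --> 0^'+] --> (0 : R).
  have idR : (t : R) @[t --> 0^'+] --> (0 : R) by apply: cvg_at_right_filter; exact: cvg_id.
  have h : C * t @[t --> 0^'+] --> C * 0 by apply: cvgM; [exact: cvg_cst|].
  have : (C * t) * (C * t) @[t --> 0^'+] --> (C * 0) * (C * 0) by apply: cvgM.
  by rewrite mulr0 mul0r; under eq_fun do rewrite -expr2.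
apply: (@squeeze_cvgr _ _ _ _ (fun=> 0) (fun t => (C * t) ^+ 2)) => //; last exact: cvg_cst.
near=> t.
have t0 : 0 < t by near: t; exact: nbhs_right_gt.
apply: ub => //; rewrite normrM (gtr0_norm t0).
have : t <= ((`|s| + 1) * M)^-1.
  by near: t; apply: nbhs_right_le; rewrite invr_gt0 mulr_gt0.
rewrite -[X in _ <= X]mul1r ler_pdivlMr ?mulr_gt0//; apply: le_trans.
by rewrite -mulrA mulrCA ler_pM2l// ler_pM2r// lerDl.
Unshelve. all: by end_near. Qed.

Hypothesis V0 : 0 < \int[P]_o (psi o ^+ 2).

(** The target drifts along the path at the rate [gamma P (s *: psi)]. The hypothesis on [C]
    identifies this rate with [s] times the variance of [psi], the relation between drift and
    information that the Gaussian identity requires. *)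
Lemma regular_halfline_convolution (C : set (O -> R))
    (Tn : forall n, n.-tuple O -> R) (L : probability (measurableTypeR R) R) :
  (forall s : R, 0 <= s -> C (s *: psi) /\
     gamma P (s *: psi) = s * \int[P]_o (psi o ^+ 2)) ->
  (forall n, measurable_fun setT (Tn n)) ->
  regular_along B0 eps P C Tn L ->
  is_normal_convolution (\int[P]_o (psi o ^+ 2)) L.
Proof.
move=> HC mTn reg.
pose Pt s t := tilt P bpsi (s * t).
apply: (halfline_convolution (bpsi := bpsi) psi0 V0 mTn
  (theta := fun s n => Psi (Pt s (Num.sqrt n%:R)^-1)) (theta0 := Psi P)); last first.
  by move=> s s0; apply: reg (HC s s0).1 (tilt_path_dqm s).
move=> s s0; rewrite -(HC s s0).2.
have tp : tangent P (s *: psi).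
  by apply: tangentZ; apply/tangentP; split=> //; exact: L2_bm.
have d := directional_derivativeP P_bounded overlap_cell_gt0 P_strata tp (tilt_path_dqm s).
have c : (Num.sqrt (n%:R : R))^-1 @[n --> \oo] --> 0^'+.
  have c0 := @cvg_inv_sqrtn R; move=> A hA; have h : \forall n \near \oo,
    0 < (Num.sqrt (n%:R : R))^-1 -> A (Num.sqrt n%:R)^-1 := c0 _ hA.
  change (\forall n \near \oo, A (Num.sqrt n%:R)^-1); near=> n.
  have n0 : (0 : R) < (Num.sqrt n%:R)^-1.
    by rewrite invr_gt0 sqrtr_gt0 ltr0n; near: n; exact: nbhs_infty_gt.
  by move: n0; near: n.
have := cvg_comp _ _ c d.
by apply: cvg_trans; apply: near_eq_cvg; near=> n; rewrite /= invrK.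
Unshelve. all: by end_near. Qed.

End tilt_path.

Theorem corollary8 (R : realType) (J K : nat) (B0 eps eta : R)
    (P : probability ('I_J.+1 * 'I_K.+1 * R)%type R)
    (eps_gt0 : 0 < eps) (eta_gt0 : 0 < eta)
    (P_model : in_model B0 eps P)
    (P_overlap : forall x a, eps + eta <= propensity P a x)
    (P_strata : forall x, 0 < pX P x)
    (P_var : forall x a, 0 < sigma2 P a x) :
  [/\ directional_derivative B0 eps P (gamma P),
      unique_maximal_linearity_subspace P (gamma P) (Hkappa P),
      riesz_representer P (gamma P) (Hkappa P) (psi_kappa P) /\
      ('E_P[fun o => (psi_kappa P o ^+ 2)%R] = (Vkappa P)%:E)%E,
      forall (Tn : forall n, n.-tuple ('I_J.+1 * 'I_K.+1 * R)%type -> R)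
             (L : probability (measurableTypeR R) R),
        (forall n, measurable_fun setT (Tn n)) ->
        regular_along B0 eps P (Hkappa P) Tn L ->
        is_normal_convolution (Vkappa P) L &
      forall d : 'I_J.+1 -> 'I_K.+1, optimal_rule P d ->
      [/\ convex_cone (Ccone P d) /\ linear_span (Ccone P d) = tangent P,
          forall (Tn : forall n, n.-tuple ('I_J.+1 * 'I_K.+1 * R)%type -> R)
                 (L : probability (measurableTypeR R) R),
            (forall n, measurable_fun setT (Tn n)) ->
            regular_along B0 eps P (Ccone P d) Tn L ->
            is_normal_convolution (Vrule P d) L,
          Vrule P d - Vkappa P =
            \sum_x pX P x *
              (cvar P (d x) x - (\sum_(a in best P x) (cvar P a x)^-1)^-1),
          (exists x, (1 < #|best P x|)%N) -> 0 < Vrule P d - Vkappa P &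
          ~ (exists x, (1 < #|best P x|)%N) -> Vrule P d - Vkappa P = 0]].
Proof.
have P_bounded : P (@bounded_outcome R J K B0) = 1%E by case: P_model.
have Pc := overlap_cell_gt0 eps_gt0 eta_gt0 P_overlap P_strata.
have bk := bm_cell_score B0 P (fun x a => weight P a x / propensity P a x).
have k0 : \int[P]_o kappa_score B0 P o = 0.
  by have /tangentP[] := tangent_kappa_score P_bounded Pc.
have kV := Rint_kappa_score_sqr P_bounded Pc P_strata P_var.
split.
- exact: directional_derivativeP.
- exact: (Hkappa_unique_maximal P_bounded Pc P_strata).
- split; first exact: (psi_kappa_riesz P_bounded Pc P_strata P_var).
  exact: (psi_kappa_norm P_bounded Pc P_strata P_var).
- move=> Tn L mTn reg; rewrite -kV.
  apply: (regular_halfline_convolution eps_gt0 eta_gt0 P_bounded P_overlap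
    P_strata bk k0 _ _ mTn reg).
    by rewrite [ltRHS]kV; exact: Vkappa_gt0.
  move=> s s0; have Hs : Hkappa P (s *: kappa_score B0 P).
    have [H0 Hl] := Hkappa_subspace P_bounded Pc P_strata.
    have Hk := Hkappa_kappa_score P_bounded Pc P_strata P_var.
    by have := Hl s _ _ Hk H0; rewrite addr0.
  split=> //; rewrite (gamma_kappa_score P_bounded Pc P_strata P_var Hs).
  rewrite -RintZl; last by under eq_fun do rewrite expr2; exact: bmM.
  apply: eq_Rintegral => o _.
  by rewrite (_ : (s *: kappa_score B0 P) o = s * kappa_score B0 P o)// /kappa_score; ring.
move=> d dP.
have bd := bm_cell_score B0 P (fun x a => (a == d x)%:R / propensity P a x).
have dC := Ccone_rule_score P_bounded Pc P_strata P_var d.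
have d0 : \int[P]_o rule_score B0 P d o = 0 by have /tangentP[] := dC.1.
have dV := Rint_rule_score_sqr P_bounded Pc P_strata d.
split.
- split; first exact: (Ccone_convex_cone P_bounded Pc P_strata).
  exact: (Ccone_span P_bounded Pc P_strata P_var dP).
- move=> Tn L mTn reg; rewrite -dV.
  apply: (regular_halfline_convolution eps_gt0 eta_gt0 P_bounded P_overlap
    P_strata bd d0 _ _ mTn reg).
    by rewrite [ltRHS]dV; exact: Vrule_gt0.
  move=> s s0; have Cs : Ccone P d (s *: rule_score B0 P d).
    (* A convex cone is closed under positive multiples only; the zero score belongs to this one
       through [Hkappa P]. *)
    move: s0; rewrite le_eqVlt => /orP[/eqP <-|sp].
      rewrite scale0r; exact: (Hkappa_Ccone dP (Hkappa_subspace P_bounded Pc P_strata).1).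
    by have [_ Cs _] := Ccone_convex_cone P_bounded Pc P_strata d; exact: Cs.
  split=> //; rewrite (gamma_rule_score P_bounded Pc P_strata dP Cs).
  rewrite -RintZl; last by under eq_fun do rewrite expr2; exact: bmM.
  apply: eq_Rintegral => o _.
  by rewrite (_ : (s *: rule_score B0 P d) o = s * rule_score B0 P d o)// /rule_score; ring.
- exact: (Vrule_sub_Vkappa P d).
- exact: (Vkappa_lt_Vrule Pc P_strata P_var dP).
- exact: (Vkappa_eq_Vrule Pc P_strata P_var dP).
Qed.
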